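(* Let $\Delta\ge 0$, let $n,m\ge 1$ be integers, and let $f:\mathcal X^n\times\mathbb R^m\to\mathbb R^n$ be Lipschitz on bounded sets with $f(0,0)=0$. Assume that there exist a functional $V:\mathcal X^n\to\mathbb R_{\ge 0}$ which is Lipschitz on bounded sets, constants $\overline a,a>0$ and $c\ge 0$, and a function $\gamma\in\mathcal N$ such that, for all $\phi\in\mathcal X^n$ and all $v\in\mathbb R^m$, $$0\le V(\phi)\le \overline a\|\phi\|^2,$$ $$D^+V(\phi,f(\phi,v))\le -a|\phi(0)|^2+c\|\phi\|^2+\gamma(|v|).$$ Assume further that there exist a symmetric positive definite matrix $P\in\mathbb R^{n\times n}$ and a constant $\sigma>0$ such that, for all $\phi\in\mathcal X^n$ and all $v\in\mathbb R^m$, $$\phi(0)^\top P f(\phi,v)\le \sigma\left(\|\phi\|^2+\gamma(|v|)\right).$$ Then there exists $\bar c>0$ such that, if $c\in[0,\bar c)$, the system $\dot x(t)=f(x_t,u(t))$ is exp-ISS. If, in addition, there exists $\gamma_0\ge 0$ such that $\gamma(s)=\gamma_0 s^2$ for all $s\ge 0$, then the system is exp-ISS with linear gain.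
   Context: $\mathcal X^n$ is the set of continuous functions $\phi:[-\Delta,0]\to\mathbb R^n$, with $\|\phi\|=\max_{\tau\in[-\Delta,0]}|\phi(\tau)|$, where $|\cdot|$ is the Euclidean norm. A map is Lipschitz on bounded sets if its restriction to every bounded set is Lipschitz. $\mathcal U^m$ is the set of Lebesgue measurable, locally essentially bounded signals $u:\mathbb R_{\ge 0}\to\mathbb R^m$; $u_{[0,t]}$ is the restriction of $u$ to $[0,t]$ and $\|u_{[0,t]}\|$ its essential supremum norm. For a continuous $x:[-\Delta,T)\to\mathbb R^n$ and $t\in[0,T)$, $x_t\in\mathcal X^n$ is $x_t(\tau):=x(t+\tau)$, $\tau\in[-\Delta,0]$. For an initial state $x_0\in\mathcal X^n$ and $u\in\mathcal U^m$, the solution of $\dot x(t)=f(x_t,u(t))$ is the (unique, maximal) locally absolutely continuous solution, the equation holding for almost every $t\geq 0$ in the existence interval. Class $\mathcal N$: functions $\mathbb R_{\ge 0}\to\mathbb R_{\ge 0}$ that are continuous, non-decreasing and zero at zero. Driver derivative: for $V:\mathcal X^n\to\mathbb R_{\ge 0}$, $\phi\in\mathcal X^n$, $w\in\mathbb R^n$, $D^+V(\phi,w):=\limsup_{h\to 0^+}\frac{V(\phi_{h,w})-V(\phi)}{h}$, where for $h\in[0,\Delta)$, $\phi_{h,w}(s):=\phi(s+h)$ if $s\in[-\Delta,-h)$ and $\phi_{h,w}(s):=\phi(0)+(h+s)w$ if $s\in[-h,0]$. (If $\Delta=0$, $\mathcal X^n$ is identified with $\mathbb R^n$ and $\phi_{h,w}:=\phi(0)+hw$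 for $h\geq 0$.) Exp-ISS: the system is exp-ISS if there exist $k,\eta>0$ and $\mu\in\mathcal N$ such that, for all $x_0\in\mathcal X^n$ and all $u\in\mathcal U^m$, the solution exists for all $t\ge 0$ and satisfies $|x(t)|\le k\|x_0\|e^{-\eta t}+\mu(\|u_{[0,t]}\|)$ for all $t\ge 0$. It is exp-ISS with linear gain if this holds with $\mu(s)=\mu_0 s$ for some $\mu_0\ge 0$. *)

(* Defs.v *)
From HB Require Import structures.
From mathcomp Require Export all_boot all_order all_algebra.
From mathcomp Require Export all_classical all_reals all_analysis.
From mathcomp Require Export ess_sup_inf measurable_realfun.
Export numFieldNormedType.Exports.
Import Order.TTheory GRing.Theory Num.Theory.

Set Implicit Arguments.
Unset Strict Implicit.
Unset Printing Implicit Defensive.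

Local Open Scope classical_set_scope.
Local Open Scope ring_scope.

(* The library norm on matrices is the max norm, hence this definition (the two
   induce the same topology). *)
Definition enorm {R : realType} {n : nat} (v : 'cV[R]_n) : R :=
  Num.sqrt (\sum_(i < n) v i 0 ^+ 2).

(* An element of X^n is represented by any function R -> R^n that is continuous
   on [-Delta, 0]; its values elsewhere are irrelevant. In particular a map that
   is Lipschitz on bounded sets in the sense below takes the same value on two
   functions that agree on [-Delta, 0], so it is a map on X^n. *)
Definition hist_space {R : realType} (Delta : R) {n : nat}
    : set (R -> 'cV[R]_n) :=
  [set phi | {within `[- Delta, 0], continuous phi}].

Definition hist_norm {R : realType} (Delta : R) {n : nat}
    (phi : R -> 'cV[R]_n) : R :=
  sup [set enorm (phi tau) | tau in `[- Delta, 0]].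

Definition hist_at {R : realType} {n : nat} (x : R -> 'cV[R]_n) (t : R)
    : R -> 'cV[R]_n :=
  fun tau => x (t + tau).

Definition lipschitz_on_bounded_rhs {R : realType} (Delta : R) {n m : nat}
    (f : (R -> 'cV[R]_n) -> 'cV[R]_m -> 'cV[R]_n) : Prop :=
  forall B : set ((R -> 'cV[R]_n) * 'cV[R]_m),
    (forall p, B p -> hist_space Delta p.1) ->
    (exists r : R, forall p, B p -> hist_norm Delta p.1 + enorm p.2 <= r) ->
    exists L : R, forall p q, B p -> B q ->
      enorm (f p.1 p.2 - f q.1 q.2)
        <= L * (hist_norm Delta (p.1 \- q.1) + enorm (p.2 - q.2)).

Definition lipschitz_on_bounded_functional {R : realType} (Delta : R) {n : nat}
    (V : (R -> 'cV[R]_n) -> R) : Prop :=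
  forall B : set (R -> 'cV[R]_n),
    B `<=` hist_space Delta ->
    (exists r : R, forall phi, B phi -> hist_norm Delta phi <= r) ->
    exists L : R, forall phi psi, B phi -> B psi ->
      `|V phi - V psi| <= L * hist_norm Delta (phi \- psi).

(* Functions on [0, +oo) are represented by functions on R; nonnegativity on
   [0, +oo) follows from the last two conditions. *)
Definition class_N {R : realType} (g : R -> R) : Prop :=
  [/\ {within `[0, +oo[, continuous g},
      (forall s t : R, 0 <= s -> s <= t -> g s <= g t)
    & g 0 = 0].

(* For Delta = 0 only the value at s = 0 matters, and it is phi 0 + h w. *)
Definition driver_shift {R : realType} {n : nat} (phi : R -> 'cV[R]_n)
    (h : R) (w : 'cV[R]_n) : R -> 'cV[R]_n :=
  fun s => if s < - h then phi (s + h) else phi 0 + (h + s) *: w.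

Definition driver_derivative {R : realType} {n : nat}
    (V : (R -> 'cV[R]_n) -> R) (phi : R -> 'cV[R]_n) (w : 'cV[R]_n) : \bar R :=
  limf_esup (fun h : R => ((V (driver_shift phi h w) - V phi) / h)%:E) 0^'+.

(* Essential supremum norm of u on [0, t]: |u| is extended by 0, which
   changes nothing for t > 0 and gives 0 for t = 0. *)
Definition input_norm {R : realType} {m : nat} (u : R -> 'cV[R]_m) (t : R)
    : \bar R :=
  ess_sup (@lebesgue_measure R) ((fun s => (enorm (u s))%:E) \_ `[0, t]).

(* The measurable sets of measurableTypeR R are the Borel sets; Lebesgue
   measurability refers to their completion. *)
Definition input_space {R : realType} {m : nat} : set (R -> 'cV[R]_m) :=
  [set u : R -> 'cV[R]_m |
    (forall i : 'I_m,
      measurable_fun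
        (`[0, +oo[%classic
          : set (g_sigma_algebraType (completed_algebra_gen (@lebesgue_measure R))))
        (fun t : R => u t i 0 : measurableTypeR R)) /\
    (forall t : R, 0 <= t -> (input_norm u t < +oo)%E)].

Definition abs_continuous {R : realType} {n : nat} (a b : R)
    (x : R -> 'cV[R]_n) : Prop :=
  forall eps : R, 0 < eps -> exists2 delta : R, 0 < delta &
    forall (N : nat) (l r : 'I_N -> R),
      (forall i, a <= l i /\ l i <= r i /\ r i <= b) ->
      trivIset [set: 'I_N] (fun i => `]l i, r i[%classic) ->
      \sum_(i < N) (r i - l i) < delta ->
      \sum_(i < N) enorm (x (r i) - x (l i)) < eps.

(* x solves x'(t) = f(x_t, u(t)) on [-Delta, T), T in (0, +oo]; the values of x
   outside [-Delta, T) are irrelevant. *)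
Definition solution {R : realType} (Delta : R) {n m : nat}
    (f : (R -> 'cV[R]_n) -> 'cV[R]_m -> 'cV[R]_n)
    (x0 : R -> 'cV[R]_n) (u : R -> 'cV[R]_m)
    (T : \bar R) (x : R -> 'cV[R]_n) : Prop :=
  [/\ (0 < T)%E,
      {within [set t : R | - Delta <= t /\ (t%:E < T)%E], continuous x},
      (forall t : R, - Delta <= t <= 0 -> x t = x0 t),
      (forall b : R, 0 <= b -> (b%:E < T)%E -> abs_continuous 0 b x)
    & {ae (@lebesgue_measure R), forall t : R, 0 <= t -> (t%:E < T)%E ->
        is_derive t 1 x (f (hist_at x t) (u t))}].

Definition maximal_solution {R : realType} (Delta : R) {n m : nat}
    (f : (R -> 'cV[R]_n) -> 'cV[R]_m -> 'cV[R]_n)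
    (x0 : R -> 'cV[R]_n) (u : R -> 'cV[R]_m)
    (T : \bar R) (x : R -> 'cV[R]_n) : Prop :=
  solution Delta f x0 u T x /\
  forall (T' : \bar R) (x' : R -> 'cV[R]_n),
    solution Delta f x0 u T' x' -> (T <= T')%E ->
    (forall t : R, - Delta <= t -> (t%:E < T)%E -> x' t = x t) ->
    T' = T.

Definition exp_iss_estimate {R : realType} (Delta : R) {n m : nat}
    (f : (R -> 'cV[R]_n) -> 'cV[R]_m -> 'cV[R]_n)
    (k eta : R) (mu : R -> R) : Prop :=
  forall (x0 : R -> 'cV[R]_n) (u : R -> 'cV[R]_m),
    hist_space Delta x0 -> input_space u ->
    (exists T x, maximal_solution Delta f x0 u T x) /\
    (forall T x, maximal_solution Delta f x0 u T x ->
      T = +oo%E /\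
      forall t : R, 0 <= t ->
        enorm (x t) <= k * hist_norm Delta x0 * expR (- (eta * t))
                       + mu (fine (input_norm u t))).

Definition exp_iss {R : realType} (Delta : R) {n m : nat}
    (f : (R -> 'cV[R]_n) -> 'cV[R]_m -> 'cV[R]_n) : Prop :=
  exists (k eta : R) (mu : R -> R),
    [/\ 0 < k, 0 < eta, class_N mu & exp_iss_estimate Delta f k eta mu].

Definition exp_iss_linear_gain {R : realType} (Delta : R) {n m : nat}
    (f : (R -> 'cV[R]_n) -> 'cV[R]_m -> 'cV[R]_n) : Prop :=
  exists k eta mu0 : R,
    [/\ 0 < k, 0 < eta, 0 <= mu0
      & exp_iss_estimate Delta f k eta (fun s => mu0 * s)].

(* Main.v *)
(* Along a trajectory, U(t) = max_{-Delta <= tau <= 0} (1 + lambda tau) q(t + tau)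
   with q = x^T P x decays at rate lambda unless the maximum is attained at
   tau = 0, and in that case the growth hypothesis on P bounds its derivative by
   a multiple of q(t) + gamma(|u|). Hence W = V + kappa U satisfies
   D^+ W <= - eta W + const * gamma(|u|) for kappa and c small, W dominates
   |x(t)|^2 and W(0) is at most a multiple of ||x0||^2, which gives the estimate
   by a Gronwall argument. Local solutions come from Picard iteration, and the a
   priori bound makes them global. *)
Require Import Defs.
From mathcomp Require Import ring lra.
Import Order.TTheory GRing.Theory Num.Theory.

Set Implicit Arguments.
Unset Strict Implicit.
Unset Printing Implicit Defensive.

Local Open Scope classical_set_scope.
Local Open Scope ring_scope.

(** * Quadratic forms and the Euclidean norm *)

Section QuadraticForms.
Variables (R : realType) (n : nat).
Implicit Types (P : 'M[R]_n) (x y z : 'cV[R]_n).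

(** [V] may vanish away from 0 and dissipates only through |phi(0)|^2. The term [kappa U] repairs
    both: U dominates ||phi||^2, and its decay at rate lambda is what absorbs c ||phi||^2. The
    obstacle is regularity. The initial history is merely continuous, so t -> x_t need not be
    Lipschitz in the sup norm, and an inequality on D^+ W that holds almost everywhere does not by
    itself bound W. Two facts valid at every time make up for it: to the right, W grows at a bounded
    rate, and from the left it cannot jump up. The first holds because x_{t+h} and the driver shift
    share the old part of the history exactly, whatever its regularity, and differ by O(h) on the
    new part. The threshold for c depends only on Delta, a, sigma and two bounds on P, so it is
    fixed before f, V and gamma. For a given t the input enters through the constant ||u_{[0,t]}||
    alone; taking square roots in the quadratic estimate halves the rate and produces a gain of the
    form sqrt(const * gamma). *)

Definition bform P x y : R := (x^T *m P *m y) 0 0.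

Lemma bformDl P x y z : bform P (x + y) z = bform P x z + bform P y z.
Proof. by rewrite /bform linearD/= !mulmxDl mxE. Qed.

Lemma bformDr P x y z : bform P x (y + z) = bform P x y + bform P x z.
Proof. by rewrite /bform mulmxDr mxE. Qed.

Lemma bformZl P (k : R) x y : bform P (k *: x) y = k * bform P x y.
Proof. by rewrite /bform linearZ/= -!scalemxAl mxE. Qed.

Lemma bformZr P (k : R) x y : bform P x (k *: y) = k * bform P x y.
Proof. by rewrite /bform -scalemxAr mxE. Qed.

Lemma bform_sym P x y : P^T = P -> bform P x y = bform P y x.
Proof.
move=> PT; rewrite /bform.
have -> : x^T *m P *m y = (y^T *m P *m x)^T by rewrite !trmx_mul trmxK PT mulmxA.
by rewrite mxE.
Qed.

Lemma bformE P x y : bform P x y = \sum_j (\sum_i x i 0 * P i j) * y j 0.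
Proof.
rewrite /bform mxE; apply: eq_bigr => j _; congr (_ * _); rewrite mxE.
by apply: eq_bigr => i _; rewrite mxE.
Qed.

(** The form is nonnegative on every combination s x + t y; s = -B and t = A yield A (A C - B^2) >=
    0. Semidefiniteness leaves the case A = 0 to be treated apart. *)
Lemma bform_CauchySchwarz P x y : P^T = P -> (forall z, 0 <= bform P z z) ->
  bform P x y ^+ 2 <= bform P x x * bform P y y.
Proof.
move=> PT P0; set A := bform P x x; set B := bform P x y; set C := bform P y y.
have H t s : 0 <= s ^+ 2 * A + 2 * s * t * B + t ^+ 2 * C.
  have := P0 (s *: x + t *: y).
  rewrite bformDl !bformDr !bformZl !bformZr (bform_sym y x PT) -/A -/B -/C.
  by congr (0 <= _); ring.
have A0 : 0 <= A := P0 x.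
have C0 : 0 <= C := P0 y.
have [A0'|Apos] := eqVneq A 0.
  (* With A = 0, taking t = -B and s = C + 1 gives 0 <= -(C + 2) B^2, which forces B = 0. *)
  have := H (- B) (C + 1); rewrite A0' => H1.
  rewrite mul0r; have [->|B0] := eqVneq B 0; first by rewrite expr0n.
  have : 0 < B ^+ 2 by rewrite exprn_even_gt0.
  by nra.
have {A0 Apos}Apos : 0 < A by rewrite lt_neqAle eq_sym Apos.
have := H A (- B); have -> : (- B) ^+ 2 * A + 2 * - B * A * B + A ^+ 2 * C
  = A * (A * C - B ^+ 2) by ring.
by rewrite pmulr_rge0// subr_ge0.
Qed.

Lemma enorm_sqrE x : enorm x ^+ 2 = bform 1%:M x x.
Proof.
rewrite /enorm sqr_sqrtr ?sumr_ge0// => [|i _]; last exact: sqr_ge0.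
rewrite /bform mulmx1 mxE; apply: eq_bigr => i _.
by rewrite mxE expr2.
Qed.

Lemma enorm_ge0 x : 0 <= enorm x.
Proof. exact: sqrtr_ge0. Qed.

Lemma bform1_ge0 z : 0 <= bform 1%:M z z.
Proof. by rewrite -enorm_sqrE sqr_ge0. Qed.

Lemma enorm_le x (r : R) : 0 <= r -> enorm x ^+ 2 <= r ^+ 2 -> enorm x <= r.
Proof. by move=> r0; rewrite ler_pXn2r// nnegrE ?enorm_ge0. Qed.

Lemma enormD x y : enorm (x + y) <= enorm x + enorm y.
Proof.
apply: enorm_le; first by rewrite addr_ge0 ?enorm_ge0.
have I1 : (1%:M : 'M[R]_n)^T = 1%:M by rewrite trmx1.
have CS := bform_CauchySchwarz x y I1 bform1_ge0.
rewrite sqrrD !enorm_sqrE bformDl !bformDr (bform_sym y x I1).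
have : bform 1%:M x y <= enorm x * enorm y.
  apply: le_trans (ler_norm _) _.
  rewrite -(@ler_pXn2r _ 2)// ?nnegrE ?mulr_ge0 ?enorm_ge0//.
  by rewrite real_normK ?num_real// exprMn !enorm_sqrE.
by lra.
Qed.

Lemma enorm0 : enorm (0 : 'cV[R]_n) = 0.
Proof.
by rewrite /enorm big1 ?sqrtr0// => i _; rewrite mxE expr0n.
Qed.

Lemma enormZ (k : R) x : enorm (k *: x) = `|k| * enorm x.
Proof.
rewrite /enorm -sqrtr_sqr -sqrtrM ?sqr_ge0//; congr Num.sqrt.
by rewrite mulr_sumr; apply: eq_bigr => i _; rewrite mxE exprMn.
Qed.

Lemma enormN x : enorm (- x) = enorm x.
Proof. by rewrite -scaleN1r enormZ normrN1 mul1r. Qed.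

Lemma enorm_distC x y : enorm (x - y) = enorm (y - x).
Proof. by rewrite -opprB enormN. Qed.

Lemma enormB x y : enorm (x - y) <= enorm x + enorm y.
Proof. by rewrite -(enormN y) enormD. Qed.

Lemma enorm_triangle y x z : enorm (x - z) <= enorm (x - y) + enorm (y - z).
Proof. by have := enormD (x - y) (y - z); rewrite addrA subrK. Qed.

Lemma enorm_dist_dist x y : `|enorm x - enorm y| <= enorm (x - y).
Proof.
rewrite ler_norml; have := enormD (x - y) y; have := enormD (y - x) x.
by rewrite !subrK enorm_distC; lra.
Qed.

Lemma enorm_eq0 x : enorm x = 0 -> x = 0.
Proof.
move=> /eqP; rewrite sqrtr_eq0 => h; apply/matrixP => i j; rewrite ord1 mxE.
apply/eqP; rewrite -sqrf_eq0 eq_le sqr_ge0 andbT; apply: le_trans h.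
by rewrite (bigD1 i)//= lerDl sumr_ge0// => k _; exact: sqr_ge0.
Qed.

Lemma coord_le_enorm x i : `|x i 0| <= enorm x.
Proof.
rewrite -sqrtr_sqr; apply: ler_wsqrtr.
by rewrite (bigD1 i)//= lerDl sumr_ge0// => k _; exact: sqr_ge0.
Qed.

Lemma enorm_le_sum x : enorm x <= \sum_i `|x i 0|.
Proof.
apply: enorm_le; first exact: sumr_ge0.
rewrite sqr_sqrtr ?sumr_ge0// => [|i _]; last exact: sqr_ge0.
rewrite expr2 mulr_suml; apply: ler_sum => i _.
rewrite -normr_id -(ger0_norm (sqr_ge0 (x i 0))) normrX expr2 normr_id.
apply: ler_wpM2l => //.
by rewrite (bigD1 i)//= lerDl sumr_ge0.
Qed.

Lemma enorm_le_coord x (r : R) : (forall i, `|x i 0| <= r) ->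
  enorm x <= n%:R * r.
Proof.
move=> xr; apply: le_trans (enorm_le_sum x) _.
by apply: le_trans (ler_sum _ (fun i _ => xr i)) _; rewrite sumr_const card_ord mulr_natl.
Qed.

Lemma norm_le_enorm x : `|x| <= enorm x.
Proof.
rewrite [leLHS]mx_normrE; apply/bigmax_leP; split; first exact: enorm_ge0.
by move=> [i j] _ /=; rewrite ord1; exact: coord_le_enorm.
Qed.

Lemma coord_le_norm x i : `|x i 0| <= `|x|.
Proof.
by rewrite [leRHS]mx_normrE; exact: (@le_bigmax_cond _ _ _ _ (i, ord0)).
Qed.

Lemma enorm_le_norm x : enorm x <= n%:R * `|x|.
Proof. by apply: enorm_le_coord => i; exact: coord_le_norm. Qed.

(** Stands in for the smallest eigenvalue: the vectors e_i = P^-1 delta_i represent the coordinates,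
    z_i = e_i^T P z, so Cauchy-Schwarz bounds z_i^2 by (e_i^T P e_i)(z^T P z). Summing over i gives
    the constant; adding 1 makes it positive at once. *)
Lemma posdef_lower P : P^T = P -> (forall z, z != 0 -> 0 < bform P z z) ->
  exists2 p : R, 0 < p & forall z, p * enorm z ^+ 2 <= bform P z z.
Proof.
move=> PT Ppos.
have b0 z : bform P z 0 = 0 by rewrite -(scale0r 0) bformZr mul0r.
have P0 z : 0 <= bform P z z.
  by have [->|/Ppos/ltW//] := eqVneq z 0; rewrite b0.
have Pu : P \in unitmx.
  rewrite -row_free_unit -kermx_eq0; apply/eqP/row_matrixP => i.
  rewrite row0; set v := row i _.
  have vP : v *m P = 0 by rewrite /v -row_mul mulmx_ker row0.
  apply/eqP/negPn/negP => v0.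
  have : v^T != 0 by rewrite -(inj_eq (@trmx_inj _ _ _)) trmxK trmx0.
  by move=> /Ppos; rewrite /bform trmxK vP mul0mx mxE ltxx.
pose e i : 'cV[R]_n := invmx P *m delta_mx i 0.
have eP i z : bform P (e i) z = z i 0.
  rewrite bform_sym// /bform /e -mulmxA mulKVmx// mxE (bigD1 i)//= big1 ?addr0.
    by rewrite !mxE !eqxx mulr1.
  by move=> j ji; rewrite !mxE (negPf ji) mulr0.
pose S : R := \sum_i bform P (e i) (e i) + 1.
have S0 : 0 < S by rewrite ltr_wpDl// sumr_ge0// => i _; exact: P0.
exists S^-1; first by rewrite invr_gt0.
move=> z; rewrite ler_pdivrMl// sqr_sqrtr ?sumr_ge0// => [|i _]; last exact: sqr_ge0.
apply: (@le_trans _ _ ((\sum_i bform P (e i) (e i)) * bform P z z)).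
  rewrite mulr_suml; apply: ler_sum => i _; rewrite -[in leLHS](eP i z).
  exact: bform_CauchySchwarz.
by apply: ler_wpM2r; rewrite ?P0// /S lerDl.
Qed.

Lemma bform_upper P :
  exists2 p : R, 0 < p & forall x y, `|bform P x y| <= p * (enorm x * enorm y).
Proof.
exists (\sum_j \sum_i `|P i j| + 1).
  by rewrite ltr_wpDl// sumr_ge0// => j _; exact: sumr_ge0.
move=> x y; rewrite bformE.
apply: (@le_trans _ _ ((\sum_j \sum_i `|P i j|) * (enorm x * enorm y))); last first.
  by apply: ler_wpM2r; rewrite ?mulr_ge0 ?enorm_ge0// lerDl.
apply: le_trans (ler_norm_sum _ _ _) _; rewrite mulr_suml; apply: ler_sum => j _.
rewrite normrM mulrA; apply: ler_pM; rewrite ?normr_ge0 ?coord_le_enorm//.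
apply: le_trans (ler_norm_sum _ _ _) _; rewrite mulr_suml; apply: ler_sum => i _.
by rewrite normrM mulrC; apply: ler_wpM2l => //; exact: coord_le_enorm.
Qed.

End QuadraticForms.

(** * Convergence and derivatives in the Euclidean norm *)

Section EnormTopology.
Variables (R : realType) (n : nat).

(** Bridges the Euclidean norm and the max norm that carries the topology; n + 1 instead of n keeps
    the divisor positive when n = 0. *)
Lemma cvg_enorm (T : Type) (F : set_system T) {FF : Filter F} (f : T -> 'cV[R]_n)
    (l : 'cV[R]_n) :
  f @ F --> l <-> forall e, 0 < e -> \forall t \near F, enorm (f t - l) <= e.
Proof.
split=> [fl e e0|H].
  have N0 : 0 < n%:R + 1 :> R by rewrite ltr_wpDl.
  near=> t; apply: le_trans (enorm_le_norm _) _.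
  have : `|l - f t| <= e / (n%:R + 1).
    by near: t; apply: cvgr_dist_le => //; rewrite divr_gt0.
  rewrite ler_pdivlMr// distrC => H.
  by apply: le_trans H; rewrite mulrC; apply: ler_wpM2l; rewrite ?lerDl.
apply/cvgrPdist_le => e e0; near=> t.
rewrite distrC; apply: le_trans (norm_le_enorm _) _.
by near: t; exact: H.
Unshelve. all: by end_near. Qed.

Lemma enorm_cvg (T : Type) (F : set_system T) {FF : Filter F} (f : T -> 'cV[R]_n)
    (l : 'cV[R]_n) : f @ F --> l -> enorm (f t) @[t --> F] --> enorm l.
Proof.
move=> /cvg_enorm fl; apply/cvgrPdist_le => e /fl; apply: filterS => t.
by apply: le_trans; rewrite distrC; exact: enorm_dist_dist.
Qed.

(** The remainder form avoids difference quotients and is trivial at h = 0, so a full neighbourhood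
    replaces the punctured one. *)
Lemma is_derive_enormP (x : R -> 'cV[R]_n) (t : R) w :
  is_derive t 1 x w <-> forall e, 0 < e ->
    \forall h \near (0 : R), enorm (x (t + h) - x t - h *: w) <= e * `|h|.
Proof.
split=> [[dx xw] e e0|H].
  have : h^-1 *: (x (h *: 1 + t) - x t) @[h --> 0^'] --> w.
    by rewrite -xw; exact: dx.
  move=> /cvg_enorm /(_ _ e0); rewrite near_withinE.
  apply: filterS => h; have [->|h0] := eqVneq h 0.
    by move=> _; rewrite addr0 subrr scale0r subrr enorm0 normr0 mulr0.
  move=> /(_ isT); rewrite scaler1 (addrC h t) => H.
  rewrite -[_ - _ - _](scalerKV h0) enormZ mulrC.
  by apply: ler_wpM2r => //; rewrite scalerBr scalerK.
have K : h^-1 *: (x (h *: 1 + t) - x t) @[h --> 0^'] --> w.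
  apply/cvg_enorm => e /H; rewrite near_withinE.
  apply: filterS => h xh h0; rewrite scaler1 (addrC h t).
  have hp : 0 < `|h| by rewrite normr_gt0.
  rewrite -(ler_pM2r hp); apply: le_trans xh.
  by rewrite mulrC -enormZ scalerBr scalerKV.
apply: DeriveDef; first by apply/cvg_ex; exists w.
by apply/cvg_lim => //; exact: norm_hausdorff.
Qed.

End EnormTopology.

(** * Monotonicity from almost everywhere derivative bounds *)

Section RealInduction.
Variable R : realType.
Implicit Types (a b t : R).

Lemma near0P (P : R -> Prop) :
  (\forall h \near (0 : R), P h) <-> exists2 d, 0 < d & forall h, `|h| < d -> P h.
Proof.
split=> [/nbhs_ballP[d /= d0 H]|[d d0 H]].
  by exists d => // h hd; apply: H; rewrite /ball/= sub0r normrN.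
by apply/nbhs_ballP; exists d => //= h; rewrite /ball/= sub0r normrN; exact: H.
Qed.

Lemma near0rP (P : R -> Prop) :
  (\forall h \near (0 : R)^'+, P h) <->
  exists2 d, 0 < d & forall h, 0 < h < d -> P h.
Proof.
rewrite near_withinE; split=> [/near0P[d d0 H]|[d d0 H]].
  by exists d => // h /andP[h0 hd]; apply: H => //; rewrite gtr0_norm.
apply/near0P; exists d => // h hd h0.
by apply: H; rewrite h0/= (le_lt_trans (ler_norm h)).
Qed.

(** The supremum of the times up to which [P] holds throughout satisfies [P] by the limit
    hypothesis, and the step hypothesis pushes beyond it unless it is b. *)
Lemma real_induction (P : R -> Prop) a b : a <= b -> P a ->
  (forall t, a <= t < b -> P t ->
    exists2 d, 0 < d & forall h, 0 < h < d -> t + h <= b -> P (t + h)) ->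
  (forall t, a < t <= b -> (forall s, a <= s < t -> P s) -> P t) ->
  P b.
Proof.
move=> ab Pa step lim.
pose S := [set t | a <= t <= b /\ forall s, a <= s <= t -> P s].
have Sa : S a.
  by split; rewrite ?lexx// => s /le_anti <-.
have Sub : has_ubound S by exists b => t [/andP[]].
have aT : a <= sup S by exact: ub_le_sup.
have Tb : sup S <= b by apply: ge_sup; [exists a|move=> t [/andP[]]].
have PltT s : a <= s < sup S -> P s.
  move=> /andP[as_ sT].
  have [||t [_ tP] st] := @sup_gt _ S s => //; first by exists a.
  by apply: tP; rewrite as_ ltW.
have PT : P (sup S).
  have [->//|aT'] := eqVneq (sup S) a.
  by apply: lim => //; rewrite Tb lt_neqAle eq_sym aT' aT.
have PleT s : a <= s <= sup S -> P s.
  move=> /andP[as_]; rewrite le_eqVlt => /predU1P[->//|sT].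
  by apply: PltT; rewrite as_.
have [<-//|Tb'] := eqVneq (sup S) b.
have {Tb'}Tb' : sup S < b by rewrite lt_neqAle Tb' Tb.
have [|d d0 H] := step (sup S) _ PT; first by rewrite aT.
pose h := Num.min (d / 2) (b - sup S).
have h0 : 0 < h by rewrite lt_min divr_gt0//= subr_gt0.
have hd : h < d by rewrite gt_min ltr_pdivrMr// mulr_natr mulr2n ltrDl d0.
have hb : h <= b - sup S by rewrite ge_min lexx orbT.
suff : S (sup S + h) by move=> /(ub_le_sup Sub); lra.
split; first by lra.
move=> s /andP[as_ sh]; have [sT|sT] := leP s (sup S).
  by apply: PleT; rewrite as_.
have := H (s - sup S); rewrite (addrC (sup S)) subrK; apply; first by apply/andP; split; lra.
by lra.
Qed.

End RealInduction.

Section AlmostEverywhere.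
Variable R : realType.
Local Notation mu := (@lebesgue_measure R).
Implicit Types (a b t C : R).

Lemma lebesgue_measure_mono (A B : set R) : measurable A -> measurable B ->
  A `<=` B -> (mu A <= mu B)%E.
Proof. by move=> mA mB AB; apply: le_measure; rewrite ?inE. Qed.

Lemma lebesgue_measure_leU (A B : set R) : measurable A -> measurable B ->
  (mu (A `|` B) <= mu A + mu B)%E.
Proof. by move=> mA mB; exact: measureU2. Qed.

Lemma lebesgue_measure_setU (A B : set R) : measurable A -> measurable B ->
  A `&` B = set0 -> mu (A `|` B) = (mu A + mu B)%E.
Proof. by move=> mA mB AB; exact: measureU. Qed.

Lemma negligible_open_cover (E : set R) (e : R) : mu.-negligible E -> 0 < e ->
  exists U : set R, [/\ open U, E `<=` U & (mu U < e%:E)%E].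
Proof.
move=> [N [mN N0 EN]] e0.
have [|U [oU NU Ue]] := lebesgue_regularity_outer mN _ e0.
  by apply: le_lt_trans (ltry 0); rewrite le_eqVlt; apply/orP; left; apply/eqP; exact: N0.
exists U; split => //; first exact: subset_trans NU.
have mU : measurable U by exact: open_measurable.
have mUN : measurable (U `\` N) by exact: measurableD.
have -> : U = N `|` (U `\` N).
  apply/seteqP; split=> x; last by move=> [/NU//|[]].
  by move=> Ux; have [xN|xN] := pselect (N x); [left|right].
apply: le_lt_trans Ue; apply: le_trans (lebesgue_measure_leU mN mUN) _.
by rewrite [X in (X + _)%E](_ : _ = 0%E) ?add0e//; exact: N0.
Qed.

Lemma lebesgue_measure_seg a b : a <= b -> mu `]a, b] = (b - a)%:E.
Proof.
rewrite le_eqVlt => /predU1P[->|ab].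
  by rewrite set_itv_ge ?bnd_simp ?ltxx// measure0 subrr.
by rewrite lebesgue_measure_itv/= lte_fin ab EFinN.
Qed.

(* The exceptional null set is covered by an open set U of small measure; the
   growth of w over the part of [a, t] lying in U is at most C mu(U). *)
Lemma dini_nonincreasing (w : R -> R) a b C : a <= b -> 0 <= C ->
  (forall t e, a < t <= b -> 0 < e ->
    exists2 d, 0 < d & forall s, a <= s -> t - d < s < t -> w t <= w s + e) ->
  (forall t, a <= t < b -> \forall h \near 0^'+, w (t + h) <= w t + C * h) ->
  {ae mu, forall t, a <= t < b -> forall e, 0 < e ->
    \forall h \near 0^'+, w (t + h) <= w t + e * h} ->
  w b <= w a.
Proof.
move=> ab C0 wl wC waE.
suff H e : 0 < e -> w b <= w a + e * (b - a) + C * e.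
  apply/ler_addgt0Pr => e e0; pose k := (b - a) + C + 1.
  have k0 : 0 < k by rewrite /k; lra.
  have := H (e / k) (divr_gt0 e0 k0) => Hb; apply: (le_trans Hb).
  rewrite -addrA lerD2l (mulrC C) -mulrDr -[leRHS](divfK (lt0r_neq0 k0)).
  by apply: ler_wpM2l; [rewrite ltW// divr_gt0|rewrite /k lerDl].
move=> e0; have [U [oU EU Ue]] := negligible_open_cover waE e0.
have mU : measurable U by exact: open_measurable.
pose A t := U `&` `]a, t].
have mA t : measurable (A t) by exact: measurableI.
have Ale t : (mu (A t) <= mu U)%E.
  by apply: lebesgue_measure_mono => //; exact: subIsetl.
have Afin t : mu (A t) \is a fin_num.
  rewrite ge0_fin_numE ?measure_ge0//.
  by apply: le_lt_trans (Ale t) _; apply: lt_trans Ue _; rewrite ltry.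
pose v t := fine (mu (A t)).
have v_mono s t : s <= t -> v s <= v t.
  move=> st; apply: fine_le => //; apply: lebesgue_measure_mono => //.
  apply: setIS => x /=; rewrite !in_itv/= => /andP[-> xs] /=.
  exact: le_trans xs st.
have v_ge0 t : 0 <= v t by rewrite fine_ge0.
have v_e t : v t <= e.
  by rewrite -lee_fin fineK//; apply: le_trans (Ale t) _; exact: ltW.
suff : w b <= w a + e * (b - a) + C * v b.
  by have := ler_wpM2l C0 (v_e b); lra.
apply: (@real_induction _ (fun t => w t <= w a + e * (t - a) + C * v t) a b) => //.
- by rewrite subrr mulr0 addr0 lerDl mulr_ge0.
- move=> t /andP[at_ tb] IH.
  (* Inside the open set U, [v] grows by exactly h, which pays for the crude rate C; outside U the
     almost everywhere bound gives the rate e. *)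
  have [tU|tU] := pselect (U t).
    have /nbhs_ballP[d1 /= d10 H1] : nbhs t U by rewrite nbhsE/=; exists U.
    have /near0rP[d2 d20 H2] := wC t ltac:(by rewrite at_).
    exists (Num.min d1 d2); first by rewrite lt_min d10.
    move=> h /andP[h0]; rewrite lt_min => /andP[hd1 hd2] thb.
    apply: le_trans (H2 h _) _; first by rewrite h0.
    suff : v t + h <= v (t + h).
      by move=> /(ler_wpM2l C0); move: IH (mulr_gt0 e0 h0); rewrite mulrDr; lra.
    have AE : A (t + h) = A t `|` `]t, t + h].
      apply/seteqP; split=> x /=.
        move=> [Ux]; rewrite /= !in_itv/= => /andP[ax xth].
        by have [xt|xt] := leP x t; [left; rewrite /A/= in_itv/= ax|right; rewrite xth].
      rewrite /A/= !in_itv/=; move=> [[Ux /andP[ax xt]]|/andP[tx xth]].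
        by split=> //; rewrite ax/=; lra.
      split; last by rewrite xth andbT; lra.
      by apply: H1; rewrite /ball/= ltr0_norm ?subr_lt0//; lra.
    rewrite /v AE [in leRHS]lebesgue_measure_setU//; last first.
      apply/seteqP; split=> x //=; rewrite /A/= !in_itv/=.
      by move=> [[_ /andP[_ xt]] /andP[tx _]]; move: (le_lt_trans xt tx); rewrite ltxx.
    have th : t <= t + h by lra.
    rewrite (lebesgue_measure_seg th) fineD//= lerD2l.
    by lra.
  have Qt : forall t', ~ U t' -> a <= t' < b -> forall e, 0 < e ->
      \forall h \near 0^'+, w (t' + h) <= w t' + e * h.
    by move=> t' Ut'; apply: contrapT => nQ; apply: Ut'; exact: EU.
  have /near0rP[d d0 H] := Qt t tU ltac:(by rewrite at_) e e0.
  exists d => // h /[dup] /andP[h0 _] /H th _.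
  have := ler_wpM2l C0 (v_mono t (t + h) ltac:(by rewrite lerDl ltW)).
  by move: th IH; rewrite !mulrBr mulrDr; lra.
(* The bound known at one s just before t carries over to t up to e1, because both correction terms
   are nondecreasing. *)
- move=> t atb IH; apply/ler_addgt0Pr => e1 e10.
  have [d d0 H] := wl t e1 atb e10.
  pose s := Num.max a (t - d / 2).
  have as_ : a <= s by rewrite le_max lexx.
  have st : s < t by rewrite gt_max; lra.
  have ds : t - d < s by rewrite lt_max; apply/orP; right; lra.
  have := H s as_ ltac:(by rewrite ds st).
  have := IH s ltac:(by rewrite as_).
  have := ler_wpM2l C0 (v_mono s t (ltW st)).
  have := mulr_gt0 e0 (ltac:(lra) : 0 < t - s).
  by rewrite !mulrBr; lra.
Qed.

(** The interval is cut into pieces that either lie in an open set U of small measure around the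
    exceptional times or satisfy the increment bound with M + e. Absolute continuity makes the
    former contribute at most e in total. *)
Lemma abs_continuous_le n (z : R -> 'cV[R]_n) a b M : a <= b -> 0 <= M ->
  abs_continuous a b z ->
  {ae mu, forall t, a < t < b -> exists2 w, is_derive t 1 z w & enorm w <= M} ->
  enorm (z b - z a) <= M * (b - a).
Proof.
move=> ab M0 zac zd.
suff H e : 0 < e -> enorm (z b - z a) <= (M + e) * (b - a) + e.
  apply/ler_addgt0Pr => e e0; pose k := (b - a) + 1.
  have k0 : 0 < k by rewrite /k; lra.
  have := H (e / k) (divr_gt0 e0 k0) => Hb; apply: (le_trans Hb).
  rewrite mulrDl -addrA lerD2l -[X in _ + X]mulr1 -mulrDr.
  by rewrite -[leRHS](divfK (lt0r_neq0 k0)).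
move=> e0; have [dl dl0 zacd] := zac e e0.
(* The endpoints join the exceptional set, since the derivative is only given inside the
   interval. *)
have : mu.-negligible ([set a; b] `|` ~` [set t | a < t < b ->
    exists2 w, is_derive t 1 z w & enorm w <= M]).
  apply: negligibleU => //; apply: negligibleU.
    by exists [set a]; split => //; exact: lebesgue_measure_set1.
  by exists [set b]; split => //; exact: lebesgue_measure_set1.
move=> /negligible_open_cover /(_ dl0) [U [oU EU Udl]].
have mU : measurable U by exact: open_measurable.
have Ua : U a by apply: EU; left; left.
have Ub : U b by apply: EU; left; right.
pose good s t := enorm (z t - z s) <= (M + e) * (t - s).
pose fine_ s t := s <= t /\ (`[s, t] `<=` U \/ good s t).
have loc t : a <= t <= b -> exists2 d, 0 < d &
    forall h, 0 < h < d -> fine_ t (t + h) /\ fine_ (t - h) t.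
  move=> /andP[at_ tb].
  have [tU|tU] := pselect (U t).
    have /nbhs_ballP[d /= d0 H] : nbhs t U by rewrite nbhsE/=; exists U.
    exists d => // h /andP[h0 hd]; split; (split; first by lra).
      left=> x; rewrite /= in_itv/= => /andP[tx xt]; apply: H.
      by rewrite /ball/= distrC ger0_norm ?subr_ge0//; lra.
    left=> x; rewrite /= in_itv/= => /andP[tx xt]; apply: H.
    by rewrite /ball/= ger0_norm ?subr_ge0//; lra.
  have [w zw wM] : exists2 w, is_derive t 1 z w & enorm w <= M.
    have ta : a != t by apply/eqP => ta; apply: tU; rewrite -ta.
    have tb' : t != b by apply/eqP => tb'; apply: tU; rewrite tb'.
    have tab : a < t < b by rewrite !lt_neqAle ta tb' at_.
    by apply: contrapT => nP; apply: tU; apply: EU; right => /= /(_ tab).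
  move/is_derive_enormP : zw => /(_ _ e0) /near0P[d d0 H].
  have bd h : `|h| < d -> enorm (z (t + h) - z t) <= (M + e) * `|h|.
    move=> /H zh; rewrite -(subrK (h *: w) (_ - _)).
    apply: le_trans (enormD _ _) _; rewrite enormZ mulrDl addrC lerD// mulrC.
    exact: ler_wpM2r.
  exists d => // h /andP[h0 hd]; split; (split; first by lra); right; rewrite /good.
    have -> : t + h - t = `|h| by rewrite gtr0_norm//; lra.
    by apply: bd; rewrite gtr0_norm.
  have -> : t - (t - h) = `|- h| by rewrite normrN gtr0_norm//; lra.
  by rewrite enorm_distC; apply: bd; rewrite normrN gtr0_norm.
(* Cousin's lemma *)
have [N [p [p0 pN pf]]] : exists N (p : nat -> R),
    [/\ p 0 = a, p N = b & forall i, (i < N)%N -> fine_ (p i) (p i.+1)].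
  pose P t := exists N (p : nat -> R),
    [/\ p 0 = a, p N = t & forall i, (i < N)%N -> fine_ (p i) (p i.+1)].
  have ext s t : P s -> fine_ s t -> P t.
    move=> [N [p [p0 pN pf]]] st.
    exists N.+1, (fun i => if (i <= N)%N then p i else t).
    split=> //; first by rewrite ltnn.
    move=> i; rewrite ltnS leq_eqVlt => /predU1P[->|iN] /=.
      by rewrite eqxx ltnn pN.
    by rewrite iN orbT; exact: pf.
  apply: (@real_induction _ P a b) => //.
  - by exists 0, (fun=> a).
  - move=> t /andP[at_ tb] Pt; have [|d d0 H] := loc t; first by rewrite at_ ltW.
    by exists d => // h /H [th _] _; exact: ext th.
  - move=> t /andP[at_ tb] IH; have [|d d0 H] := loc t; first by rewrite tb ltW.
    pose h := Num.min (d / 2) (t - a).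
    have h0 : 0 < h by rewrite lt_min; apply/andP; split; lra.
    have hd : h < d by rewrite gt_min; apply/orP; left; lra.
    have ha : h <= t - a by rewrite ge_min lexx orbT.
    have [|_ th] := H h; first by rewrite h0.
    by apply: ext th; apply: IH; lra.
have pmono i j : (i <= j <= N)%N -> p i <= p j.
  move=> /andP[ij jN]; elim: j ij jN => [|j IH]; first by rewrite leqn0 => /eqP->.
  rewrite leq_eqVlt => /predU1P[->//|ij] jN.
  by apply: le_trans (IH ij (ltnW jN)) _; case: (pf j jN).
pose l (i : 'I_N) := p i.
(* Collapsing the good pieces to empty intervals leaves one family over ['I_N] for absolute
   continuity, in which the good pieces count for 0. *)
pose r (i : 'I_N) := if good (p i) (p i.+1) then p i else p i.+1.
have lr i : l i <= r i.
  by rewrite /l /r; case: ifP => // _; case: (pf i (ltn_ord i)).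
have rp i : r i <= p i.+1.
  by rewrite /r; case: ifP => // _; case: (pf i (ltn_ord i)).
have triv : trivIset [set: 'I_N] (fun i => `]l i, r i[%classic).
  have K (i j : 'I_N) x : (i < j)%N -> l j < x -> x < r i -> False.
    move=> ij lj ri; have : p i.+1 <= p j by apply: pmono; rewrite ij ltnW.
    by have := rp i; rewrite /l in lj; lra.
  move=> i j _ _ [x []]; rewrite /= !in_itv/= => /andP[li ri] /andP[lj rj].
  apply: val_inj; case: (ltngtP i j) => // ij; exfalso.
    exact: (K _ _ x ij).
  exact: (K _ _ x ij).
have tel k : (k <= N)%N -> enorm (z (p k) - z a) <=
    \sum_(0 <= i < k) enorm (z (p i.+1) - z (p i)).
  elim: k => [_|k IH kN]; first by rewrite big_geq// p0 subrr enorm0.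
  rewrite big_nat_recr//= addrC; apply: le_trans (enorm_triangle (z (p k)) _ _) _.
  by rewrite lerD2l IH// ltnW.
have := tel N (leqnn N); rewrite pN big_mkord => /le_trans; apply.
apply: (@le_trans _ _ (\sum_(i < N) ((M + e) * (p i.+1 - p i) + enorm (z (r i) - z (l i))))).
  apply: ler_sum => i _; rewrite /r /l; case: ifPn => g.
    by apply: le_trans g _; rewrite lerDl enorm_ge0.
  rewrite lerDr; apply: mulr_ge0; first by rewrite addr_ge0// ltW.
  rewrite subr_ge0.
  by case: (pf i (ltn_ord i)).
rewrite big_split/= lerD//.
  rewrite -mulr_sumr -(big_mkord xpredT (fun i => p i.+1 - p i)) telescope_sumr//.
  by rewrite pN p0.
apply/ltW/zacd => //.
  move=> i; split; first by rewrite -p0; apply: pmono; rewrite leq0n ltnW.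
  by split=> //; apply: le_trans (rp i) _; rewrite -pN; apply: pmono; rewrite ltn_ord/=.
rewrite -lte_fin; apply: le_lt_trans Udl.
have -> : ((\sum_(i < N) (r i - l i))%:E = \sum_(i < N) mu `]l i, r i[)%E.
  rewrite -sumEFin; apply: eq_bigr => i _; rewrite lebesgue_measure_itv/= lte_fin.
  by have := lr i; rewrite le_eqVlt => /predU1P[->|->]; rewrite ?ltxx ?subrr ?EFinN.
have mI : measurable (\big[setU/set0]_(i < N) `]l i, r i[%classic).
  by apply: bigsetU_measurable.
rewrite -measure_semi_additive_ord//.
apply: lebesgue_measure_mono => //.
apply: (big_ind (fun A : set R => A `<=` U)) => [x []|A B AU BU|i _ x /=].
  by rewrite subUset.
rewrite in_itv/= /l /r; case: ifPn => g /andP[xl xr]; first by lra.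
case: (pf i (ltn_ord i)) => _ [H|gi]; last by rewrite gi in g.
apply: H.
by rewrite /= in_itv/= !ltW.
Qed.

End AlmostEverywhere.

(** * History spaces *)

Section Clamp.
Variable R : realType.
Implicit Types a b t s : R.

(** Precomposition with [clamp] turns a function continuous on [a, b] into one continuous on R with
    the same values there, so later arguments can work with globally continuous functions. *)
Definition clamp a b t := Num.max a (Num.min t b).

Lemma clamp_id a b t : a <= t <= b -> clamp a b t = t.
Proof. by move=> /andP[at_ tb]; rewrite /clamp min_l// max_r. Qed.

Lemma clamp_itv a b t : a <= b -> a <= clamp a b t <= b.
Proof. by move=> ab; rewrite /clamp le_max lexx ge_max ab ge_min lexx orbT. Qed.

Lemma clamp_dist a b t s : `|clamp a b t - clamp a b s| <= `|t - s|.
Proof.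
have mx x y : `|Num.max a x - Num.max a y| <= `|x - y|.
  have := ler_norm (x - y); have := ler_norm (- (x - y)).
  rewrite normrN ler_norml => h1 h2.
  by case: (leP a x) => ?; case: (leP a y) => ?; apply/andP; split; lra.
have mn x y : `|Num.min x b - Num.min y b| <= `|x - y|.
  have := ler_norm (x - y); have := ler_norm (- (x - y)).
  rewrite normrN ler_norml => h1 h2.
  by case: (leP x b) => ?; case: (leP y b) => ?; apply/andP; split; lra.
exact: le_trans (mx _ _) (mn _ _).
Qed.

Lemma clamp_continuous a b : continuous (clamp a b).
Proof.
move=> t; apply/cvgrPdist_le => e e0; near=> s.
apply: le_trans (clamp_dist _ _ _ _) _.
by near: s; apply: cvgr_dist_le => //; exact: cvg_id.
Unshelve. all: by end_near. Qed.

Lemma continuous_clamp (T : topologicalType) (x : R -> T) a b : a <= b ->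
  {within `[a, b], continuous x} -> continuous (x \o clamp a b).
Proof.
move=> ab xc t; have cab := clamp_itv t ab.
have := xc (clamp a b t); rewrite /continuous_at /=.
rewrite /nbhs/= -nbhs_subspace_in ?in_itv//= => xcl A /xcl.
rewrite /= nbhs_simpl/= => /(clamp_continuous (a := a) (b := b) (x := t)).
rewrite /= nbhs_simpl/=; apply: filterS => s /=; apply.
by rewrite in_itv/= clamp_itv.
Qed.

End Clamp.

Section Histories.
Variables (R : realType) (Delta : R) (n : nat).
Hypothesis D0 : 0 <= Delta.
Implicit Types (phi psi x y : R -> 'cV[R]_n) (t s : R).

Let Dle0 : - Delta <= 0. Proof. by rewrite oppr_le0. Qed.

Lemma hist_space_ext phi psi :
  (forall tau, - Delta <= tau <= 0 -> phi tau = psi tau) ->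
  hist_space Delta phi -> hist_space Delta psi.
Proof.
move=> e; apply: subspace_eq_continuous => tau.
by rewrite inE/= in_itv/= => /e.
Qed.

Lemma continuous_hist_space phi : continuous phi -> hist_space Delta phi.
Proof. by move=> c; exact: continuous_subspaceT. Qed.

Lemma continuous_hist_at y t : continuous y -> continuous (hist_at y t).
Proof.
move=> yc tau; apply: (@continuous_comp _ _ _ (fun s => t + s) y); last exact: yc.
by apply: continuousD; [exact: cst_continuous|exact: cvg_id].
Qed.

Lemma hist_space_clamp phi : hist_space Delta phi -> continuous (phi \o clamp (- Delta) 0).
Proof. exact: continuous_clamp. Qed.

Lemma hist_spaceB phi psi : hist_space Delta phi -> hist_space Delta psi ->
  hist_space Delta (phi \- psi).
Proof.
move=> /hist_space_clamp hp /hist_space_clamp hq.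
apply: (@hist_space_ext ((phi \o clamp (- Delta) 0) - (psi \o clamp (- Delta) 0))).
  by move=> tau ht; rewrite /= !fctE /= clamp_id.
by apply: continuous_hist_space => t; apply: continuousB; [exact: hp|exact: hq].
Qed.

Lemma hist_norm_ub phi tau : hist_space Delta phi -> - Delta <= tau <= 0 ->
  enorm (phi tau) <= hist_norm Delta phi.
Proof.
move=> /hist_space_clamp hp ht.
have : {within `[- Delta, 0], continuous (fun s => enorm ((phi \o clamp (- Delta) 0) s))}.
  by apply: continuous_subspaceT => s; apply: enorm_cvg; exact: hp.
move=> /(EVT_max Dle0)[c _ H].
apply: ub_le_sup; last by exists tau => //=; rewrite in_itv.
exists (enorm ((phi \o clamp (- Delta) 0) c)) => r [s /=].
rewrite in_itv/= => hs <-; have := H s; rewrite /= clamp_id//; apply.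
by rewrite in_itv.
Qed.

Lemma hist_norm_le phi (r : R) :
  (forall tau, - Delta <= tau <= 0 -> enorm (phi tau) <= r) -> hist_norm Delta phi <= r.
Proof.
move=> H; apply: ge_sup.
  by exists (enorm (phi 0)), 0 => //=; rewrite in_itv/= lexx Dle0.
by move=> z [s /=]; rewrite in_itv/= => hs <-; exact: H.
Qed.

Lemma hist_norm_ext phi psi :
  (forall tau, - Delta <= tau <= 0 -> phi tau = psi tau) ->
  hist_norm Delta phi = hist_norm Delta psi.
Proof.
move=> e; rewrite /hist_norm; congr sup; apply/seteqP; split=> z [s /=];
  rewrite in_itv/= => hs <-; exists s => //=; rewrite ?in_itv//= e//.
Qed.

Lemma hist_norm_ge0 phi : hist_space Delta phi -> 0 <= hist_norm Delta phi.
Proof.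
by move=> hp; apply: le_trans (hist_norm_ub hp (_ : - Delta <= 0 <= 0));
  rewrite ?enorm_ge0// lexx Dle0.
Qed.

Lemma hist_norm_distC phi psi :
  hist_norm Delta (phi \- psi) = hist_norm Delta (psi \- phi).
Proof.
rewrite /hist_norm; congr sup; apply/seteqP; split=> _ [s /= hs <-];
  exists s => //=; exact: enorm_distC.
Qed.

Lemma hist_norm_triangle phi psi : hist_space Delta phi -> hist_space Delta psi ->
  hist_norm Delta phi <= hist_norm Delta psi + hist_norm Delta (phi \- psi).
Proof.
move=> hp hq; apply: hist_norm_le => tau ht.
rewrite -(subrK (psi tau) (phi tau)) addrC; apply: le_trans (enormD _ _) _.
rewrite lerD//; first exact: hist_norm_ub.
exact: (hist_norm_ub (hist_spaceB hp hq)).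
Qed.

(** Compactness of the window makes the estimate near each pair (tau, t) uniform in tau. Continuity
    in the sup norm is all that a merely continuous y allows. *)
Lemma hist_at_uniform y t e : continuous y -> 0 < e ->
  \forall s \near t, hist_norm Delta (hist_at y s \- hist_at y t) <= e.
Proof.
move=> yc e0.
have K : \forall s \near t, `[- Delta, 0] `<=`
    [set tau | enorm (y (s + tau) - y (t + tau)) <= e].
  have /compact_near_coveringP K0 := @segment_compact R (- Delta) 0.
  apply: (K0 R (nbhs t) (fun s tau => enorm (y (s + tau) - y (t + tau)) <= e)) => tau _.
  have := yc (t + tau); move=> /cvg_enorm /(_ (e / 2)).
  rewrite divr_gt0// => /(_ isT) /nbhs_ballP[d /= d0 H].
  exists (ball tau (d / 2), ball t (d / 2)).
    by split; apply: nbhsx_ballx; rewrite divr_gt0.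
  move=> [tau' s] [/=]; rewrite /ball/= => h1 h2.
  apply: le_trans (enorm_triangle (y (t + tau)) _ _) _.
  rewrite (splitr e); apply: lerD; [|rewrite enorm_distC].
    apply: (H); rewrite /ball/=.
    have -> : t + tau - (s + tau') = (t - s) + (tau - tau') by ring.
    by apply: le_lt_trans (ler_normD _ _) _; rewrite (splitr d) ltrD.
  apply: (H); rewrite /ball/=.
  have -> : t + tau - (t + tau') = tau - tau' by ring.
  by apply: lt_le_trans h1 _; rewrite ler_pdivrMr// ler_pMr// ler1n.
near=> s; apply: hist_norm_le => tau ht.
by apply: (near K s) => //=; rewrite in_itv.
Unshelve. all: by end_near. Qed.

Section Lipschitz.
Variables (m : nat) (f : (R -> 'cV[R]_n) -> 'cV[R]_m -> 'cV[R]_n) (V : (R -> 'cV[R]_n) -> R).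
Hypothesis flip : lipschitz_on_bounded_rhs Delta f.
Hypothesis Vlip : lipschitz_on_bounded_functional Delta V.

(** The hypothesis speaks of sets of pairs and of a constant of unknown sign; this is its form on a
    ball, with |L|. *)
Lemma rhs_lipschitz (r : R) : exists2 L, 0 <= L & forall phi psi v w,
  hist_space Delta phi -> hist_space Delta psi ->
  hist_norm Delta phi <= r -> hist_norm Delta psi <= r ->
  enorm v <= r -> enorm w <= r ->
  enorm (f phi v - f psi w) <= L * (hist_norm Delta (phi \- psi) + enorm (v - w)).
Proof.
pose B := [set p : (R -> 'cV[R]_n) * 'cV[R]_m |
  [/\ hist_space Delta p.1, hist_norm Delta p.1 <= r & enorm p.2 <= r]].
have B1 p : B p -> hist_space Delta p.1 by case.
have B2 : exists r : R, forall p, B p -> hist_norm Delta p.1 + enorm p.2 <= r.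
  by exists (r + r) => p [_ ? ?]; exact: lerD.
have [L HL] := flip B1 B2.
exists `|L| => // phi psi v w hp hq np nq nv nw.
apply: le_trans (HL (phi, v) (psi, w) _ _) _ => //=.
apply: ler_wpM2r; last exact: ler_norm.
by rewrite addr_ge0 ?enorm_ge0// hist_norm_ge0//; exact: hist_spaceB.
Qed.

Lemma functional_lipschitz (r : R) : exists2 L, 0 <= L & forall phi psi,
  hist_space Delta phi -> hist_space Delta psi ->
  hist_norm Delta phi <= r -> hist_norm Delta psi <= r ->
  `|V phi - V psi| <= L * hist_norm Delta (phi \- psi).
Proof.
pose B := [set p : R -> 'cV[R]_n | hist_space Delta p /\ hist_norm Delta p <= r].
have B1 : B `<=` hist_space Delta by move=> p [].
have B2 : exists r : R, forall p, B p -> hist_norm Delta p <= r by exists r => p [].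
have [L HL] := Vlip B1 B2.
exists `|L| => // phi psi hp hq np nq.
apply: le_trans (HL phi psi _ _) _ => //=.
apply: ler_wpM2r; last exact: ler_norm.
by rewrite hist_norm_ge0//; exact: hist_spaceB.
Qed.

Lemma hist_norm_sub_eq0 phi psi :
  (forall tau, - Delta <= tau <= 0 -> phi tau = psi tau) ->
  hist_norm Delta (phi \- psi) <= 0.
Proof. by move=> e; apply: hist_norm_le => tau ht; rewrite /= e// subrr enorm0. Qed.

(** Histories that agree on [-Delta, 0] are at distance 0, so the Lipschitz bound identifies the
    values. This lets a trajectory be replaced by a clamped version inside [f]. *)
Lemma rhs_ext phi psi v : hist_space Delta phi ->
  (forall tau, - Delta <= tau <= 0 -> phi tau = psi tau) -> f phi v = f psi v.
Proof.
move=> hp e; have hq := hist_space_ext e hp.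
have [L L0 HL] := rhs_lipschitz (hist_norm Delta phi + enorm v).
have N0 := hist_norm_ge0 hp.
apply/eqP; rewrite -subr_eq0; apply/eqP/enorm_eq0/le_anti; rewrite enorm_ge0 andbT.
apply: le_trans (HL phi psi v v _ _ _ _ _ _) _ => //;
  rewrite -?(hist_norm_ext e) ?lerDl ?lerDr ?enorm_ge0//.
rewrite subrr enorm0 addr0 -(mulr0 L); apply: ler_wpM2l => //.
exact: hist_norm_sub_eq0.
Qed.

Lemma hist_space0 : hist_space Delta (fun=> 0 : 'cV[R]_n).
Proof. by apply: continuous_hist_space => t; exact: cvg_cst. Qed.

(** Lipschitz comparison with the equilibrium (0, 0). For r < 0 the bound is void, and |r| keeps the
    constant nonnegative. *)
Lemma rhs_bounded (r : R) : f (fun=> 0) 0 = 0 ->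
  exists2 F, 0 <= F & forall phi v,
    hist_space Delta phi -> hist_norm Delta phi <= r -> enorm v <= r -> enorm (f phi v) <= F.
Proof.
move=> f0; have [L L0 HL] := rhs_lipschitz r.
exists (L * (`|r| + `|r|)); first by rewrite mulr_ge0// addr_ge0.
move=> phi v hp np nv; have r0 : 0 <= r := le_trans (hist_norm_ge0 hp) np.
have := HL phi (fun=> 0) v 0 hp hist_space0 np; rewrite f0 !subr0 enorm0.
move=> H; apply: le_trans (H _ nv r0) _.
  by apply: hist_norm_le => tau _; rewrite enorm0.
apply: ler_wpM2l => //; rewrite ger0_norm// lerD//.
by rewrite (@hist_norm_ext _ phi)// => tau _ /=; rewrite subr0.
Qed.

End Lipschitz.
End Histories.

(** * Primitives and measurability *)

Section AlmostEverywhereImplication.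
Variable R : realType.
Local Notation mu := (@lebesgue_measure R).

Lemma ae_imp (P Q : R -> Prop) : (forall t, P t -> Q t) ->
  {ae mu, forall t, P t} -> {ae mu, forall t, Q t}.
Proof. by move=> PQ; apply: negligibleS => t /= nQ /PQ. Qed.

Lemma ae_and (P Q : R -> Prop) : {ae mu, forall t, P t} -> {ae mu, forall t, Q t} ->
  {ae mu, forall t, P t /\ Q t}.
Proof.
move=> aP aQ; apply: negligibleS (negligibleU aP aQ) => t /= nPQ.
by have [Pt|nPt] := pselect (P t); [right=> Qt; apply: nPQ|left].
Qed.

End AlmostEverywhereImplication.

Section Primitive.
Variables (R : realType) (n : nat).
Local Notation mu := (@lebesgue_measure R).
Variables (g : R -> 'cV[R]_n) (F t0 : R).
Hypothesis g_meas : forall i, measurable_fun [set: R] (fun s => g s i 0).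
Hypothesis g_bnd : forall s, enorm (g s) <= F.

(** For t < t0 the interval is empty and the integral is 0, so the function extends to R as a
    constant to the left of t0. *)
Definition primitive (t : R) : 'cV[R]_n :=
  \col_i \int[mu]_(s in `[t0, t]) g s i 0.

Let gi_bnd i s : `|g s i 0| <= F.
Proof. exact: le_trans (coord_le_enorm _ _) (g_bnd s). Qed.

Let g_int i (A : set R) : measurable A -> (mu A < +oo)%E ->
  mu.-integrable A (EFin \o (fun s => g s i 0)).
Proof.
move=> mA Afin; apply: measurable_bounded_integrable => //.
  exact: measurable_funS (g_meas i).
exists F; split; first exact: num_real.
by move=> x Fx s _ /=; apply: le_trans (gi_bnd i s) (ltW Fx).
Qed.

Let seg_fin a b : (mu `[a, b] < +oo)%E.
Proof.
rewrite lebesgue_measure_itv/=; case: ifPn => _; last exact: ltry.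
by rewrite -EFinD ltry.
Qed.

Lemma primitive0 t : t < t0 -> primitive t = 0.
Proof.
move=> tt0; apply/matrixP => i j; rewrite !mxE.
by rewrite set_itv_ge ?Rintegral_set0// bnd_simp -ltNge.
Qed.

Lemma primitive_start : primitive t0 = 0.
Proof.
by apply/matrixP => i j; rewrite !mxE set_itv1 Rintegral_set1.
Qed.

Lemma primitive_lipschitz s t : s <= t ->
  enorm (primitive t - primitive s) <= n%:R * F * (t - s).
Proof.
have H s' t' : t0 <= s' -> s' <= t' ->
    enorm (primitive t' - primitive s') <= n%:R * F * (t' - s').
  move=> ts st; rewrite -mulrA; apply: enorm_le_coord => i; rewrite !mxE.
  have I1 : mu.-integrable [set` Interval (BLeft t0) (BRight t')]
    (EFin \o (fun s => g s i 0)) by apply: g_int.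
  rewrite (Rintegral_itvB I1) ?bnd_simp//.
  have mI : measurable (`]s', t'] : set R) by [].
  have fI : (mu `]s', t'] < +oo)%E by rewrite lebesgue_measure_seg// ltry.
  apply: le_trans (@le_normr_Rintegral _ (measurableTypeR R) R mu _ (fun s => g s i 0)
    mI (g_int i mI fI)) _.
  have -> : F * (t' - s') = \int[mu]_(_ in `]s', t']) F.
    rewrite Rintegral_cst//; congr (_ * _); rewrite -[LHS]/(fine (t' - s')%:E).
    by congr fine; apply/esym/lebesgue_measure_seg.
  apply: le_Rintegral => //.
  - apply: measurable_bounded_integrable => //.
      apply: measurable_funS (measurableT_comp (@normr_measurable R setT) (g_meas i)) => //.
    exists F; split; first exact: num_real.
    by move=> x Fx u _ /=; rewrite normr_id; apply: le_trans (gi_bnd i u) (ltW Fx).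
  - apply: measurable_bounded_integrable => //.
    exists `|F|; split; first exact: num_real.
    by move=> x Fx u _ /=; exact: ltW.
have F0 : 0 <= F := le_trans (enorm_ge0 _) (g_bnd 0).
have nF : 0 <= n%:R * F by rewrite mulr_ge0.
move=> st; have [ts|st0] := leP t0 s; first exact: H.
rewrite (primitive0 st0) -primitive_start.
have [tt|tt] := leP t0 t.
  by apply: le_trans (H _ _ (lexx _) tt) _; apply: ler_wpM2l => //; lra.
by rewrite (primitive0 tt) primitive_start subrr enorm0 mulr_ge0// subr_ge0.
Qed.

Lemma primitive_derive :
  {ae mu, forall t, t0 < t -> is_derive t 1 primitive (g t)}.
Proof.
have : {ae mu, forall t, forall i : 'I_n, t0 < t ->
    is_derive t 1 (fun t => primitive t i 0) (g t i 0)}.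
  have ae_ord (P : 'I_n -> R -> Prop) : (forall i, {ae mu, forall t, P i t}) ->
      {ae mu, forall t, forall i, P i t}.
    move=> PH.
    (* Coordinates are re-indexed by all natural numbers in order to use a countable intersection;
       indices >= n carry no condition. *)
    have H k : {ae mu, forall t, forall i : 'I_n, val i = k -> P i t}.
      have [kn|kn] := ltnP k n.
        by apply: ae_imp (PH (Ordinal kn)) => t Pt i ik; rewrite (_ : i = Ordinal kn)//; exact: val_inj.
      by apply: aeW => t i ik; move: (ltn_ord i); rewrite ik ltnNge kn.
    by apply: ae_imp (ae_foralln H) => t Ht i; exact: (Ht (val i) i).
  apply: ae_ord => i.
  have loc : locally_integrable [set: R] (fun s => g s i 0).
    split; [exact: g_meas|exact: openT|move=> K _ cK].
    have mK : measurable K := compact_measurable cK.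
    have /integrableP[_] := g_int i mK (compact_finite_measure cK).
    by [].
  have gI y : mu.-integrable [set` Interval (BLeft t0) (BRight y)] (EFin \o (fun s => g s i 0)).
    exact: g_int.
  have := FTC1 gI loc; apply: ae_imp => t Ht t0t.
  have [|dF DF] := Ht; first by rewrite /= lte_fin.
  have -> : (fun t => primitive t i 0) = (fun y => \int[mu]_(s in `[t0, y]) g s i 0).
    by apply/funext => y; rewrite mxE.
  by apply: DeriveDef; [exact: dF|rewrite -DF derive1E].
apply: ae_imp => t H t0t.
have dP : derivable primitive t 1.
  by apply/derivable_mxP => i j; rewrite ord1; have [] := H i t0t.
apply: DeriveDef => //; rewrite derive_mx//.
by apply/matrixP => i j; rewrite mxE ord1; have [] := H i t0t.
Qed.

End Primitive.

(** * Measurability along Borel inputs, and Borel representatives of inputs *)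

Section Measurability.
Variables (R : realType) (m : nat).
Local Notation mu := (@lebesgue_measure R).

(* The superlevel sets are countable unions of preimages of boxes with rational
   centers and radii 1 / (N + 1). *)
Lemma measurable_caratheodory (H : R -> 'cV[R]_m -> R) (u : R -> 'cV[R]_m) :
  (forall i, measurable_fun [set: R] (fun s => u s i 0)) ->
  (forall s v e, 0 < e -> exists2 d, 0 < d & forall s' v',
     `|s' - s| < d -> enorm (v' - v) < d -> `|H s' v' - H s v| < e) ->
  measurable_fun [set: R] (fun s => H s (u s)).
Proof.
move=> um Hc; apply: (measurability _ (RGenOInfty.measurableE R)).
move=> _ [_ [a ->] <-]; rewrite setTI.
pose dist (N : nat) : R := N.+1%:R^-1.
pose I := (rat * 'cV[rat]_m * nat)%type.
pose box (k : I) := [set s | `|s - ratr k.1.1| < dist k.2] `&`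
  \big[setI/setT]_(i < m) [set s | `|u s i 0 - ratr (k.1.2 i 0)| < dist k.2].
pose ok (k : I) := forall s' (v : 'cV[R]_m), `|s' - ratr k.1.1| < dist k.2 ->
  (forall i, `|v i 0 - ratr (k.1.2 i 0)| < dist k.2) -> a < H s' v.
pose G k := if pselect (ok k) then box k else set0.
have boxP k s : box k s <-> `|s - ratr k.1.1| < dist k.2 /\
    forall i, `|u s i 0 - ratr (k.1.2 i 0)| < dist k.2.
  rewrite /box -bigcap_seq/=; split=> [[? K]|[? K]]; split=> // i.
    by apply: (K i); rewrite /= mem_index_enum.
  by move=> _; exact: K.
have -> : (fun s => H s (u s)) @^-1` `]a, +oo[%classic = \bigcup_k G k.
  apply/seteqP; split=> s /=.
    rewrite in_itv/= andbT => aH.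
    have [|d d0 Hd] := Hc s (u s) (H s (u s) - a); first by rewrite subr_gt0.
    (* Two points of a box differ by less than 2 [dist N] in time and in each coordinate, hence by
       at most 2 m [dist N] in the Euclidean norm; the factor m + 1 covers both. *)
    have [N Nd] : exists N, dist N < d / (m.+1%:R * 2).
      have e0 : 0 < d / (m.+1%:R * 2) by rewrite divr_gt0// mulr_gt0.
      have [N _ HN] := near_infty_natSinv_lt (PosNum e0).
      by exists N; apply: (HN N) => /=.
    have D0 : 0 < dist N by rewrite invr_gt0.
    have rq (x : R) : exists q : rat, `|x - ratr q| < dist N.
      have [|q] := @rat_in_itvoo R (x - dist N) (x + dist N); first by lra.
      by rewrite in_itv/= => qx; exists q; rewrite distrC ltr_distl.
    have [q0 hq0] := rq s; have [q hq] := choice (fun i => rq (u s i 0)).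
    exists (q0, \col_i q i, N) => //.
    have mN : dist N * (m.+1%:R * 2) < d by rewrite -ltr_pdivlMr// mulr_gt0.
    have m1 : 1 <= m.+1%:R :> R by rewrite ler1n.
    have m0 : 0 <= m%:R :> R by [].
    have mS : m.+1%:R = m%:R + 1 :> R by rewrite -natr1.
    rewrite /G; case: pselect => [okq|[]] /=.
      by apply/boxP; split=> //= i; rewrite mxE.
    move=> s' v /= hs' hv.
    have Hs : `|s' - s| < d.
      have -> : s' - s = (s' - ratr q0) - (s - ratr q0) by ring.
      apply: le_lt_trans (ler_normB _ _) _.
      by move: hs' hq0 mN D0 m1; nra.
    have Hv : enorm (v - u s) < d.
      apply: (@le_lt_trans _ _ (m%:R * (dist N * 2))); last first.
        by move: mN D0; rewrite mS; nra.
      apply: enorm_le_coord => i; rewrite !mxE.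
      have -> : v i 0 - u s i 0 = (v i 0 - ratr (q i)) - (u s i 0 - ratr (q i)) by ring.
      apply: le_trans (ler_normB _ _) _.
      by have := hv i; have := hq i; rewrite mxE; lra.
    have := Hd s' v Hs Hv; rewrite ltr_distl => /andP[+ _].
    by rewrite opprB addrC subrK.
  move=> [k _]; rewrite /G; case: pselect => //= okk /boxP[h1 h2].
  by rewrite in_itv/= andbT; exact: okk.
apply: countable_bigcupT_measurable; first exact: countableP.
move=> k; rewrite /G; case: pselect => //= okk.
apply: measurableI.
  apply: open_measurable.
  rewrite (_ : [set s | _] = ball (ratr k.1.1 : R) (dist k.2)); first exact: ball_open.
  by apply/seteqP; split=> s; rewrite /ball/= distrC.
apply: bigsetI_measurable => i _.
rewrite (_ : [set s | _] = (fun s => u s i 0) @^-1` (ball (ratr (k.1.2 i 0) : R) (dist k.2))).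
  rewrite -[X in measurable X]setTI; apply: um => //.
  by apply: open_measurable; exact: ball_open.
by apply/seteqP; split=> s; rewrite /ball/= distrC.
Qed.

(** Inputs are only Lebesgue measurable, while the integral lives on Borel sets. Each set {u_i < q}
    with q rational is Borel up to a Borel null set; these countably many null sets, with the one
    where the bound K fails, are removed, and w is 0 there and outside [0, b]. *)
Lemma borel_representative (u : R -> 'cV[R]_m) (b K : R) : 0 <= K ->
  input_space u -> {ae mu, forall s, 0 <= s <= b -> enorm (u s) <= K} ->
  exists w : R -> 'cV[R]_m, [/\
    forall i, measurable_fun [set: R] (fun s => w s i 0),
    forall s, enorm (w s) <= K &
    {ae mu, forall s, 0 <= s <= b -> w s = u s}].
Proof.
move=> K0 [um _] [N0 [mN0 N00 N0u]].
have cm (i : 'I_m) (q : rat) : exists AN : set R * set R, [/\ measurable AN.1,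
    measurable AN.2, mu AN.2 = 0%E &
    forall s, 0 <= s -> ~ AN.2 s -> (u s i 0 < ratr q <-> AN.1 s)].
  have := um i; set S := (X in measurable_fun X) => ui.
  have mS : (completed_algebra_gen mu).-sigma.-measurable S.
    rewrite g_sigma_completed_algebra_genE; exists S; first exact: measurable_itv.
    by exists set0; [exact: negligible_set0|rewrite setU0].
  have := ui mS (`]-oo, ratr q[%classic) (measurable_itv _).
  rewrite [X in X _ -> _](_ : _ = completed_algebra_gen mu); last first.
    exact: g_sigma_completed_algebra_genE.
  move=> [A mA [N [M [mM M0 NM]] AN]].
  exists (A, M); split => // s s0 Ms.
  have sN : ~ N s by move=> /NM.
  rewrite /=; have <- : (A `|` N) s <-> A s by split; [case|left].
  rewrite AN; split=> [us|[_]].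
    by split; rewrite /S/= ?in_itv/= ?s0.
  by rewrite /= in_itv.
have [AN HAN] := choice (fun iq : 'I_m * rat => cm iq.1 iq.2).
pose M := N0 `|` \bigcup_k (AN k).2.
have mM : measurable M.
  apply: measurableU => //; apply: countable_bigcupT_measurable; first exact: countableP.
  by move=> k; case: (HAN k).
have M0 : mu.-negligible M.
  apply: negligibleU; first by exists N0; split => //; exact: N00.
  have [/eqP T0|/set0P[k0 _]] := boolP ([set: 'I_m * rat] == set0).
    by rewrite T0 bigcup_set0; exact: negligible_set0.
  rewrite (_ : \bigcup_k _ = \bigcup_(j : nat) (if unpickle j is Some k then (AN k).2 else set0)).
    apply: negligible_bigcup => j; case: (unpickle j) => [k|]; last exact: negligible_set0.
    by have [_ m2 m20 _] := HAN k; exists (AN k).2; split.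
  apply/seteqP; split=> s [k _ ks]; first by exists (pickle k) => //; rewrite pickleK.
  by move: ks; case: (unpickle k) => // l ls; exists l.
pose D := `[0, b] `\` M.
have mD : measurable D by exact: measurableD.
have DP s : D s -> [/\ 0 <= s, s <= b & ~ M s].
  by move=> [/=]; rewrite in_itv/= => /andP[].
exists (fun s => if s \in D then u s else 0); split.
- move=> i.
  have -> : (fun s => (if s \in D then u s else 0) i 0) = (fun s => u s i 0) \_ D.
    by apply/funext => s; rewrite /patch; case: ifP => // _; rewrite mxE.
  apply/(measurable_restrictT (fun s => u s i 0) mD) => _; apply: (measurability _ (RGenInftyO.measurableE R)) => //.
  move=> _ [_ [x ->] <-].
  (* By density, u_i < x holds exactly if u_i < q for some rational q <= x, and on [D] each of these
     conditions is Borel. *)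
  rewrite (_ : _ `&` _ = \bigcup_(q : rat)
     (if ratr q <= x then D `&` (AN (i, q)).1 else set0)).
    apply: bigcupT_measurable_rat => q; case: ifP => // _.
    by apply: measurableI => //; case: (HAN (i, q)).
  apply/seteqP; split=> s /=.
    rewrite in_itv/= => -[Ds usx].
    have [q] := rat_in_itvoo usx; rewrite in_itv/= => /andP[uq qx].
    exists q => //; rewrite ltW//; split=> //.
    have [_ _ _ H] := HAN (i, q); have [s0 _ Ms] := DP _ Ds.
    apply/(H s s0) => // Ns; apply: Ms; right; by exists (i, q).
  move=> [q _]; case: ifP => // qx [Ds As]; split=> //.
  rewrite in_itv/=; apply: lt_le_trans qx.
  have [_ _ _ H] := HAN (i, q); have [s0 _ Ms] := DP _ Ds.
  by apply/(H s s0) => // Ns; apply: Ms; right; exists (i, q).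
- move=> s; case: ifPn => [/set_mem Ds|_]; last by rewrite enorm0.
  have [s0 sb Ms] := DP _ Ds.
  by apply: contrapT => us; apply: Ms; left; apply: N0u => /= H; apply: us; apply: H; rewrite s0.
- apply: negligibleS M0 => s /= H; apply: contrapT => Ms; apply: H => sb.
  by rewrite mem_set//; split=> //=; rewrite in_itv.
Qed.

End Measurability.

(** * Existence and uniqueness of solutions *)

Section AbsoluteContinuity.
Variables (R : realType) (n : nat).
Implicit Types (x y : R -> 'cV[R]_n) (a b : R).

Lemma is_derive_incr x y t w :
  (\forall h \near (0 : R), x (t + h) - x t = y (t + h) - y t) ->
  is_derive t 1 y w -> is_derive t 1 x w.
Proof.
move=> xy /is_derive_enormP yw; apply/is_derive_enormP => e /yw H.
by near=> h; rewrite (near xy h)//; near: h.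
Unshelve. all: by end_near. Qed.

Lemma lipschitz_continuous x (C : R) :
  (forall s t, s <= t -> enorm (x t - x s) <= C * (t - s)) -> continuous x.
Proof.
move=> xC t; have C1 : 0 < `|C| + 1 by rewrite ltr_wpDl.
apply/cvg_enorm => e e0; near=> s.
have ts : `|t - s| <= e / (`|C| + 1).
  by near: s; apply: cvgr_dist_le; [exact: cvg_id|rewrite divr_gt0].
have le s' t' : s' <= t' -> enorm (x t' - x s') <= (`|C| + 1) * `|t' - s'|.
  move=> st; apply: le_trans (xC _ _ st) _; rewrite (ger0_norm (x := t' - s')) ?subr_ge0//.
  by apply: ler_wpM2r; rewrite ?subr_ge0// ler_wpDr// ler_norm.
rewrite -(divfK (lt0r_neq0 C1) e) mulrC.
have [st|st] := leP s t.
  by rewrite enorm_distC; apply: le_trans (le _ _ st) _; rewrite ler_pM2l.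
by apply: le_trans (le _ _ (ltW st)) _; rewrite distrC ler_pM2l.
Unshelve. all: by end_near. Qed.

Lemma lipschitz_abs_continuous x a b (C : R) :
  (forall s t, a <= s -> s <= t -> t <= b -> enorm (x t - x s) <= C * (t - s)) ->
  abs_continuous a b x.
Proof.
move=> xC e e0; have C1 : 0 < `|C| + 1 by rewrite ltr_wpDl.
exists (e / (`|C| + 1)); first by rewrite divr_gt0.
move=> N l r lr _ sum_lt.
apply: (@le_lt_trans _ _ ((`|C| + 1) * \sum_(i < N) (r i - l i))); last first.
  by rewrite mulrC -ltr_pdivlMr.
rewrite mulr_sumr; apply: ler_sum => i _; have [al [li rb]] := lr i.
apply: le_trans (xC _ _ al li rb) _.
by apply: ler_wpM2r; rewrite ?subr_ge0// ler_wpDr// ler_norm.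
Qed.

Lemma abs_continuousB x y a b : abs_continuous a b x -> abs_continuous a b y ->
  abs_continuous a b (x \- y).
Proof.
move=> xa ya e e0; have e2 : 0 < e / 2 by rewrite divr_gt0.
have [d1 d10 H1] := xa _ e2; have [d2 d20 H2] := ya _ e2.
exists (Num.min d1 d2); first by rewrite lt_min d10.
move=> N l r lr tr; rewrite lt_min => /andP[s1 s2].
rewrite (splitr e); apply: le_lt_trans (ltrD (H1 N l r lr tr s1) (H2 N l r lr tr s2)).
rewrite -big_split/=; apply: ler_sum => i _.
rewrite (_ : _ - _ - _ = (x (r i) - x (l i)) - (y (r i) - y (l i))); first exact: enormB.
by apply/matrixP => p q; rewrite !mxE; ring.
Qed.

Lemma abs_continuous_sub x a b a' b' : a <= a' -> b' <= b ->
  abs_continuous a b x -> abs_continuous a' b' x.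
Proof.
move=> aa bb xa e /xa[d d0 H]; exists d => // N l r lr; apply: H => i.
have [al [li rb]] := lr i; split; first exact: le_trans al.
by split=> //; exact: le_trans bb.
Qed.

(** The intervals of radius 2 C / 2^k around z k are nested, and the supremum of their left
    endpoints lies in all of them: the limit comes together with its rate. *)
Lemma geometric_limit (z : nat -> R) (C : R) :
  (forall k, `|z k.+1 - z k| <= C / 2 ^+ k) ->
  exists l, forall k, `|z k - l| <= 2 * C / 2 ^+ k.
Proof.
move=> zC; pose c k := 2 * C / 2 ^+ k.
have p2 k : 0 < 2 ^+ k :> R by rewrite exprn_gt0.
have cS k : C / 2 ^+ k = c k / 2 /\ c k.+1 = c k / 2.
  by rewrite /c exprS; split; field; rewrite gt_eqF.
have step k : z k - c k <= z k.+1 - c k.+1 /\ z k.+1 + c k.+1 <= z k + c k.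
  by have [e1 ->] := cS k; have := zC k; rewrite e1 ler_norml => /andP[]; split; lra.
have c0 k : 0 <= c k.
  by have [e1 _] := cS k; have := le_trans (normr_ge0 _) (zC k); rewrite e1; lra.
have up i j : (i <= j)%N -> z i - c i <= z j - c j /\ z j + c j <= z i + c i.
  elim: j => [|j IH]; first by rewrite leqn0 => /eqP->.
  rewrite leq_eqVlt => /predU1P[->//|/IH[h1 h2]]; have [h3 h4] := step j.
  by split; [exact: le_trans h3|exact: le_trans h2].
have cross i j : z i - c i <= z j + c j.
  have [/up[h _]|/ltnW/up[_ h]] := leqP i j; first by have := c0 j; lra.
  by have := c0 i; lra.
pose S := [set z i - c i | i in [set: nat]].
have Sub : has_ubound S by exists (z 0 + c 0) => r [i _ <-]; exact: cross.
exists (sup S) => k; rewrite ler_distlC; apply/andP; split.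
  have : z k - c k <= sup S by apply: ub_le_sup => //; exists k.
  by rewrite /c; lra.
have : sup S <= z k + c k.
  by apply: ge_sup; [exists (z 0 - c 0), 0|move=> r [i _ <-]; exact: cross].
by rewrite /c; lra.
Qed.

Lemma geometric_limit_vec (z : nat -> 'cV[R]_n) (C : R) :
  (forall k, enorm (z k.+1 - z k) <= C / 2 ^+ k) ->
  exists l, forall k, enorm (z k - l) <= n%:R * (2 * C) / 2 ^+ k.
Proof.
move=> zC.
have H i : exists l, forall k, `|z k i 0 - l| <= 2 * C / 2 ^+ k.
  apply: geometric_limit => k; apply: le_trans (zC k).
  by have := coord_le_enorm (z k.+1 - z k) i; rewrite !mxE.
have [l Hl] := choice H; exists (\col_i l i) => k.
by rewrite -mulrA; apply: enorm_le_coord => i; rewrite !mxE; exact: Hl.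
Qed.

Lemma le_geometric0 (r C : R) : (forall k, r <= C / 2 ^+ k) -> r <= 0.
Proof.
move=> rC; rewrite leNgt; apply/negP => r0.
have [k] : exists k, C / r < 2 ^+ k.
  exists (Num.truncn `|C / r|).+1.
  apply: le_lt_trans (ler_norm _) _; apply: lt_le_trans (truncnS_gt _) _.
  by rewrite -natrX ler_nat ltnW// ltn_expl.
rewrite ltr_pdivrMr// => Ck; have := rC k.
by rewrite ler_pdivlMr ?exprn_gt0// mulrC; lra.
Qed.

End AbsoluteContinuity.

(** * Local existence with a uniform step *)

Section LocalExistence.
Variables (R : realType) (Delta : R) (n m : nat).
Variable f : (R -> 'cV[R]_n) -> 'cV[R]_m -> 'cV[R]_n.
Hypothesis D0 : 0 <= Delta.
Hypothesis flip : lipschitz_on_bounded_rhs Delta f.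
Hypothesis f0 : f (fun=> 0) 0 = 0.
Local Notation mu := (@lebesgue_measure R).

Lemma hist_norm_at_le (y : R -> 'cV[R]_n) t (r : R) : (forall s, t - Delta <= s <= t -> enorm (y s) <= r) ->
  hist_norm Delta (hist_at y t) <= r.
Proof. by move=> H; apply: hist_norm_le => // tau /andP[? ?]; apply: H; apply/andP; split; lra. Qed.

(** The map (s, v) -> f(y_s, v) is jointly continuous: y_s varies continuously in the sup norm and f
    is Lipschitz on bounded sets. *)
Lemma rhs_measurable (y : R -> 'cV[R]_n) (w : R -> 'cV[R]_m) i :
  continuous y -> (forall j, measurable_fun [set: R] (fun s => w s j 0)) ->
  measurable_fun [set: R] (fun s => f (hist_at y s) (w s) i 0).
Proof.
move=> yc wm; apply: (@measurable_caratheodory _ _ (fun s v => f (hist_at y s) v i 0)) => //.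
move=> s v e e0.
have hs t : hist_space Delta (hist_at y t).
  by apply: continuous_hist_space; exact: continuous_hist_at.
pose r := hist_norm Delta (hist_at y s) + enorm v + 1.
have [L L0 HL] := rhs_lipschitz D0 flip r.
have N0 := hist_norm_ge0 D0 (hs s); have v0 := enorm_ge0 v.
pose q := Num.min 1 (e / (2 * (L + 1))).
have q0 : 0 < q by rewrite lt_min ltr01 divr_gt0// mulr_gt0// ltr_wpDl.
have q1 : q <= 1 by rewrite ge_min lexx.
have qe : L * (q + q) < e.
  have : q <= e / (2 * (L + 1)) by rewrite ge_min lexx orbT.
  by rewrite ler_pdivlMr; [nra|rewrite mulr_gt0// ltr_wpDl].
have /nbhs_ballP[d /= d0 Hd] := hist_at_uniform D0 s yc q0.
exists (Num.min d q); first by rewrite lt_min d0.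
move=> s' v'; rewrite lt_min => /andP[sd _]; rewrite lt_min => /andP[_ vq].
have hq : hist_norm Delta (hist_at y s' \- hist_at y s) <= q.
  by apply: Hd; rewrite /ball/= distrC.
apply: (@le_lt_trans _ _ (enorm (f (hist_at y s') v' - f (hist_at y s) v))).
  by have := coord_le_enorm (f (hist_at y s') v' - f (hist_at y s) v) i; rewrite !mxE.
apply: le_lt_trans qe; apply: le_trans (HL _ _ _ _ _ _ _ _ _ _) _ => //.
- by have := hist_norm_triangle D0 (hs s') (hs s); rewrite /r; lra.
- by rewrite /r; lra.
- by have := enormD (v' - v) v; rewrite subrK /r; lra.
- by rewrite /r; lra.
- by apply: ler_wpM2l => //; apply: lerD => //; exact: ltW.
Qed.

(** The length d depends on M and K alone, not on t0, xi or w: continuation needs steps that do not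
    shrink. A Borel w bounded everywhere is what [borel_representative] supplies. *)
Lemma local_existence (M K : R) : 0 <= M -> 0 <= K ->
  exists2 d, 0 < d & forall (t0 : R) (xi : R -> 'cV[R]_n) (w : R -> 'cV[R]_m),
    continuous xi -> (forall t, enorm (xi t) <= M) ->
    (forall j, measurable_fun [set: R] (fun s => w s j 0)) ->
    (forall s, enorm (w s) <= K) ->
    exists y : R -> 'cV[R]_n, [/\ continuous y, (forall t, t <= t0 -> y t = xi t),
      (exists C : R, forall s t, t0 <= s -> s <= t -> t <= t0 + d ->
         enorm (y t - y s) <= C * (t - s)) &
      {ae mu, forall t, t0 < t < t0 + d -> is_derive t 1 y (f (hist_at y t) (w t))}].
Proof.
move=> M0 K0; pose r := M + 1 + K.
have [L L0 HL] := rhs_lipschitz D0 flip r.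
have [F F0 HF] := rhs_bounded D0 flip r f0.
have nF0 : 0 <= n%:R * F by rewrite mulr_ge0.
(* The first bound, n F d <= 1, keeps the iterates in the ball of radius M + 1; the second, L d <=
   1/2, makes the Picard operator halve distances. *)
pose d := Num.min ((n%:R * F + 1)^-1) ((2 * L + 1)^-1).
have p1 : 0 < n%:R * F + 1 by rewrite ltr_wpDl.
have p2 : 0 < 2 * L + 1 by rewrite ltr_wpDl// mulr_ge0.
have d0 : 0 < d by rewrite lt_min !invr_gt0 p1.
have dF : n%:R * F * d <= 1.
  have : d <= (n%:R * F + 1)^-1 by rewrite ge_min lexx.
  by rewrite -[leRHS]div1r ler_pdivlMr//; nra.
have dL : L * d <= 2^-1.
  have : d <= (2 * L + 1)^-1 by rewrite ge_min lexx orbT.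
  by rewrite -[leRHS]div1r ler_pdivlMr//; nra.
exists d => // t0 xi w xic xiM wm wK.
pose g (z : R -> 'cV[R]_n) s := f (hist_at z s) (w s).
(* The Picard operator, with the history kept before t0 and the value frozen after t0 + d, so that
   all iterates live on R and are compared by sup bounds over R. *)
pose T (z : R -> 'cV[R]_n) t :=
  xi (Num.min t t0) + primitive (g z) t0 (Num.min t (t0 + d)).
pose inv (z : R -> 'cV[R]_n) := [/\ continuous z, forall t, enorm (z t) <= M + 1 &
  forall t, t <= t0 -> z t = xi t].
have inv_hs z s : inv z -> hist_space Delta (hist_at z s).
  by move=> [zc _ _]; apply: continuous_hist_space; exact: continuous_hist_at.
have inv_hn z s : inv z -> hist_norm Delta (hist_at z s) <= r.
  move=> [_ zM _]; apply: hist_norm_at_le => u _; apply: le_trans (zM u) _.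
  by rewrite /r lerDl.
have wr s : enorm (w s) <= r by apply: le_trans (wK s) _; rewrite /r; lra.
have inv_gF z s : inv z -> enorm (g z s) <= F.
  by move=> iz; apply: HF; [exact: inv_hs|exact: inv_hn|exact: wr].
have inv_gm z i : inv z -> measurable_fun [set: R] (fun s => g z s i 0).
  by move=> [zc _ _]; exact: rhs_measurable.
have prim_le z t : inv z -> t <= t0 -> primitive (g z) t0 t = 0.
  move=> iz; rewrite le_eqVlt => /predU1P[->|]; first exact: primitive_start.
  exact: primitive0.
have plip z s t : inv z -> s <= t ->
    enorm (primitive (g z) t0 t - primitive (g z) t0 s) <= n%:R * F * (t - s).
  by move=> iz; apply: primitive_lipschitz => [i|u]; [exact: inv_gm|exact: inv_gF].
have pder z : inv z -> {ae mu, forall t, t0 < t ->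
    is_derive t 1 (primitive (g z) t0) (g z t)}.
  by move=> iz; apply: primitive_derive => [i|u]; [exact: inv_gm|exact: inv_gF].
have T_inv z : inv z -> inv (T z).
  move=> iz; split.
  - move=> t; rewrite /continuous_at /T; apply: cvgD.
      apply: (@continuous_comp _ _ _ (fun t => Num.min t t0) xi); last exact: xic.
      by apply: continuous_min; [exact: cvg_id|exact: cst_continuous].
    apply: (@continuous_comp _ _ _ (fun t => Num.min t (t0 + d)) (primitive (g z) t0)).
      by apply: continuous_min; [exact: cvg_id|exact: cst_continuous].
    by apply: (lipschitz_continuous (C := n%:R * F)) => s u; exact: plip.
  - move=> t; apply: le_trans (enormD _ _) _; apply: lerD; first exact: xiM.
    have [tt|tt] := leP (Num.min t (t0 + d)) t0; first by rewrite prim_le// enorm0.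
    rewrite -[primitive _ _ _]subr0 -(primitive_start (g z) t0).
    apply: le_trans (plip _ _ _ iz (ltW tt)) _; apply: le_trans dF.
    by apply: ler_wpM2l => //; rewrite lerBlDl ge_min lexx orbT.
  - move=> t tt0; rewrite /T min_l// prim_le ?addr0// ge_min tt0//.
have contr z z' e : inv z -> inv z' -> (forall t, enorm (z t - z' t) <= e) ->
    forall t, enorm (T z t - T z' t) <= e / 2.
  move=> iz iz' ze t; have e0 : 0 <= e := le_trans (enorm_ge0 _) (ze 0).
  rewrite /T opprD addrACA subrr add0r; set t' := Num.min _ _.
  have [tt|tt] := leP t' t0; first by rewrite !prim_le// subrr enorm0 divr_ge0.
  (* Bounding the derivative of the difference, rather than each coordinate of the integral, gives
     the factor L e without the dimension n. *)
  pose P := primitive (g z) t0 \- primitive (g z') t0.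
  have PAC : abs_continuous t0 t' P.
    by apply: abs_continuousB; apply: lipschitz_abs_continuous => s u _ su _; exact: plip.
  have P0 : P t0 = 0 by rewrite /P/= !primitive_start subrr.
  rewrite -[_ - _]subr0 -P0.
  apply: (@le_trans _ _ (L * e * (t' - t0))); last first.
    have : t' - t0 <= d by rewrite lerBlDl ge_min lexx orbT.
    move=> /(ler_wpM2l (mulr_ge0 L0 e0)) /le_trans; apply.
    by rewrite mulrAC mulrC; apply: ler_wpM2l.
  apply: (abs_continuous_le (ltW tt) _ PAC); first by rewrite mulr_ge0.
  have := ae_and (pder z iz) (pder z' iz'); apply: ae_imp => s [H1 H2] /andP[ts _].
  exists (g z s - g z' s); first exact: is_deriveB (H1 ts) (H2 ts).
  rewrite /g; apply: le_trans (HL _ _ _ _ _ _ _ _ _ _) _; rewrite ?inv_hn//.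
  - exact: inv_hs.
  - exact: inv_hs.
  - rewrite subrr enorm0 addr0; apply: ler_wpM2l => //.
    by apply: hist_norm_le => // tau _; exact: ze.
pose Z k := iter k T (fun t => xi (Num.min t t0)).
have Z_inv k : inv (Z k).
  elim: k => [|k IH]; last exact: T_inv.
  split=> [t|t|t tt] /=.
  - apply: (@continuous_comp _ _ _ (fun t => Num.min t t0) xi); last exact: xic.
    by apply: continuous_min; [exact: cvg_id|exact: cst_continuous].
  - by apply: le_trans (xiM _) _; rewrite lerDl.
  - by rewrite min_l.
pose C := 2 * (M + 1).
have ZC k t : enorm (Z k.+1 t - Z k t) <= C / 2 ^+ k.
  elim: k t => [|k IH] t.
    rewrite expr0 divr1 /C mulr_natl mulr2n; apply: le_trans (enormB _ _) _.
    by apply: lerD; [have [_ H _] := Z_inv 1|have [_ H _] := Z_inv 0]; exact: H.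
  by rewrite exprSr invfM mulrA; apply: (contr (Z k.+1) (Z k)).
have [y Hy] := choice (fun t => geometric_limit_vec (z := Z ^~ t) (ZC ^~ t)).
pose C' := n%:R * (2 * C).
have yi : inv y.
  split.
  - move=> t; apply/cvg_enorm => e e0.
    have [k Ck] : exists k, C' / 2 ^+ k <= e / 3.
      apply: contrapT => nk; have := @le_geometric0 R (e / 3) C'.
      rewrite leNgt divr_gt0// => H; have : false by apply: H => k; rewrite leNgt; apply/negP => h; apply: nk; exists k; exact: ltW.
      by [].
    have [Zc _ _] := Z_inv k; have /cvg_enorm/(_ (e / 3)) := Zc t.
    rewrite divr_gt0// => /(_ isT); apply: filterS => s Zs.
    have h1 := Hy s k; have h2 := Hy t k.
    apply: le_trans (enorm_triangle (Z k s) _ _) _; rewrite enorm_distC.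
    have := enorm_triangle (Z k t) (Z k s) (y t).
    by rewrite -/C' in h1 h2; lra.
  - move=> t; rewrite -subr_le0; apply: (@le_geometric0 _ _ C') => k.
    have [_ H _] := Z_inv k; have := H t; have := Hy t k.
    by have := enormD (y t - Z k t) (Z k t); rewrite subrK enorm_distC -/C'; lra.
  - move=> t tt; apply/eqP; rewrite -subr_eq0; apply/eqP/enorm_eq0/le_anti.
    rewrite enorm_ge0 andbT; apply: (@le_geometric0 _ _ C') => k.
    by have [_ _ H] := Z_inv k; rewrite -(H t tt) enorm_distC; exact: Hy.
have yT t : y t = T y t.
  apply/eqP; rewrite -subr_eq0; apply/eqP/enorm_eq0/le_anti.
  rewrite enorm_ge0 andbT; apply: (@le_geometric0 _ _ C') => k.
  (* Both y and T y are within O(2^-k) of Z_{k+1} = T Z_k. *)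
  apply: le_trans (enorm_triangle (Z k.+1 t) _ _) _.
  have h1 := Hy t k.+1.
  have h2 := contr (Z k) y (C' / 2 ^+ k) (Z_inv k) yi (fun t => Hy t k) t.
  rewrite enorm_distC; apply: le_trans (lerD h1 h2) _.
  rewrite -/C' exprSr invfM mulrA; lra.
exists y; have [yc yM yxi] := yi; split=> //.
  exists (n%:R * F) => s t ts st td; rewrite (yT t) (yT s) /T.
  rewrite !(min_r (x := _) (y := t0)) ?(le_trans ts)// !(min_l (y := t0 + d))// ?(le_trans st)//.
  by rewrite opprD addrACA subrr add0r; exact: plip.
have := pder y yi; apply: ae_imp => t H /andP[tt td]; apply: is_derive_incr (H tt).
apply/near0P; exists (Num.min (t - t0) (t0 + d - t)).
  by rewrite lt_min !subr_gt0 tt.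
move=> h; rewrite lt_min !ltr_norml => /andP[/andP[h1 h2] /andP[h3 h4]].
have yE s : t0 <= s -> s <= t0 + d -> y s = xi t0 + primitive (g y) t0 s.
  by move=> s1 s2; rewrite (yT s) /T min_r// min_l.
rewrite !yE; [|lra..].
by rewrite opprD addrACA subrr add0r.
Qed.

End LocalExistence.

(** * Essential bounds on inputs *)

Section Inputs.
Variables (R : realType) (m : nat).
Local Notation mu := (@lebesgue_measure R).
Implicit Types (u : R -> 'cV[R]_m) (b t : R).

Lemma lebesgue_measureT_gt0 : (0 < mu [set: R])%E.
Proof.
apply: (@lt_le_trans _ _ (mu (`]0, 1] : set R))).
  by rewrite (lebesgue_measure_seg ler01) subr0 lte_fin.
exact: lebesgue_measure_mono.
Qed.

Lemma ae_neq (a : R) : {ae mu, forall t, t != a}.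
Proof.
exists [set a]; split => //; first exact: lebesgue_measure_set1.
by move=> t /= /negP/negPn/eqP.
Qed.

Lemma input_norm_ge0 u t : (0 <= input_norm u t)%E.
Proof.
apply: ess_sup_gee; first exact: lebesgue_measureT_gt0.
apply: aeW => s; rewrite /patch; case: ifP => // _.
by rewrite lee_fin enorm_ge0.
Qed.

Lemma input_norm_fin u t : input_space u -> 0 <= t -> input_norm u t \is a fin_num.
Proof. by move=> [_ H] t0; rewrite ge0_fin_numE ?input_norm_ge0// H. Qed.

Lemma input_norm_bound u b : input_space u -> 0 <= b ->
  {ae mu, forall s, 0 <= s <= b -> enorm (u s) <= fine (input_norm u b)}.
Proof.
move=> hu b0; have := ess_sup_ge mu ((fun s => (enorm (u s))%:E) \_ `[0, b]).
apply: ae_imp => s + sb.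
rewrite /patch mem_set; last by rewrite /= in_itv.
by rewrite -lee_fin fineK//; exact: input_norm_fin.
Qed.

Lemma fine_input_norm_ge0 u t : 0 <= fine (input_norm u t).
Proof. by rewrite fine_ge0// input_norm_ge0. Qed.

Lemma fine_input_norm_mono u s t : input_space u -> 0 <= s -> s <= t ->
  fine (input_norm u s) <= fine (input_norm u t).
Proof.
move=> hu s0 st; apply: fine_le; rewrite ?input_norm_fin// ?(le_trans s0)//.
apply: le_ess_sup; apply: aeW => r; rewrite /patch.
case: ifPn => [/set_mem|_]; last first.
  by case: ifP => // _; rewrite lee_fin enorm_ge0.
rewrite /= in_itv/= => /andP[r0 rs]; rewrite mem_set//=.
by rewrite in_itv/= r0 (le_trans rs).
Qed.

End Inputs.

(** * Solutions on segments: regularity, uniqueness, gluing *)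

Section Solutions.
Variables (R : realType) (Delta : R) (n m : nat).
Variable f : (R -> 'cV[R]_n) -> 'cV[R]_m -> 'cV[R]_n.
Hypothesis D0 : 0 <= Delta.
Hypothesis flip : lipschitz_on_bounded_rhs Delta f.
Hypothesis f0 : f (fun=> 0) 0 = 0.
Local Notation mu := (@lebesgue_measure R).
Implicit Types (x y z : R -> 'cV[R]_n) (u : R -> 'cV[R]_m) (b t : R).

(** Working form of a solution on [0, b]: y is continuous on all of R, so histories need no care
    about domains, and the initial condition is kept separate. *)
Definition solves u b y := [/\ continuous y, abs_continuous 0 b y &
  {ae mu, forall t, 0 < t < b -> is_derive t 1 y (f (hist_at y t) (u t))}].

Lemma is_derive_local x y a b t w : (forall s, a < s < b -> x s = y s) ->
  a < t < b -> is_derive t 1 y w -> is_derive t 1 x w.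
Proof.
move=> xy /andP[at_ tb]; apply: is_derive_incr.
apply/near0P; exists (Num.min (t - a) (b - t)); first by rewrite lt_min !subr_gt0 at_.
move=> h; rewrite lt_min !ltr_norml => /andP[/andP[h1 h2] /andP[h3 h4]].
by rewrite !xy//; apply/andP; split; lra.
Qed.

Lemma bounded_on_segment y a b : continuous y -> a <= b ->
  exists2 r, 0 <= r & forall t, a <= t <= b -> enorm (y t) <= r.
Proof.
move=> yc ab.
have : {within `[a, b], continuous (fun s => enorm (y s))}.
  by apply: continuous_subspaceT => s; apply: enorm_cvg; exact: yc.
move=> /(EVT_max ab)[c _ H]; exists (enorm (y c)); first exact: enorm_ge0.
by move=> t ht; apply: H; rewrite in_itv.
Qed.

Lemma hist_at_space y t : continuous y -> hist_space Delta (hist_at y t).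
Proof. by move=> yc; apply: continuous_hist_space; exact: continuous_hist_at. Qed.

(** On a segment the histories are bounded, and so is the input almost everywhere; hence the
    derivative is bounded and absolute continuity improves to a Lipschitz bound. *)
Lemma solves_lipschitz u b y K : solves u b y ->
  {ae mu, forall s, 0 <= s <= b -> enorm (u s) <= K} ->
  exists2 C, 0 <= C & forall s t, 0 <= s -> s <= t -> t <= b ->
    enorm (y t - y s) <= C * (t - s).
Proof.
move=> [yc yac yd] uK; have Dge := D0.
have [b0|b0] := leP 0 b; last by exists 0 => // s t; lra.
have [|r r0 yr] := bounded_on_segment yc (_ : - Delta <= b); first by lra.
have [F F0 HF] := rhs_bounded D0 flip (Num.max r K) f0.
exists F => // s t s0 st tb; apply: (abs_continuous_le st F0).
  exact: abs_continuous_sub yac.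
apply: ae_imp (ae_and yd uK) => q [qd qK] /andP[sq qt].
exists (f (hist_at y q) (u q)); first by apply: qd; apply/andP; split; lra.
apply: HF; first exact: hist_at_space.
  apply: (hist_norm_at_le D0) => v /andP[v1 v2]; rewrite le_max yr//.
  by apply/andP; split; lra.
by rewrite le_max qK ?orbT//; apply/andP; split; lra.
Qed.

(** On a step of length at most h, with L h <= 1/2, starting where y and z still agree, the maximum
    E of |y - z| also bounds the distance of the histories. Hence E <= E / 2, so E = 0, and finitely
    many steps reach b. *)
Lemma solves_unique u b y z K : solves u b y -> solves u b z ->
  {ae mu, forall s, 0 <= s <= b -> enorm (u s) <= K} ->
  (forall t, - Delta <= t <= 0 -> y t = z t) ->
  forall t, - Delta <= t <= b -> y t = z t.
Proof.
move=> [yc yac yd] [zc zac zd] uK yz0; have Dge := D0.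
have [b0|b0] := leP 0 b; last by move=> t /andP[? ?]; apply: yz0; apply/andP; split; lra.
have [|r r0 yr] := bounded_on_segment yc (_ : - Delta <= b); first by lra.
have [|r' r'0 zr] := bounded_on_segment zc (_ : - Delta <= b); first by lra.
have [L L0 HL] := rhs_lipschitz D0 flip (r + r' + `|K|).
pose h := (2 * L + 1)^-1.
have p0 : 0 < 2 * L + 1 by lra.
have h0 : 0 < h by rewrite invr_gt0.
have hL : L * h <= 2^-1 by rewrite /h ler_pdivrMr//; lra.
have K0 : K <= `|K| := ler_norm K.
have Kn : 0 <= `|K| := normr_ge0 K.
suff H j t : - Delta <= t -> t <= b -> t <= j%:R * h -> y t = z t.
  move=> t /andP[t1 t2]; apply: (H (Num.truncn (b / h)).+1) => //.
  by apply: (le_trans t2); rewrite -ler_pdivrMr//; exact/ltW/truncnS_gt.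
elim: j t => [|j IH] t t1 t2; first by rewrite mul0r => tt; apply: yz0; rewrite t1.
rewrite -natr1 mulrDl mul1r => tj.
pose c := Num.min (j%:R * h) b.
have [tc|ct] := leP t c.
  by apply: IH => //; move: tc; rewrite le_min => /andP[].
have cj : c <= j%:R * h by rewrite ge_min lexx.
have jh : 0 <= j%:R * h by rewrite mulr_ge0// ltW.
have c0 : 0 <= c by rewrite le_min jh.
have cjE : c = j%:R * h.
  rewrite /c; case: leP => // bj; exfalso.
  by move: ct; rewrite /c min_r ?(ltW bj)//; lra.
rewrite -cjE in tj IH; clear cj jh cjE; clearbody c h.
have : {within `[c, t], continuous (fun s => enorm (y s - z s))}.
  apply: continuous_subspaceT => s; apply: enorm_cvg.
  by apply: cvgB; [exact: yc|exact: zc].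
move=> /(EVT_max (ltW ct))[q]; rewrite in_itv/= => /andP[cq qt] Hq.
pose E := enorm (y q - z q).
have E0 : 0 <= E := enorm_ge0 _.
have yzc : y c - z c = 0 by rewrite IH ?subrr//; lra.
have : enorm ((y \- z) q - (y \- z) c) <= L * E * (q - c).
  apply: (@abs_continuous_le _ _ (y \- z) c q (L * E) cq); first exact: mulr_ge0.
    by apply: abs_continuousB; [apply: abs_continuous_sub yac|apply: abs_continuous_sub zac] => //; lra.
  apply: ae_imp (ae_and yd (ae_and zd uK)) => s [sy [sz su]] /andP[cs sq].
  have s0b : 0 < s < b by apply/andP; split; lra.
  exists (f (hist_at y s) (u s) - f (hist_at z s) (u s)).
    exact: is_deriveB (sy s0b) (sz s0b).
  have us : enorm (u s) <= K by apply: su; apply/andP; split; lra.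
  apply: le_trans (HL _ _ _ _ _ _ _ _ _ _) _; try exact: hist_at_space.
  - by apply: (hist_norm_at_le D0) => v /andP[v1 v2]; apply: (@le_trans _ _ r);
      [apply: yr; apply/andP; split; lra|lra].
  - by apply: (hist_norm_at_le D0) => v /andP[v1 v2]; apply: (@le_trans _ _ r');
      [apply: zr; apply/andP; split; lra|lra].
  - by lra.
  - by lra.
  rewrite subrr enorm0 addr0; apply: ler_wpM2l => //.
  apply: (hist_norm_le D0) => tau /andP[tau1 tau2] /=; rewrite /hist_at.
  have [sc|sc] := leP (s + tau) c.
    by rewrite IH ?subrr ?enorm0 ?enorm_ge0//; lra.
  by apply: Hq; rewrite in_itv/=; apply/andP; split; lra.
rewrite /= yzc subr0 -/E.
have qh : q - c <= h by lra.
have -> : L * E * (q - c) = E * (L * (q - c)) by ring.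
have Lq : L * (q - c) <= 2^-1 by apply: le_trans hL; exact: ler_wpM2l.
move=> /le_trans /(_ (ler_wpM2l E0 Lq)) Ehalf.
have Et : enorm (y t - z t) <= E by apply: Hq; rewrite in_itv/= lexx (ltW ct).
apply/eqP; rewrite -subr_eq0; apply/eqP/enorm_eq0/le_anti; rewrite enorm_ge0 andbT.
by lra.
Qed.

Section FixedData.
Variables (x0 : R -> 'cV[R]_n) (u : R -> 'cV[R]_m).
Hypothesis hx0 : hist_space Delta x0.
Hypothesis hu : input_space u.

Local Notation sol := (solution Delta f x0 u).

(** Values of x outside its interval are arbitrary; clamping makes it continuous on R, and [rhs_ext]
    carries the equation over. *)
Lemma solution_clamp (T : \bar R) x b : sol T x -> 0 <= b -> (b%:E < T)%E ->
  solves u b (x \o clamp (- Delta) b).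
Proof.
move=> [T0 xc xx0 xac xd] b0 bT; have Dge := D0.
have Db : - Delta <= b by lra.
have E t : - Delta <= t -> t <= b -> (x \o clamp (- Delta) b) t = x t.
  by move=> t1 t2 /=; rewrite clamp_id// t1.
have yc : continuous (x \o clamp (- Delta) b).
  apply: continuous_clamp => //; apply: continuous_subspaceW xc => t /=.
  rewrite in_itv/= => /andP[t1 t2]; split=> //.
  by apply: le_lt_trans bT; rewrite lee_fin.
split=> //.
  move=> e e0; have [d d0 H] := xac b b0 bT e e0; exists d => // N l r lr tr s.
  rewrite (eq_bigr (fun i => enorm (x (r i) - x (l i)))); first exact: H.
  by move=> i _; have [l1 [l2 l3]] := lr i; rewrite !E//; lra.
apply: ae_imp xd => t H /andP[t0 tb].
have hE : forall tau, - Delta <= tau <= 0 ->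
    hist_at x t tau = hist_at (x \o clamp (- Delta) b) t tau.
  by move=> tau /andP[tau1 tau2]; rewrite /hist_at E//; lra.
rewrite -(rhs_ext D0 flip (u t) _ hE); last first.
  apply: hist_space_ext _ (hist_at_space yc) => tau htau.
  by rewrite hE.
apply: (@is_derive_local _ x (- Delta) b).
- by move=> s /andP[s1 s2]; rewrite E//; exact: ltW.
- by rewrite tb andbT; lra.
- by apply: H; [exact: ltW|apply: lt_trans bT; rewrite lte_fin].
Qed.

Lemma solution_start (T : \bar R) x t : sol T x -> - Delta <= t <= 0 -> x t = x0 t.
Proof. by move=> [_ _ H _ _]; exact: H. Qed.

Lemma solution_unique (T T' : \bar R) x x' t : sol T x -> sol T' x' ->
  - Delta <= t -> (t%:E < T)%E -> (t%:E < T')%E -> x t = x' t.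
Proof.
move=> sx sx' t1 tT tT'; have [t0|t0] := leP t 0.
  by rewrite (solution_start sx) ?t1// (solution_start sx') ?t1.
have ht : - Delta <= t <= t by rewrite t1 lexx.
have := solves_unique (solution_clamp sx (ltW t0) tT) (solution_clamp sx' (ltW t0) tT')
  (input_norm_bound hu (ltW t0)) _ ht.
rewrite /= !clamp_id//; apply.
move=> s /andP[s1 s2] /=; rewrite !clamp_id ?s1 ?(le_trans s2) ?(ltW t0)//.
by rewrite (solution_start sx) ?s1// (solution_start sx') ?s1.
Qed.

Lemma clamp_within_continuous (T : \bar R) x :
  (forall b, 0 <= b -> (b%:E < T)%E -> continuous (x \o clamp (- Delta) b)) ->
  (0 < T)%E ->
  {within [set t : R | - Delta <= t /\ (t%:E < T)%E], continuous x}.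
Proof.
move=> H T0; apply/subspace_continuousP => t [t1 tT].
have [b [b0 tb bT]] : exists b, [/\ 0 <= b, t < b & (b%:E < T)%E].
  case: T T0 tT {H} => [T| |] //=.
    rewrite !lte_fin => T0 tT; exists ((Num.max t 0 + T) / 2).
    have M0 : 0 <= Num.max t 0 by rewrite le_max lexx orbT.
    have Mt : t <= Num.max t 0 by rewrite le_max lexx.
    have MT : Num.max t 0 < T by rewrite gt_max tT.
    by split; rewrite ?lte_fin; lra.
  by move=> _ _; exists (Num.max t 0 + 1); split; rewrite ?ltry//;
    [rewrite addr_ge0// le_max lexx orbT|rewrite ltr_pwDr// le_max lexx].
have := H b b0 bT t; rewrite /continuous_at /= clamp_id ?t1 ?ltW// => xt A /xt xA.
suff : \forall s \near t, [set t : R | - Delta <= t /\ (t%:E < T)%E] s -> A (x s) by [].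
have sb : \forall s \near t, s <= b.
  by exists (b - t) => /= [|s]; rewrite ?subr_gt0// /ball_/= ltr_norml => /andP[]; lra.
have {}xA : \forall s \near t, A ((x \o clamp (- Delta) b) s) by exact: xA.
apply: filterS (filterI xA sb) => s [As sb'] [s1 sT].
by move: As; rewrite /= clamp_id// s1.
Qed.

(** Countably many segments exhaust [0, T[, so the null sets where the equation may fail unite to a
    null set, for T = +oo as well. *)
Lemma solution_of_solves (T : \bar R) x : (0 < T)%E ->
  (forall t, - Delta <= t <= 0 -> x t = x0 t) ->
  (forall b, 0 <= b -> (b%:E < T)%E -> exists y, solves u b y /\
    forall t, - Delta <= t <= b -> x t = y t) ->
  sol T x.
Proof.
move=> T0 xx0 H; have Dge := D0.
have Hc b : 0 <= b -> (b%:E < T)%E -> solves u b (x \o clamp (- Delta) b).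
  move=> b0 bT; have [y [[yc yac yd] xy]] := H b b0 bT.
  have Db : - Delta <= b by lra.
  have xE : x \o clamp (- Delta) b = y \o clamp (- Delta) b.
    by apply/funext => t /=; rewrite xy// clamp_itv.
  have E t : - Delta <= t -> t <= b -> (y \o clamp (- Delta) b) t = y t.
    by move=> t1 t2 /=; rewrite clamp_id// t1.
  rewrite xE; split.
  - move=> t; apply: (@continuous_comp _ _ _ (clamp (- Delta) b) y); last exact: yc.
    exact: clamp_continuous.
  - move=> e /yac[d d0 K]; exists d => // N l r lr tr s.
    rewrite (eq_bigr (fun i => enorm (y (r i) - y (l i)))); first exact: K.
    by move=> i _; have [l1 [l2 l3]] := lr i; rewrite !E//; lra.
  - apply: ae_imp yd => t K /andP[t0 tb].
    have hE : forall tau, - Delta <= tau <= 0 ->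
        hist_at y t tau = hist_at (y \o clamp (- Delta) b) t tau.
      by move=> tau /andP[tau1 tau2]; rewrite /hist_at E//; lra.
    rewrite -(rhs_ext D0 flip (u t) (hist_at_space yc) hE).
    apply: (@is_derive_local _ y (- Delta) b).
    + by move=> s /andP[s1 s2]; rewrite E//; exact: ltW.
    + by rewrite tb andbT; lra.
    + by apply: K; rewrite t0.
have E b t : - Delta <= t -> t <= b -> (x \o clamp (- Delta) b) t = x t.
  by move=> t1 t2 /=; rewrite clamp_id// t1.
split=> //.
- by apply: clamp_within_continuous => // b b0 /(Hc b b0)[].
- move=> b b0 /(Hc b b0)[_ xac _] e /xac[d d0 K]; exists d => // N l r lr tr s.
  rewrite (eq_bigr (fun i => enorm ((x \o clamp (- Delta) b) (r i) - (x \o clamp (- Delta) b) (l i)))); first exact: K.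
  by move=> i _; have [l1 [l2 l3]] := lr i; rewrite !E//; lra.
(* A sequence in [0, T[ that passes every t < T. *)
- pose b k : R := match T with r%:E => r - r / k.+2%:R | _ => k%:R end.
  have bP k : 0 <= b k /\ ((b k)%:E < T)%E.
    have k1 : 1 <= k.+2%:R :> R by rewrite ler1n.
    have kp : 0 < k.+2%:R :> R by rewrite ltr0n.
    rewrite /b; case: T T0 {H Hc b} => [T| |]//=; last by split; rewrite ?ltry.
    rewrite lte_fin => T0; split; last by rewrite lte_fin ltrBlDr ltrDl divr_gt0.
    by rewrite subr_ge0 ler_pdivrMr// ler_peMr// ltW.
  have bT t : 0 <= t -> (t%:E < T)%E -> exists k, t < b k.
    rewrite /b; case: T T0 {H Hc b bP} => [T| |]//=.
      rewrite !lte_fin => T0 t0 tT.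
      exists (Num.truncn (T / (T - t))).
      rewrite ltrBrDr -ltrBrDl ltr_pdivrMr ?ltr0n// mulrC -ltr_pdivrMr ?subr_gt0//.
      by apply: lt_trans (truncnS_gt _) _; rewrite ltr_nat.
    by move=> _ t0 _; exists (Num.truncn t).+1; exact: truncnS_gt.
  have := @ae_foralln _ _ _ mu (fun k t => 0 < t < b k -> is_derive t 1
    (x \o clamp (- Delta) (b k)) (f (hist_at (x \o clamp (- Delta) (b k)) t) (u t))).
  move=> K; have /K{K} : forall k, {ae mu, forall t, 0 < t < b k -> is_derive t 1
    (x \o clamp (- Delta) (b k)) (f (hist_at (x \o clamp (- Delta) (b k)) t) (u t))}.
    by move=> k; have [b0 bkT] := bP k; have [] := Hc _ b0 bkT.
  (* [solves] says nothing at t = 0, which [solution] includes; this single point is discarded. *)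
  move=> K; apply: ae_imp (ae_and K (ae_neq 0)) => t [Kt tn0] t0 tT.
  have {}t0 : 0 < t by rewrite lt_neqAle eq_sym tn0.
  have [k tk] := bT t (ltW t0) tT; have [b0 bkT] := bP k.
  have [yc _ _] := Hc _ b0 bkT.
  have hE : forall tau, - Delta <= tau <= 0 ->
      hist_at (x \o clamp (- Delta) (b k)) t tau = hist_at x t tau.
    by move=> tau /andP[tau1 tau2]; rewrite /hist_at E//; lra.
  rewrite -(rhs_ext D0 flip (u t) (hist_at_space yc) hE).
  apply: (@is_derive_local _ (x \o clamp (- Delta) (b k)) (- Delta) (b k)).
  + by move=> s /andP[s1 s2]; rewrite E//; exact: ltW.
  + by rewrite tk andbT; lra.
  + by apply: Kt; rewrite t0.
Qed.

End FixedData.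
End Solutions.

(** * Continuation under an a priori bound *)

Section GlobalSolutions.
Variables (R : realType) (Delta : R) (n m : nat).
Variable f : (R -> 'cV[R]_n) -> 'cV[R]_m -> 'cV[R]_n.
Hypothesis D0 : 0 <= Delta.
Hypothesis flip : lipschitz_on_bounded_rhs Delta f.
Hypothesis f0 : f (fun=> 0) 0 = 0.
Local Notation mu := (@lebesgue_measure R).
Variables (x0 : R -> 'cV[R]_n) (u : R -> 'cV[R]_m).
Hypothesis hx0 : hist_space Delta x0.
Hypothesis hu : input_space u.
Implicit Types (x y z : R -> 'cV[R]_n) (b t : R).

Local Notation sol := (solution Delta f x0 u).

Lemma solution_sub (T T' : \bar R) x : (0 < T')%E -> (T' <= T)%E -> sol T x -> sol T' x.
Proof.
move=> T'0 TT sx; have Dge := D0; apply: (solution_of_solves D0 flip) => //.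
  by move=> t; exact: (solution_start sx).
move=> b b0 bT'; exists (x \o clamp (- Delta) b); split.
  exact: (solution_clamp D0 flip sx b0 (lt_le_trans bT' TT)).
by move=> t ht /=; rewrite clamp_id.
Qed.

(** The solution xi on [0, t0] serves as the initial history of a local solution. The gain d is the
    same for all t0 <= b, since the input is bounded once and for all on [0, b + 1]. *)
Lemma solution_step (M b : R) : 0 <= M -> 0 <= b ->
  exists2 d, 0 < d & forall t0 xi, 0 <= t0 <= b -> solves f u t0 xi ->
    (forall t, enorm (xi t) <= M) -> (forall t, - Delta <= t <= 0 -> xi t = x0 t) ->
    exists x, sol (t0 + d)%:E x.
Proof.
move=> M0 b0; have Dge := D0.
have b1 : 0 <= b + 1 by lra.
have K0 := fine_input_norm_ge0 u (b + 1).
have uK := input_norm_bound hu b1.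
set K := fine _ in K0 uK.
have [w [wm wK wu]] := borel_representative K0 hu uK.
have [dl dl0 H] := local_existence D0 flip f0 M0 K0.
(* The cap 1 keeps t0 + d within [0, b + 1], where K bounds the input and w represents it. *)
pose d := Num.min dl 1.
have d0 : 0 < d by rewrite lt_min dl0 ltr01.
have d1 : d <= 1 by rewrite ge_min lexx orbT.
have dd : d <= dl by rewrite ge_min lexx.
exists d => // t0 xi /andP[t00 t0b] xis xiM xix0; have [xic xiac xid] := xis.
have [y [yc yxi [C2 yC2] yd]] := H t0 xi w xic xiM wm wK.
have uK' : {ae mu, forall s, 0 <= s <= t0 -> enorm (u s) <= K}.
  by apply: ae_imp uK => s Hs /andP[s1 s2]; apply: Hs; apply/andP; split; lra.
have [C1 C10 yC1] := solves_lipschitz D0 flip f0 xis uK'.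
exists y; apply: (solution_of_solves D0 flip).
- by rewrite lte_fin; lra.
- by move=> t /[dup] /xix0 <- /andP[_ t0']; apply: yxi; lra.
move=> b' b'0; rewrite lte_fin => b't; exists y; split=> //; split=> //.
  have lip1 s t : 0 <= s -> s <= t -> t <= t0 -> enorm (y t - y s) <= (C1 + `|C2|) * (t - s).
    move=> s0 st tt; rewrite !yxi//; last exact: le_trans tt.
    apply: le_trans (yC1 _ _ s0 st tt) _; apply: ler_wpM2r; first by rewrite subr_ge0.
    by rewrite lerDl.
  have lip2 s t : t0 <= s -> s <= t -> t <= t0 + dl -> enorm (y t - y s) <= (C1 + `|C2|) * (t - s).
    move=> s0 st tt; apply: le_trans (yC2 _ _ s0 st tt) _.
    apply: ler_wpM2r; first by rewrite subr_ge0.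
    by rewrite ler_wpDl// ler_norm.
  apply: (lipschitz_abs_continuous (C := C1 + `|C2|)) => s t s0 st tb.
  have [tt|tt] := leP t t0; first exact: lip1.
  have [ss|ss] := leP t0 s; first by apply: lip2 => //; lra.
  apply: le_trans (enorm_triangle (y t0) _ _) _.
  have -> : t - s = (t - t0) + (t0 - s) by ring.
  by rewrite mulrDr; apply: lerD; [apply: lip2|apply: lip1]; lra.
(* At the junction t0 the one-sided derivatives may differ, so this point is excluded too. *)
apply: ae_imp (ae_and xid (ae_and yd (ae_and wu (ae_neq t0)))) => t.
move=> [Hxi [Hy [Hw tt0]]] /andP[t1 t2].
have [tt|tt] := ltP t t0.
  have hE : forall tau, - Delta <= tau <= 0 -> hist_at xi t tau = hist_at y t tau.
    by move=> tau /andP[tau1 tau2]; rewrite /hist_at yxi//; lra.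
  rewrite -(rhs_ext D0 flip (u t) (hist_at_space xic) hE).
  apply: (@is_derive_local _ _ y xi 0 t0).
  + by move=> s /andP[_ s2]; rewrite yxi// ltW.
  + by rewrite t1.
  + by apply: Hxi; rewrite t1.
have {tt0}tt : t0 < t by rewrite lt_neqAle eq_sym tt0.
rewrite -Hw; last by apply/andP; split; lra.
by apply: Hy; apply/andP; split; lra.
Qed.

Variable B : R -> R.
Hypothesis apriori : forall T x, sol T x ->
  forall t, 0 <= t -> (t%:E < T)%E -> enorm (x t) <= B t.
Hypothesis B_bounded : forall b, exists M, forall t, 0 <= t <= b -> B t <= M.

(** A solution on [-Delta, T[ need not be defined at T, so the restart is made at T - e; with e <= d
    / 2 a gain of d / 2 remains. Agreement of x' with x is left to uniqueness. *)
Lemma solution_extend (b : R) : 0 <= b -> exists2 d, 0 < d & forall T x, 0 < T <= b ->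
  sol T%:E x -> exists x', sol (T + d)%:E x'.
Proof.
move=> b0; have Dge := D0; have [M BM] := B_bounded b.
have N0 := hist_norm_ge0 D0 hx0.
have M'0 : 0 <= hist_norm Delta x0 + `|M| by rewrite addr_ge0.
have [d d0 H] := solution_step M'0 b0.
exists (d / 2); first by rewrite divr_gt0.
move=> T x /andP[T0 Tb] sx.
pose e := Num.min d T / 2.
have e0 : 0 < e by rewrite divr_gt0// lt_min d0.
have ed : e <= d / 2 by rewrite ler_wpM2r ?invr_ge0// ge_min lexx.
have eT : e <= T / 2 by rewrite ler_wpM2r ?invr_ge0// ge_min lexx orbT.
have t00 : 0 <= T - e by lra.
have tT : ((T - e)%:E < T%:E)%E by rewrite lte_fin; lra.
have [||||x' sx'] := H (T - e) (x \o clamp (- Delta) (T - e)).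
- by rewrite t00; lra.
- exact: (solution_clamp D0 flip sx t00 tT).
- move=> t /=; have [|c1 c2] := andP (clamp_itv t (_ : - Delta <= T - e)); first by lra.
  set c := clamp _ _ _ in c1 c2 *.
  have [c0|c0] := leP c 0.
    rewrite (solution_start sx) ?c1// ler_wpDr//.
    by apply: hist_norm_ub => //; rewrite c1.
  have cT : (c%:E < T%:E)%E by rewrite lte_fin; lra.
  apply: le_trans (apriori sx (ltW c0) cT) _.
  apply: le_trans (BM _ _) _; first by apply/andP; split; lra.
  by rewrite ler_wpDl// ler_norm.
- move=> t /andP[t1 t2] /=; rewrite clamp_id; last by apply/andP; split; lra.
  by rewrite (solution_start sx)// t1.
exists x'; apply: solution_sub sx'; rewrite ?lte_fin ?lee_fin; lra.
Qed.

Lemma solution_upto (b : R) : 0 < b -> exists x, sol b%:E x.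
Proof.
move=> b0; have Dge := D0; have N0 := hist_norm_ge0 D0 hx0.
have x0c := hist_space_clamp D0 hx0.
have [d1 d10 H1] := solution_step N0 (lexx 0).
have [||||x1 sx1] := H1 0 (x0 \o clamp (- Delta) 0).
- by rewrite lexx.
- split=> //.
    apply: (lipschitz_abs_continuous (C := 0)) => s t s0 st tb.
    have -> : s = 0 by lra.
    have -> : t = 0 by lra.
    by rewrite !subrr enorm0 mulr0.
  by apply: aeW => t; lra.
- move=> t; apply: (hist_norm_ub D0 hx0); apply: clamp_itv; lra.
- by move=> t ht /=; rewrite clamp_id.
have [d d0 H] := solution_extend (ltW b0).
(* Each extension gains the same length d as long as T < b, so about b / d of them suffice. *)
have K j : exists T x, [/\ 0 < T, sol T%:E x & b <= T \/ j%:R * d <= T].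
  elim: j => [|j [T [x [T0 sx bT]]]].
    by exists d1, x1; rewrite mul0r; split=> //; [rewrite -[d1]add0r|right; exact: ltW].
  have [bT'|Tb] := leP b T; first by exists T, x; split=> //; left.
  have [|x' sx'] := H T x _ sx; first by rewrite T0 ltW.
  exists (T + d), x'; split=> //; first by lra.
  by right; rewrite -natr1 mulrDl mul1r; case: bT => ?; lra.
have [T [x [T0 sx bT]]] := K (Num.truncn (b / d)).+1.
exists x; apply: solution_sub sx; rewrite ?lte_fin// lee_fin.
case: bT => // bT; apply: le_trans bT.
by rewrite -ler_pdivrMr//; exact/ltW/truncnS_gt.
Qed.

(** Glued pointwise: the value at t is taken from a solution that exists beyond t, and uniqueness
    makes the choices coherent. *)
Lemma solution_global : exists x, sol +oo%E x.
Proof.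
have [X HX] := choice (fun k : nat => solution_upto (ltr0Sn R k)).
exists (fun t => X (Num.truncn t) t); apply: (solution_of_solves D0 flip) => //.
  by move=> t ht; exact: (solution_start (HX _)).
move=> b b0 _; have bk : (b%:E < (Num.truncn b).+1%:R%:E)%E.
  by rewrite lte_fin truncnS_gt.
exists (X (Num.truncn b) \o clamp (- Delta) b); split.
  exact: (solution_clamp D0 flip (HX _) b0 bk).
move=> t /[dup] ht /andP[t1 t2] /=; rewrite clamp_id//.
apply: (solution_unique D0 flip hu (HX _) (HX _) t1); rewrite lte_fin ?truncnS_gt//.
by apply: le_lt_trans t2 _; rewrite -lte_fin.
Qed.

(** Nothing exceeds +oo, so a global solution is maximal. A finite T would be beaten by
    [solution_extend], the longer solution being an extension by uniqueness. *)
Lemma maximal_solutions_global :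
  (exists T x, maximal_solution Delta f x0 u T x) /\
  (forall T x, maximal_solution Delta f x0 u T x -> T = +oo%E).
Proof.
split.
  have [x sx] := solution_global; exists +oo%E, x; split=> // T' x' _ + _.
  by rewrite leye_eq => /eqP.
move=> [T| |] x [sx mx] //; last by case: sx.
have T0 : 0 < T by case: sx; rewrite lte_fin.
have [d d0 H] := solution_extend (ltW T0).
have [|x' sx'] := H T x _ sx; first by rewrite T0 lexx.
have TT : ((T + d)%:E = T%:E)%E.
  apply: (mx _ x') => //; first by rewrite lee_fin lerDl ltW.
  move=> t t1 tT; apply: (solution_unique D0 flip hu sx' sx t1) => //.
  by apply: lt_trans tT _; rewrite lte_fin ltrDl.
by case: TT => /eqP; rewrite -subr_eq0 addrAC subrr add0r gt_eqF.
Qed.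

End GlobalSolutions.

(** * The Lyapunov estimate *)

Section Gronwall.
Variable R : realType.
Local Notation mu := (@lebesgue_measure R).
Implicit Types (a b t h C : R).

Lemma expR_le_inv1B (x : R) : expR x * (1 - x) <= 1.
Proof.
by rewrite -[leRHS](expRxMexpNx_1 x) ler_pM2l ?expR_gt0// expR_ge1Dx.
Qed.

(** [dini_nonincreasing] applied to z(t) = exp(eta t)(w(t) - k), where k is the level to which w
    relaxes. The bound M controls the terms of second order in h. *)
Lemma dini_gronwall (w : R -> R) (eta k b C M : R) : 0 <= b -> 0 < eta -> 0 <= C ->
  (forall t, 0 <= t <= b -> `|w t - k| <= M) ->
  (forall t e, 0 < t <= b -> 0 < e ->
    exists2 d, 0 < d & forall s, 0 <= s -> t - d < s < t -> w t <= w s + e) ->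
  (forall t, 0 <= t < b -> \forall h \near 0^'+, w (t + h) <= w t + C * h) ->
  {ae mu, forall t, 0 <= t < b -> forall e, 0 < e ->
    \forall h \near 0^'+, w (t + h) <= w t + h * (- (eta * (w t - k)) + e)} ->
  w b <= expR (- (eta * b)) * (w 0 - k) + k.
Proof.
move=> b0 eta0 C0 wM wl wC wae.
have M0 : 0 <= M by apply: le_trans (wM 0 _); rewrite ?lexx.
pose z t := expR (eta * t) * (w t - k).
suff : z b <= z 0.
  rewrite /z mulr0 expR0 mul1r => zb; rewrite -lerBlDr expRN mulrC.
  by rewrite ler_pdivlMr ?expR_gt0// mulrC.
have E0 t : 0 < expR (eta * t) := expR_gt0 _.
have Em s t : s <= t -> expR (eta * s) <= expR (eta * t).
  by move=> st; rewrite ler_expR ler_wpM2l// ltW.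
(* First and second order bounds on exp(eta h) for eta h < 1/2; they stand in for the product rule,
   as w only has one-sided growth bounds. *)
have small h : 0 < h < (2 * eta)^-1 -> [/\ 1 + eta * h <= expR (eta * h),
    expR (eta * h) * (1 - eta * h) <= 1, expR (eta * h) <= 2 &
    expR (eta * h) <= 1 + 2 * (eta * h)].
  move=> /andP[h0 h1]; have eh : eta * h < 2^-1.
    by move: h1; rewrite invfM mulrC -ltr_pdivrMl ?invrK// invr_gt0.
  have eh0 : 0 < eta * h by rewrite mulr_gt0.
  have e1 := expR_ge1Dx (eta * h); have e2 := expR_le_inv1B (eta * h).
  by split=> //; nra.
(* Over a step h the exponential grows by at most 2 eta h, acting on |w - k| <= M, and at most
   doubles C h. *)
pose D := expR (eta * b) * (2 * eta * M + 2 * C).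
apply: (@dini_nonincreasing _ z 0 b D) => //.
- by rewrite mulr_ge0 ?expR_ge0// addr_ge0// !mulr_ge0// ltW.
- move=> t e /andP[t0 tb] e0.
  have e1 : 0 < e / 2 / expR (eta * t) by rewrite !divr_gt0.
  have [d d0 Hd] := wl t _ (ltac:(by rewrite t0) : 0 < t <= b) e1.
  have e2 : 0 < e / 2 / (M + 1) by rewrite !divr_gt0// ltr_wpDl.
  have cE : {for t, continuous (fun s => expR (eta * s))}.
    apply: (@continuous_comp _ _ _ (fun s => eta * s) expR); last exact: continuous_expR.
    by apply: cvgMr; exact: cvg_id.
  have /cvgrPdist_le/(_ _ e2)/nbhs_ballP[d' /= d'0 Hd'] := cE.
  exists (Num.min d d'); first by rewrite lt_min d0.
  move=> s s0 /andP[s1 st].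
  have s1d : t - d < s by apply: le_lt_trans s1; rewrite lerB// ge_min lexx.
  have s1d' : t - d' < s by apply: le_lt_trans s1; rewrite lerB// ge_min lexx orbT.
  have h1 := Hd s s0 (ltac:(by rewrite s1d) : t - d < s < t).
  have h2 : expR (eta * t) - expR (eta * s) <= e / 2 / (M + 1).
    apply: le_trans (ler_norm _) _; apply: Hd'; rewrite /ball/= gtr0_norm; lra.
  have h3 : 0 <= expR (eta * t) - expR (eta * s) by rewrite subr_ge0 Em// ltW.
  have h4 : w s - k <= M by apply: le_trans (ler_norm _) (wM _ _); apply/andP; split; lra.
  have -> : z t = z s + (expR (eta * t) * (w t - w s) +
     (expR (eta * t) - expR (eta * s)) * (w s - k)) by rewrite /z; ring.
  rewrite lerD2l (splitr e); apply: lerD.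
    have : w t - w s <= e / 2 / expR (eta * t) by lra.
    by move=> /(ler_wpM2l (ltW (E0 t))) /le_trans; apply; rewrite mulrC divfK// gt_eqF.
  apply: le_trans (ler_wpM2l h3 h4) _; apply: le_trans (ler_wpM2r M0 h2) _.
  have p1 : 0 < M + 1 by lra.
  by rewrite mulrAC ler_pdivrMr// ler_pM2l ?divr_gt0// lerDl.
- move=> t /[dup] htb /andP[t0 tb]; have /near0rP[d d0 H] := wC t htb.
  apply/near0rP; exists (Num.min d (2 * eta)^-1).
    by rewrite lt_min d0 invr_gt0 mulr_gt0.
  move=> h; rewrite lt_min => /andP[h0 /andP[hd he]].
  have [e1 e2 e3 e4] := small h ltac:(by rewrite h0).
  have wh := H h ltac:(by rewrite h0).
  have wt := wM t ltac:(by rewrite t0 ltW).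
  set Eh := expR (eta * h) in e1 e2 e3 e4.
  have -> : z (t + h) = expR (eta * t) * (Eh * (w (t + h) - k)).
    by rewrite /z (mulrDr eta) expRD -mulrA.
  have X : Eh * (w (t + h) - k) <= (w t - k) + (2 * eta * M + 2 * C) * h.
    have Y1 := ler_norm (w t - k).
    have Ch : 0 <= C * h by rewrite mulr_ge0// ltW.
    have eh : 0 < eta * h by rewrite mulr_gt0.
    have E1 : 1 <= Eh by lra.
    apply: (@le_trans _ _ (Eh * ((w t - k) + C * h))).
      by apply: ler_wpM2l; lra.
    have A1 : Eh * (C * h) <= 2 * (C * h) by exact: ler_wpM2r.
    have A2 : (Eh - 1) * (w t - k) <= (2 * (eta * h)) * M.
      by apply: (@le_trans _ _ ((Eh - 1) * M)); [apply: ler_wpM2l; lra|apply: ler_wpM2r; lra].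
    have -> : Eh * (w t - k + C * h) = (w t - k) + (Eh - 1) * (w t - k) + Eh * (C * h) by ring.
    have -> : (2 * eta * M + 2 * C) * h = 2 * (eta * h) * M + 2 * (C * h) by ring.
    by lra.
  apply: le_trans (ler_wpM2l (ltW (E0 t)) X) _.
  have -> : D * h = expR (eta * b) * ((2 * eta * M + 2 * C) * h) by rewrite /D mulrA.
  rewrite mulrDr lerD2l; apply: ler_wpM2r; last by apply: Em; lra.
  by rewrite mulr_ge0 ?addr_ge0 ?mulr_ge0// ltW.
- apply: negligibleS wae => t /= nH H; apply: nH => /[dup] htb /andP[t0 tb] e e0.
  have e1 : 0 < e / (4 * expR (eta * t)) by rewrite divr_gt0// mulr_gt0.
  have /near0rP[d d0 Hd] := H htb _ e1.
  set e' := e / _ in e1 Hd.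
  (* This bound on h makes the second-order error (eta h)^2 M at most e' h; with the 2 e' h from the
     growth of w it stays below the 4 e' h allowed. *)
  have q0 : 0 < e' / (eta * eta * (M + 1)).
    by rewrite divr_gt0// !mulr_gt0// ltr_wpDl.
  apply/near0rP; exists (Num.min d (Num.min (2 * eta)^-1 (e' / (eta * eta * (M + 1))))).
    by rewrite !lt_min d0 q0 invr_gt0 mulr_gt0.
  move=> h; rewrite lt_min => /andP[h0 /andP[hd]]; rewrite lt_min => /andP[he hq].
  have [a1 a2 a3 a4] := small h ltac:(by rewrite h0).
  have wh := Hd h ltac:(by rewrite h0).
  have wt := wM t ltac:(by rewrite t0 ltW).
  set Eh := expR (eta * h) in a1 a2 a3 a4.
  have -> : z (t + h) = expR (eta * t) * (Eh * (w (t + h) - k)).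
    by rewrite /z (mulrDr eta) expRD -mulrA.
  have X : Eh * (w (t + h) - k) <= (w t - k) + 4 * e' * h.
    set Y := w t - k in wh wt *.
    have eh : 0 < eta * h by rewrite mulr_gt0.
    have E1 : 1 <= Eh by lra.
    apply: (@le_trans _ _ (Eh * (Y + h * (- (eta * Y) + e')))).
      apply: ler_wpM2l; first by lra.
      move: wh; move: (h * _) => Z wh.
      have YE : Y = w t - k by [].
      by lra.
    have -> : Eh * (Y + h * (- (eta * Y) + e')) = Y + (Eh * (1 - eta * h) - 1) * Y + Eh * (h * e').
      by ring.
    have he0 : 0 < h * e' by rewrite mulr_gt0.
    have A1 : Eh * (h * e') <= 2 * (h * e') by apply: ler_wpM2r => //; exact: ltW.
    have A2 : (Eh * (1 - eta * h) - 1) * Y <= (eta * h) * (eta * h) * M.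
      have B1 : - ((eta * h) * (eta * h)) <= Eh * (1 - eta * h) - 1.
        have eh2 : 0 <= 1 - eta * h.
          by move: he; rewrite invfM mulrC -ltr_pdivrMl ?invrK ?invr_gt0//; lra.
        by have := ler_wpM2r eh2 a1; nra.
      have B2 : - M <= Y by move: wt; rewrite ler_norml => /andP[].
      have B3 : Y <= M by move: wt; rewrite ler_norml => /andP[].
      have B4 : Eh * (1 - eta * h) - 1 <= 0 by lra.
      set bb := Eh * (1 - eta * h) - 1 in B1 B4 *.
      apply: (@le_trans _ _ (- bb * M)).
        by rewrite mulNr -mulrN; exact: ler_wnM2l.
      by apply: ler_wpM2r => //; rewrite lerNl.
    have A3 : (eta * h) * (eta * h) * M <= h * e'.
      have p0 : 0 < eta * eta * (M + 1) by rewrite !mulr_gt0// ltr_wpDl.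
      have : h * (eta * eta * (M + 1)) <= e' by rewrite -ler_pdivlMr// ltW.
      move=> /(ler_wpM2l (ltW h0)); apply: le_trans.
      have -> : eta * h * (eta * h) * M = h * (h * (eta * eta * M)) by ring.
      apply: ler_wpM2l; first exact: ltW.
      apply: ler_wpM2l; first exact: ltW.
      by apply: ler_wpM2l; [rewrite mulr_ge0// ltW|lra].
    have -> : 4 * e' * h = 4 * (h * e') by ring.
    by lra.
  apply: le_trans (ler_wpM2l (ltW (E0 t)) X) _.
  rewrite mulrDr lerD2l /e'.
  have -> : expR (eta * t) * (4 * (e / (4 * expR (eta * t))) * h) = e * h.
    by field; rewrite gt_eqF.
  by [].
Qed.

End Gronwall.

Section BformIdentities.
Variables (R : realType) (n : nat) (P : 'M[R]_n).
Hypothesis P_sym : P^T = P.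
Implicit Types x z : 'cV[R]_n.

Lemma bform_expand x z :
  bform P x x = bform P z z + 2 * bform P z (x - z) + bform P (x - z) (x - z).
Proof.
rewrite -{1 2}(subrK z x); move: (x - z) => d.
rewrite bformDl !bformDr (bform_sym d z P_sym).
by move: (bform P z z) (bform P z d) (bform P d d) => ? ? ?; ring.
Qed.

Lemma bform_diff x z : bform P x x = bform P z z + bform P (x - z) (x + z).
Proof.
rewrite bformDl !bformDr -scaleN1r !bformZl (bform_sym z x P_sym).
by move: (bform P z z) (bform P x z) (bform P x x) => ? ? ?; ring.
Qed.

End BformIdentities.

(** * The driver derivative compared with true histories *)

Section DriverDerivative.
Variables (R : realType) (Delta : R) (n : nat).
Hypothesis D0 : 0 <= Delta.
Implicit Types (y : R -> 'cV[R]_n) (V : (R -> 'cV[R]_n) -> R) (t h g : R).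

(** The upper limit is an infimum of suprema over right neighbourhoods of 0; a level strictly above
    it bounds one of these suprema. *)
Lemma driver_derivative_le V phi w g e : (driver_derivative V phi w <= g%:E)%E ->
  0 < e -> \forall h \near 0^'+, V (driver_shift phi h w) <= V phi + h * (g + e).
Proof.
move=> Hg e0; have : (driver_derivative V phi w < (g + e)%:E)%E.
  by apply: le_lt_trans Hg _; rewrite lte_fin ltrDl.
rewrite /driver_derivative /limf_esup => /ereal_inf_lt[_ [S FS <-] Sg].
have h0 : \forall h \near (0 : R)^'+, 0 < h by exact: nbhs_right_gt.
apply: filterS (filterI FS h0) => h [Sh hp].
have : (((V (driver_shift phi h w) - V phi) / h)%:E < (g + e)%:E)%E.
  by apply: le_lt_trans Sg; apply: ereal_sup_ubound; exists h.
by rewrite lte_fin ltr_pdivrMr// => /ltW; rewrite mulrC lerBlDl.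
Qed.

(** The min-max form shows continuity across s = -h without splitting cases. *)
Lemma driver_shift_hist_at y t h w : driver_shift (hist_at y t) h w =
  (fun s => y (t + Num.min (s + h) 0) + Num.max (h + s) 0 *: w).
Proof.
apply/funext => s; rewrite /driver_shift /hist_at; case: ifPn => sh.
  rewrite min_l; last by lra.
  by rewrite max_r ?scale0r ?addr0//; lra.
rewrite min_r; last by lra.
by rewrite max_l//; lra.
Qed.

Lemma driver_shift_space y t h w : continuous y ->
  hist_space Delta (driver_shift (hist_at y t) h w).
Proof.
move=> yc; apply: continuous_hist_space; rewrite driver_shift_hist_at => s.
have c1 : (fun s : R => t + Num.min (s + h) 0) s' @[s' --> s] --> t + Num.min (s + h) 0.
  apply: cvgD; first exact: cvg_cst.
  have : {for s, continuous (fun s : R => Num.min (s + h) 0)}.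
    apply: continuous_min; last exact: cst_continuous.
    by apply: cvgD; [exact: cvg_id|exact: cvg_cst].
  by [].
have c2 : Num.max (h + s') 0 @[s' --> s] --> Num.max (h + s) 0.
  have : {for s, continuous (fun s : R => Num.max (h + s) 0)}.
    apply: continuous_max; last exact: cst_continuous.
    by apply: cvgD; [exact: cvg_cst|exact: cvg_id].
  by [].
rewrite /continuous_at; apply: cvgD; last by apply: cvgZr_tmp.
by apply: (@cvg_comp _ _ _ _ y _ _ _ c1); exact: yc.
Qed.

(** The two functions coincide on the old part of the window, so only the linearization error of y
    on [t, t + h] counts; the modulus of continuity of the old history does not enter. *)
Lemma driver_shift_dist y t h w (rho : R) : 0 <= h -> 0 <= rho ->
  (forall j, 0 <= j <= h -> enorm (y (t + j) - y t - j *: w) <= rho * h) ->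
  hist_norm Delta (hist_at y (t + h) \- driver_shift (hist_at y t) h w) <= rho * h.
Proof.
move=> h0 rho0 H; apply: (hist_norm_le D0) => s /andP[s1 s2] /=.
rewrite /driver_shift /hist_at; case: ifPn => sh.
  have -> : t + h + s = t + (s + h) by ring.
  by rewrite subrr enorm0 mulr_ge0.
have -> : t + h + s = t + (h + s) by ring.
rewrite opprD addrA addr0; apply: H; apply/andP; split; lra.
Qed.

End DriverDerivative.

(** * The Lyapunov functional along a trajectory *)

Section Lyapunov.
Variables (R : realType) (Delta : R) (n m : nat) (P : 'M[R]_n).
Variables (f : (R -> 'cV[R]_n) -> 'cV[R]_m -> 'cV[R]_n) (V : (R -> 'cV[R]_n) -> R).
Variables (a abar sigma c p1 p2 : R) (gamma : R -> R).
Local Notation mu := (@lebesgue_measure R).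
Hypothesis D0 : 0 <= Delta.
Hypothesis flip : lipschitz_on_bounded_rhs Delta f.
Hypothesis f0 : f (fun=> 0) 0 = 0.
Hypothesis Vlip : lipschitz_on_bounded_functional Delta V.
Hypothesis P_sym : P^T = P.
Hypotheses (p1_gt0 : 0 < p1) (p2_gt0 : 0 < p2) (a_gt0 : 0 < a) (abar_gt0 : 0 < abar)
  (sigma_gt0 : 0 < sigma) (c_ge0 : 0 <= c).
Hypothesis P_low : forall z, p1 * enorm z ^+ 2 <= bform P z z.
Hypothesis P_up : forall x y, `|bform P x y| <= p2 * (enorm x * enorm y).
Hypothesis gamma_mono : forall s t : R, 0 <= s -> s <= t -> gamma s <= gamma t.
Hypothesis gamma0 : gamma 0 = 0.
Hypothesis V_bounds : forall phi, hist_space Delta phi ->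
  0 <= V phi <= abar * hist_norm Delta phi ^+ 2.
Hypothesis V_driver : forall phi (v : 'cV[R]_m), hist_space Delta phi ->
  (driver_derivative V phi (f phi v)
    <= (- a * enorm (phi 0) ^+ 2 + c * hist_norm Delta phi ^+ 2 + gamma (enorm v))%:E)%E.
Hypothesis P_growth : forall phi (v : 'cV[R]_m), hist_space Delta phi ->
  bform P (phi 0) (f phi v) <= sigma * (hist_norm Delta phi ^+ 2 + gamma (enorm v)).

(* The Lyapunov functional is W = V + kappa U with
   U(phi) = max_{tau in [-Delta, 0]} (1 + lambda tau) phi(tau)^T P phi(tau).
   When U increases, its maximum is attained at tau = 0, whence
   D^+ U <= - lambda U + A phi(0)^T P phi(0) + 2 sigma gamma(|v|); kappa is such
   that the second term is absorbed by - a |phi(0)|^2. *)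
Definition lyap_lambda := (2 * Delta + 1)^-1.
Definition lyap_A := lyap_lambda + 4 * sigma / p1.
Definition lyap_kappa := a / (p2 * lyap_A).
(** Half of the decay kappa lambda U is spent on c ||phi||^2; as ||phi||^2 <= (2 / p1) U, this asks
    for c (2 / p1) <= kappa lambda / 2. *)
Definition lyap_cbar := lyap_kappa * lyap_lambda * p1 / 4.
(** The other half of the decay, divided by the constant in W <= (2 abar / p1 + kappa) U. *)
Definition lyap_eta := (lyap_kappa * lyap_lambda / 2) / (2 * abar / p1 + lyap_kappa).
Hypothesis c_small : c < lyap_cbar.

Local Notation lam := lyap_lambda.
Local Notation A := lyap_A.
Local Notation kappa := lyap_kappa.
Local Notation eta := lyap_eta.

Lemma lyap_lambda_gt0 : 0 < lam.
Proof. by rewrite invr_gt0; have := D0; lra. Qed.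

Lemma lyap_A_gt0 : 0 < A.
Proof. by rewrite addr_gt0 ?lyap_lambda_gt0// divr_gt0// mulr_gt0. Qed.

Lemma lyap_kappa_gt0 : 0 < kappa.
Proof. by rewrite divr_gt0// mulr_gt0// lyap_A_gt0. Qed.

Lemma lyap_cbar_gt0 : 0 < lyap_cbar.
Proof.
apply: divr_gt0 => //; apply: mulr_gt0 => //.
by apply: mulr_gt0; [exact: lyap_kappa_gt0|exact: lyap_lambda_gt0].
Qed.

Lemma lyap_eta_gt0 : 0 < eta.
Proof.
apply: divr_gt0.
  apply: divr_gt0 => //.
  by apply: mulr_gt0; [exact: lyap_kappa_gt0|exact: lyap_lambda_gt0].
apply: addr_gt0; last exact: lyap_kappa_gt0.
by apply: divr_gt0 => //; exact: mulr_gt0.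
Qed.

(** The choice of lambda gives 2 lambda Delta <= 1, the 1 in its denominator covering Delta = 0.
    Weights of at least 1/2 make U comparable with ||phi||^2. *)
Lemma weight_bounds tau : - Delta <= tau <= 0 -> 2^-1 <= 1 + lam * tau <= 1.
Proof.
move=> /andP[t1 t2]; have Dge := D0; have l0 := lyap_lambda_gt0.
have lD : lam * Delta <= 2^-1.
  by rewrite mulrC ler_pdivrMr; lra.
have h1 : lam * (- Delta) <= lam * tau by apply: ler_wpM2l => //; exact: ltW.
have h2 : lam * tau <= 0 by apply: mulr_ge0_le0 => //; exact: ltW.
by rewrite mulrN in h1; apply/andP; split; lra.
Qed.

Lemma bform_ge0 z : 0 <= bform P z z.
Proof. by apply: le_trans (P_low z); rewrite mulr_ge0 ?sqr_ge0// ltW. Qed.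

Section Trajectory.
Variables (y : R -> 'cV[R]_n) (u : R -> 'cV[R]_m) (b K r C : R).
Hypothesis yc : continuous y.
Hypothesis y_bnd : forall t, enorm (y t) <= r.
Hypothesis b_ge0 : 0 <= b.
Hypothesis y_lip : forall s t, 0 <= s -> s <= t -> t <= b -> enorm (y t - y s) <= C * (t - s).
Hypotheses (C_ge0 : 0 <= C) (r_ge0 : 0 <= r) (K_ge0 : 0 <= K).
Hypothesis y_der : {ae mu, forall t, 0 < t < b -> is_derive t 1 y (f (hist_at y t) (u t))}.
Hypothesis u_bnd : {ae mu, forall s, 0 <= s <= b -> enorm (u s) <= K}.
Implicit Types (s t h e tau : R).

Let G := gamma K.
Let q s := bform P (y s) (y s).
Let U t := sup [set (1 + lam * tau) * q (t + tau) | tau in `[- Delta, 0]].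
Let N t := hist_norm Delta (hist_at y t).
Let W t := V (hist_at y t) + kappa * U t.
(** The input contributes G through V and 2 sigma kappa G through kappa U. *)
Let B := (1 + 2 * sigma * kappa) * G.

Let G_ge0 : 0 <= G.
Proof. by rewrite -gamma0; exact: gamma_mono. Qed.

Let q_ge0 s : 0 <= q s. Proof. exact: bform_ge0. Qed.

Let q_le s : q s <= p2 * enorm (y s) ^+ 2.
Proof. by apply: le_trans (ler_norm _) _; rewrite expr2; exact: P_up. Qed.

Let sqr_le (x z : R) : 0 <= x -> x <= z -> x ^+ 2 <= z ^+ 2.
Proof. by move=> x0 xz; rewrite ler_pXn2r// nnegrE// (le_trans x0). Qed.

Let hs t : hist_space Delta (hist_at y t). Proof. exact: hist_at_space. Qed.

Let N_le t : N t <= r.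
Proof. by apply: (hist_norm_at_le D0) => s _; exact: y_bnd. Qed.

Let N_ge0 t : 0 <= N t. Proof. exact: hist_norm_ge0. Qed.

Let y_le_N t tau : - Delta <= tau <= 0 -> enorm (y (t + tau)) <= N t.
Proof. by move=> ht; exact: (hist_norm_ub D0 (@hs t) ht). Qed.

Let weighted_le t tau : - Delta <= tau <= 0 -> (1 + lam * tau) * q (t + tau) <= p2 * N t ^+ 2.
Proof.
move=> ht; have /andP[w1 w2] := weight_bounds ht.
apply: (@le_trans _ _ (q (t + tau))); first by rewrite ler_piMl.
apply: le_trans (q_le _) _; rewrite ler_pM2l//; apply: sqr_le; first exact: enorm_ge0.
exact: y_le_N.
Qed.

Let U_ub t tau : - Delta <= tau <= 0 -> (1 + lam * tau) * q (t + tau) <= U t.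
Proof.
move=> ht; apply: ub_le_sup; last by exists tau => //=; rewrite in_itv.
exists (p2 * N t ^+ 2) => z [s /=]; rewrite in_itv/= => hs' <-; exact: weighted_le.
Qed.

Let U_le t (z : R) :
  (forall tau, - Delta <= tau <= 0 -> (1 + lam * tau) * q (t + tau) <= z) -> U t <= z.
Proof.
move=> H; apply: ge_sup.
  by exists ((1 + lam * 0) * q (t + 0)), 0 => //=; rewrite in_itv/= lexx oppr_le0 D0.
by move=> z' [s /=]; rewrite in_itv/= => hs' <-; exact: H.
Qed.

Let zero_in : - Delta <= (0 : R) <= (0 : R).
Proof. by rewrite lexx oppr_le0 D0. Qed.

Let q_le_U t : q t <= U t.
Proof. by have := U_ub t zero_in; rewrite mulr0 !addr0 mul1r. Qed.

Let U_ge0 t : 0 <= U t. Proof. exact: le_trans (q_le_U t). Qed.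

Let U_le_N t : U t <= p2 * N t ^+ 2.
Proof. by apply: U_le => tau; exact: weighted_le. Qed.

Let N_le_U t : p1 / 2 * N t ^+ 2 <= U t.
Proof.
have X0 : 0 <= 2 * U t / p1 by rewrite divr_ge0 ?mulr_ge0// ltW.
suff : N t <= Num.sqrt (2 * U t / p1).
  move=> /(sqr_le (N_ge0 t)); rewrite sqr_sqrtr// ler_pdivlMr//.
  by lra.
apply: (hist_norm_le D0) => tau ht; rewrite -(@ler_pXn2r _ 2)// ?nnegrE ?sqrtr_ge0 ?enorm_ge0//.
rewrite [leRHS]sqr_sqrtr// ler_pdivlMr// mulrC /hist_at.
have /andP[w1 _] := weight_bounds ht.
apply: le_trans (P_low _) _; rewrite -/(q (t + tau)).
have := U_ub t ht; have := ler_wpM2r (q_ge0 (t + tau)) w1; lra.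
Qed.

Let Cq := p2 * (C * (2 * r)).
Let Cq_ge0 : 0 <= Cq. Proof. by rewrite !mulr_ge0// ltW. Qed.

(** Difference of squares: the factor y(t) + y(s) is at most 2 r, whence [Cq]. *)
Let q_lip s t : 0 <= s -> s <= t -> t <= b -> q t <= q s + Cq * (t - s).
Proof.
move=> s0 st tb.
have -> : q t = q s + bform P (y t - y s) (y t + y s).
  exact: bform_diff.
rewrite lerD2l; apply: le_trans (ler_norm _) _; apply: le_trans (P_up _ _) _.
rewrite /Cq -!mulrA ler_pM2l//.
apply: (@le_trans _ _ ((C * (t - s)) * (2 * r))); last by rewrite -!mulrA (mulrC (t - s)) -!mulrA.
apply: ler_pM; rewrite ?enorm_ge0//; first exact: y_lip.
by apply: le_trans (enormD _ _) _; have := y_bnd t; have := y_bnd s; lra.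
Qed.

(* Shifting the window by h multiplies the old part of the weighted maximum by
   at most 1 - lambda h; only the values on ]t, t + h] are new. *)
Let U_shift t h (z : R) : 0 <= h -> (1 - lam * h) * U t <= z ->
  (forall j, 0 < j <= h -> q (t + j) <= z) -> U (t + h) <= z.
Proof.
move=> h0 Uz qz; apply: U_le => tau /[dup] ht /andP[t1 t2].
have l0 := lyap_lambda_gt0; have /andP[w1 w2] := weight_bounds ht.
have [th|th] := leP tau (- h).
  have -> : t + h + tau = t + (tau + h) by ring.
  have ht' : - Delta <= tau + h <= 0 by apply/andP; split; lra.
  have /andP[w1' w2'] := weight_bounds ht'.
  apply: le_trans Uz; have lh : 0 <= lam * h by rewrite mulr_ge0// ltW.
  have h1 : 1 + lam * tau <= (1 - lam * h) * (1 + lam * (tau + h)).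
    have : lam * h * (lam * (tau + h)) <= 0.
      by apply: mulr_ge0_le0 => //; apply: mulr_ge0_le0; [exact: ltW|lra].
    by lra.
  have lh1 : 0 <= 1 - lam * h.
    by have := ler_wpM2l (ltW l0) (ltac:(lra) : tau <= - h); rewrite mulrN; lra.
  apply: le_trans (ler_wpM2r (q_ge0 _) h1) _; rewrite -mulrA.
  by apply: ler_wpM2l => //; exact: U_ub.
apply: (@le_trans _ _ (q (t + h + tau))); first by rewrite ler_piMl.
by rewrite -addrA; apply: qz; apply/andP; split; lra.
Qed.

Let U_growth t h : 0 <= t -> 0 <= h -> t + h <= b -> U (t + h) <= U t + Cq * h.
Proof.
move=> t0 h0 tb; apply: U_shift => //.
  have l0 := lyap_lambda_gt0.
  have := mulr_ge0 (mulr_ge0 (ltW l0) h0) (U_ge0 t); have := mulr_ge0 Cq_ge0 h0; lra.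
move=> j /andP[j0 jh]; apply: le_trans (q_lip t0 _ _) _; [lra|lra|].
rewrite addrAC subrr add0r lerD//; exact: ler_wpM2l.
Qed.

Let D t := 4 * sigma / p1 * U t + 2 * sigma * G.

Let D_ge0 t : 0 <= D t.
Proof.
apply: addr_ge0; apply: mulr_ge0 => //; last by apply: mulr_ge0 => //; exact: ltW.
by apply: divr_ge0; [apply: mulr_ge0 => //|]; exact: ltW.
Qed.

Let N_le_U' t : N t ^+ 2 <= 2 / p1 * U t.
Proof.
have p12 : 0 <= 2 / p1 by apply: divr_ge0 => //; exact: ltW.
have -> : N t ^+ 2 = 2 / p1 * (p1 / 2 * N t ^+ 2) by field; rewrite gt_eqF.
exact: ler_wpM2l.
Qed.

Let gamma_le_G t : enorm (u t) <= K -> gamma (enorm (u t)) <= G.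
Proof. by move=> uK; apply: gamma_mono => //; exact: enorm_ge0. Qed.

(** The growth hypothesis on P, with ||x_t||^2 replaced by (2 / p1) U, where the weights cost the
    factor 2. *)
Let q_slope t : enorm (u t) <= K -> 2 * bform P (y t) (f (hist_at y t) (u t)) <= D t.
Proof.
move=> /gamma_le_G uG.
have := P_growth (u t) (@hs t); rewrite {1}/hist_at addr0 -/(N t) => H.
have NU := ler_wpM2l (ltW sigma_gt0) (lerD (N_le_U' t) uG).
have -> : D t = 2 * (sigma * (2 / p1 * U t + G)) by rewrite /D; field; rewrite gt_eqF.
by rewrite ler_pM2l//; exact: le_trans NU.
Qed.

Let q_expand t j (w : 'cV[R]_n) : q (t + j) = q t + 2 * (j * bform P (y t) w) +
  (2 * bform P (y t) (y (t + j) - y t - j *: w) +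
   bform P (y (t + j) - y t) (y (t + j) - y t)).
Proof.
rewrite /q (bform_expand P_sym _ (y t)).
have -> : j * bform P (y t) w = bform P (y t) (j *: w) by rewrite bformZr.
have -> : bform P (y t) (y (t + j) - y t) =
    bform P (y t) (j *: w) + bform P (y t) (y (t + j) - y t - j *: w).
  by rewrite -bformDr; congr (bform P _ _); rewrite [RHS]addrC subrK.
by move: (bform _ _ _) (bform _ _ _) (bform _ _ _) (bform _ _ _) => ? ? ? ?; ring.
Qed.

(** Uniform in j, with h in place of j on the right since [D] is nonnegative: [U_shift] needs all
    values that enter the window at once. Half of e pays for the linearization error, half for the
    quadratic term. *)
Let q_dini t e : 0 <= t < b -> is_derive t 1 y (f (hist_at y t) (u t)) ->
  enorm (u t) <= K -> 0 < e ->
  \forall h \near 0^'+, forall j, 0 < j <= h -> q (t + j) <= q t + h * (D t + e).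
Proof.
move=> /andP[t0 tb] yd /q_slope dq e0; set w := f _ _ in yd dq.
have r1 : 0 < r + 1 by rewrite ltr_wpDl.
have e1 : 0 < e / (4 * (p2 * (r + 1))).
  by apply: divr_gt0 => //; apply: mulr_gt0 => //; exact: mulr_gt0.
have /near0P[d1 d10 H1] := (is_derive_enormP y t w).1 yd _ e1.
set e' := e / _ in e1 H1.
have pC : 0 <= p2 * (C * C) by apply: mulr_ge0; [exact: ltW|exact: mulr_ge0].
have C2 : 0 < p2 * (C * C) + 1 by rewrite ltr_wpDl.
have bt : 0 < b - t by rewrite subr_gt0.
have eC : 0 < e / 2 / (p2 * (C * C) + 1) by apply: divr_gt0 => //; exact: divr_gt0.
apply/near0rP; exists (Num.min d1 (Num.min (b - t) (e / 2 / (p2 * (C * C) + 1)))).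
  by rewrite lt_min d10 lt_min bt eC.
move=> h; rewrite lt_min => /andP[h0 /andP[hd1]]; rewrite lt_min => /andP[hb hC] j /andP[j0 jh].
have jd : `|j| < d1 by rewrite gtr0_norm// (le_lt_trans jh).
have yj := H1 j jd; rewrite gtr0_norm// in yj.
have t1 : t <= t + j by rewrite lerDl ltW.
have t2 : t + j <= b by rewrite -lerBrDl (le_trans jh)// ltW.
have yl : enorm (y (t + j) - y t) <= C * j.
  by have := y_lip t0 t1 t2; rewrite addrAC subrr add0r.
have R1 : 2 * (j * bform P (y t) w) <= h * D t.
  rewrite mulrCA; apply: le_trans (ler_wpM2l (ltW j0) dq) _.
  by apply: ler_wpM2r.
have R2 : 2 * bform P (y t) (y (t + j) - y t - j *: w) <= h * (e / 2).
  apply: (@le_trans _ _ (2 * (p2 * ((r + 1) * (e' * j))))).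
    rewrite ler_pM2l//; apply: le_trans (le_trans (ler_norm _) (P_up _ _)) _.
    rewrite ler_pM2l//; apply: ler_pM; rewrite ?enorm_ge0//.
    by apply: le_trans (y_bnd t) _; rewrite lerDl.
  have -> : 2 * (p2 * ((r + 1) * (e' * j))) = j * (e / 2).
    rewrite /e'; have p2n : p2 != 0 by rewrite gt_eqF.
    have rn : r + 1 != 0 by rewrite gt_eqF.
    by field; apply/andP.
  by apply: ler_wpM2r => //; apply: divr_ge0 => //; exact: ltW.
have R3 : bform P (y (t + j) - y t) (y (t + j) - y t) <= h * (e / 2).
  apply: le_trans (le_trans (ler_norm _) (P_up _ _)) _.
  apply: (@le_trans _ _ (p2 * ((C * j) * (C * j)))).
    by rewrite ler_pM2l//; apply: ler_pM; rewrite ?enorm_ge0.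
  have jj : j * j <= h * h by apply: ler_pM => //; exact: ltW.
  have hC' : h * (p2 * (C * C) + 1) <= e / 2 by rewrite -ler_pdivlMr// ltW.
  have h0' : 0 <= h := ltW h0.
  have := ler_wpM2l h0' hC'; apply: le_trans.
  have -> : p2 * (C * j * (C * j)) = (p2 * (C * C)) * (j * j) by ring.
  apply: le_trans (ler_wpM2l pC jj) _.
  have -> : h * (h * (p2 * (C * C) + 1)) = p2 * (C * C) * (h * h) + h * h by ring.
  by rewrite lerDl mulr_ge0.
rewrite (q_expand t j w) -addrA lerD2l.
have -> : h * (D t + e) = h * D t + (h * (e / 2) + h * (e / 2)) by field.
by apply: lerD => //; exact: lerD.
Qed.

Let U_dini t e : 0 <= t < b -> is_derive t 1 y (f (hist_at y t) (u t)) ->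
  enorm (u t) <= K -> 0 < e ->
  \forall h \near 0^'+, U (t + h) <= U t + h * (- lam * U t + A * q t + 2 * sigma * G + e).
Proof.
move=> htb yd uK e0; have rem := q_dini htb yd uK e0.
have l0 := lyap_lambda_gt0; have A0 := lyap_A_gt0; have Dt := D_ge0 t.
have h0s : \forall h \near (0 : R)^'+, 0 < h by exact: nbhs_right_gt.
have Aq : A * q t = lam * q t + 4 * sigma / p1 * q t by rewrite /A mulrDl.
have [qU|qU] := leP (U t) (q t).
  have qUE : q t = U t by apply/le_anti; rewrite q_le_U qU.
  apply: filterS (filterI h0s rem) => h [h0 H].
  have hD : - lam * U t + A * q t + 2 * sigma * G + e = D t + e.
    rewrite Aq qUE /D; move: (U t) (G) => U' G'; ring.
  rewrite hD; apply: U_shift; first exact: ltW.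
    have h1 := mulr_ge0 (mulr_ge0 (ltW l0) (ltW h0)) (U_ge0 t).
    have h2 := mulr_ge0 (ltW h0) (addr_ge0 Dt (ltW e0)).
    rewrite mulrBl mul1r; apply: (@le_trans _ _ (U t)); first by rewrite gerBl.
    by rewrite lerDl.
  by move=> j hj; rewrite -qUE; exact: H.
(* S is the speed at which the bound on the new values of q and the shrinking (1 - lambda h) U
   approach each other, so h < (U - q) / S keeps them apart. *)
pose S := D t + e + lam * U t.
have S0 : 0 < S.
  apply: ltr_wpDr; first by apply: mulr_ge0 => //; exact: ltW.
  by rewrite ltr_wpDl.
have g0 : 0 < (U t - q t) / S by apply: divr_gt0 => //; rewrite subr_gt0.
have hsm : \forall h \near (0 : R)^'+, h < (U t - q t) / S by exact: nbhs_right_lt.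
apply: filterS (filterI h0s (filterI hsm rem)) => h [h0 [hs' H]].
have pos : 0 <= A * q t + 2 * sigma * G + e.
  apply: addr_ge0; last exact: ltW.
  apply: addr_ge0; apply: mulr_ge0 => //; first exact: ltW.
  by apply: mulr_ge0 => //; exact: ltW.
have hp := mulr_ge0 (ltW h0) pos.
have UE : (1 - lam * h) * U t <= U t + h * (- lam * U t + A * q t + 2 * sigma * G + e).
  have -> : U t + h * (- lam * U t + A * q t + 2 * sigma * G + e) =
    (1 - lam * h) * U t + h * (A * q t + 2 * sigma * G + e) by move: (U t) (q t) G => *; ring.
  by rewrite lerDl.
apply: U_shift => //; first exact: ltW.
move=> j hj; apply: le_trans (H j hj) _; apply: le_trans UE.
have : h * S <= U t - q t by rewrite -ler_pdivlMr// ltW.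
have -> : (1 - lam * h) * U t = U t - h * (lam * U t) by move: (U t) => *; ring.
by rewrite /S; lra.
Qed.

(** Used twice: with v = u(t) and a small rho where y is differentiable, and with v = 0 and rho = C
    + F at every time. The distance rho h between the true history and the driver shift costs L rho
    per unit of time; the ball of radius rr contains the shift for h < 1. *)
Let V_step (L rr rho : R) t (v : 'cV[R]_m) e : 0 <= L -> 0 <= rho -> r + rho <= rr ->
  (forall phi psi, hist_space Delta phi -> hist_space Delta psi ->
    hist_norm Delta phi <= rr -> hist_norm Delta psi <= rr ->
    `|V phi - V psi| <= L * hist_norm Delta (phi \- psi)) ->
  (\forall h \near 0^'+, forall j, 0 <= j <= h ->
    enorm (y (t + j) - y t - j *: f (hist_at y t) v) <= rho * h) ->
  0 < e ->
  \forall h \near 0^'+, V (hist_at y (t + h)) <= V (hist_at y t) +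
    h * (- a * enorm (y t) ^+ 2 + c * N t ^+ 2 + gamma (enorm v) + e + L * rho).
Proof.
move=> L0 rho0 rrr HL yw e0; set w := f _ _ in yw.
have := V_driver v (@hs t); rewrite -/w {2}/hist_at addr0 -/(N t) => dd.
have h0s : \forall h \near (0 : R)^'+, 0 < h by exact: nbhs_right_gt.
have h1s : \forall h \near (0 : R)^'+, h < 1 by exact: nbhs_right_lt.
apply: filterS (filterI h0s (filterI h1s (filterI yw (driver_derivative_le dd e0)))).
move=> h [h0 [h1 [yh Vh]]].
have hd := driver_shift_dist D0 (ltW h0) rho0 yh.
have sp : hist_space Delta (driver_shift (hist_at y t) h w) by exact: driver_shift_space.
have rh : rho * h <= rho by rewrite ler_piMr// ltW.
have n1 : hist_norm Delta (hist_at y (t + h)) <= rr.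
  by apply: le_trans (N_le _) _; apply: le_trans rrr; rewrite lerDl.
have n2 : hist_norm Delta (driver_shift (hist_at y t) h w) <= rr.
  apply: le_trans (hist_norm_triangle D0 sp (@hs (t + h))) _.
  rewrite hist_norm_distC; apply: le_trans rrr; apply: lerD; first exact: N_le.
  exact: le_trans rh.
have := HL _ _ (@hs (t + h)) sp n1 n2.
move=> /(le_trans (ler_norm _)) VV; have := le_trans VV (ler_wpM2l L0 hd).
rewrite lerBlDl => /le_trans; apply; apply: le_trans (lerD Vh (lexx _)) _.
have E (v' x : R) : v' + h * (x + L * rho) = v' + h * x + L * (rho * h) by ring.
by rewrite E.
Qed.

(* At the exceptional times, V is compared with its driver derivative for v = 0:
   since y is Lipschitz, a wrong direction only costs a bounded rate. This holds
   for every continuous initial history, although V along the trajectory need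
   not be absolutely continuous on [0, Delta]. *)
Let W_growth : exists2 Cw, 0 <= Cw & forall t, 0 <= t < b ->
  \forall h \near 0^'+, W (t + h) <= W t + Cw * h.
Proof.
have [F F0 HF] := rhs_bounded D0 flip r f0.
have CF0 : 0 <= C + F by exact: addr_ge0.
have [L L0 HL] := functional_lipschitz D0 Vlip (r + (C + F)).
have k0 := lyap_kappa_gt0.
exists (c * r ^+ 2 + 1 + L * (C + F) + kappa * Cq).
  apply: addr_ge0; last by apply: mulr_ge0 => //; exact: ltW.
  apply: addr_ge0; last exact: mulr_ge0.
  by apply: addr_ge0 => //; apply: mulr_ge0 => //; exact: sqr_ge0.
move=> t /andP[t0 tb]; have bt : 0 < b - t by rewrite subr_gt0.
have h0s : \forall h \near (0 : R)^'+, 0 < h by exact: nbhs_right_gt.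
have hbs : \forall h \near (0 : R)^'+, h < b - t by exact: nbhs_right_lt.
have yw : \forall h \near 0^'+, forall j, 0 <= j <= h ->
    enorm (y (t + j) - y t - j *: f (hist_at y t) 0) <= (C + F) * h.
  apply: filterS hbs => h hb j /andP[j0 jh].
  have t1 : t <= t + j by rewrite lerDl.
  have t2 : t + j <= b by rewrite -lerBrDl (le_trans jh)// ltW.
  have yl := y_lip t0 t1 t2; rewrite addrAC subrr add0r in yl.
  have fF : enorm (f (hist_at y t) 0) <= F.
    by apply: HF; [exact: hs|exact: N_le|rewrite enorm0].
  apply: le_trans (enormB _ _) _; rewrite enormZ ger0_norm//.
  apply: le_trans (lerD yl (ler_wpM2l j0 fF)) _; rewrite (mulrC j) -mulrDl.
  exact: ler_wpM2l.
have Vs := V_step L0 CF0 (lexx _) HL yw ltr01.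
apply: filterS (filterI h0s (filterI hbs Vs)) => h [h0 [hb Vh]].
have Uh : U (t + h) <= U t + Cq * h.
  by apply: U_growth => //; [exact: ltW|rewrite -lerBrDl ltW].
have kU := ler_wpM2l (ltW k0) Uh; rewrite mulrDr in kU.
rewrite enorm0 gamma0 addr0 in Vh.
have NN : c * N t ^+ 2 <= c * r ^+ 2 by apply: ler_wpM2l => //; exact: sqr_le.
have aa : - a * enorm (y t) ^+ 2 <= 0.
  by rewrite mulNr oppr_le0; apply: mulr_ge0; [exact: ltW|exact: sqr_ge0].
have gg : - a * enorm (y t) ^+ 2 + c * N t ^+ 2 + 1 + L * (C + F) <=
  c * r ^+ 2 + 1 + L * (C + F) by rewrite !lerD2r; rewrite -[leRHS]add0r; exact: lerD.
have hg := ler_wpM2l (ltW h0) gg.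
rewrite /W; apply: le_trans (lerD Vh kU) _.
have E (v k Y : R) : v + k + (Y + kappa * Cq) * h = v + h * Y + (k + kappa * (Cq * h)).
  by ring.
by rewrite E; apply: lerD => //; rewrite lerD2l.
Qed.

Let W_le_U t : 0 <= W t <= (2 * abar / p1 + kappa) * U t.
Proof.
have /andP[V0 Vb] := V_bounds (@hs t); have k0 := lyap_kappa_gt0.
apply/andP; split; first by apply: addr_ge0 => //; apply: mulr_ge0 => //; exact: ltW.
rewrite mulrDl lerD2r; apply: le_trans Vb _.
have E (x : R) : 2 * abar / p1 * x = abar * (2 / p1 * x) by field; rewrite gt_eqF.
by rewrite E; apply: ler_wpM2l; [exact: ltW|exact: N_le_U'].
Qed.

(** The budget: kappa A q is paid by a |y|^2 through q <= p2 |y|^2, and the decay kappa lambda U is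
    split evenly between c N^2 and eta W. *)
Let dissipation t : - a * enorm (y t) ^+ 2 + c * N t ^+ 2 + G +
  kappa * (- lam * U t + A * q t + 2 * sigma * G) <= - (eta * W t) + B.
Proof.
have k0 := lyap_kappa_gt0; have A0 := lyap_A_gt0; have l0 := lyap_lambda_gt0.
have e0 := lyap_eta_gt0.
have kq : kappa * (A * q t) <= a * enorm (y t) ^+ 2.
  have -> : kappa * (A * q t) = a / p2 * q t.
    by rewrite /kappa; field; rewrite !gt_eqF.
  have ap : 0 <= a / p2 by apply: divr_ge0; exact: ltW.
  apply: le_trans (ler_wpM2l ap (q_le t)) _.
  by rewrite mulrA divfK// gt_eqF.
have cN : c * N t ^+ 2 <= kappa * lam / 2 * U t.
  apply: le_trans (ler_wpM2l c_ge0 (N_le_U' t)) _.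
  have -> : kappa * lam / 2 * U t = lyap_cbar * (2 / p1 * U t).
    by rewrite /lyap_cbar; field; rewrite gt_eqF.
  apply: ler_wpM2r; last exact: ltW.
  by apply: mulr_ge0 => //; apply: divr_ge0 => //; exact: ltW.
have eW : eta * W t <= kappa * lam / 2 * U t.
  have /andP[_ WU] := W_le_U t; apply: le_trans (ler_wpM2l (ltW e0) WU) _.
  rewrite mulrA /eta divfK// gt_eqF//; apply: addr_gt0 => //.
  by apply: divr_gt0 => //; exact: mulr_gt0.
rewrite /B; move: kq cN eW; rewrite mulNr.
move: (enorm (y t) ^+ 2) (N t ^+ 2) (W t) (q t) (U t) G => y2 N2 W' q' U' G' *.
lra.
Qed.

Let W_dini : {ae mu, forall t, 0 <= t < b -> forall e, 0 < e ->
  \forall h \near 0^'+, W (t + h) <= W t + h * (- (eta * (W t - B / eta)) + e)}.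
Proof.
have k0 := lyap_kappa_gt0; have e0 := lyap_eta_gt0.
have [L L0 HL] := functional_lipschitz D0 Vlip (r + 1).
apply: ae_imp (ae_and (ae_neq 0) (ae_and y_der u_bnd)) => t [tn0 [yd uK']] /andP[t0 tb].
have {}tn0 : 0 < t by rewrite lt_neqAle eq_sym tn0.
have {}yd : is_derive t 1 y (f (hist_at y t) (u t)) by apply: yd; rewrite tn0.
have {uK'}uK : enorm (u t) <= K by apply: uK'; rewrite t0 ltW.
move=> e ep.
have L1 : 0 < L + 1 by rewrite ltr_wpDl.
(* The slack e is split as e/4 for the driver derivative, e/4 for L rho and e/2 for kappa U; rho <=
   1 keeps the radius r + 1 valid. *)
pose rho := Num.min 1 (e / 4 / (L + 1)).
have e4 : 0 < e / 4 by exact: divr_gt0.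
have rho0 : 0 < rho by rewrite lt_min ltr01 divr_gt0.
have rho1 : rho <= 1 by rewrite ge_min lexx.
have Lrho : L * rho <= e / 4.
  have : rho <= e / 4 / (L + 1) by rewrite ge_min lexx orbT.
  by rewrite ler_pdivlMr// mulrDr mulr1 (mulrC rho); apply: le_trans; rewrite lerDl ltW.
have yw : \forall h \near 0^'+, forall j, 0 <= j <= h ->
    enorm (y (t + j) - y t - j *: f (hist_at y t) (u t)) <= rho * h.
  have /near0P[d d0 H] := (is_derive_enormP y t _).1 yd _ rho0.
  apply/near0rP; exists d => // h /andP[h0 hd] j /andP[j0 jh].
  have := H j; rewrite ger0_norm// => /(_ (le_lt_trans jh hd)) /le_trans; apply.
  by rewrite ler_pM2l.
have rr : r + rho <= r + 1 by rewrite lerD2l.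
have Vs := V_step L0 (ltW rho0) rr HL yw e4.
have ek : 0 < e / 2 / kappa by apply: divr_gt0 => //; exact: divr_gt0.
have htb : 0 <= t < b by rewrite t0.
have Us := U_dini htb yd uK ek.
have h0s : \forall h \near (0 : R)^'+, 0 < h by exact: nbhs_right_gt.
apply: filterS (filterI h0s (filterI Vs Us)) => h [h0 [Vh Uh]].
have kU := ler_wpM2l (ltW k0) Uh; rewrite mulrDr in kU.
rewrite -[W (t + h)]/(V (hist_at y (t + h)) + kappa * U (t + h)).
apply: le_trans (lerD Vh kU) _.
have E (v k x z : R) : v + h * x + (k + kappa * (h * z)) = (v + k) + h * (x + kappa * z).
  by ring.
rewrite E; apply: lerD; first exact: lexx.
rewrite ler_pM2l//.
have ke : kappa * (e / 2 / kappa) = e / 2 by rewrite mulrC divfK// gt_eqF.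
have eB : eta * (W t - B / eta) = eta * W t - B.
  by rewrite mulrBr (mulrC eta (B / eta)) divfK// gt_eqF.
have := dissipation t; have uG := gamma_le_G uK.
rewrite eB (mulrDr kappa _ (e / 2 / kappa)) ke.
by lra.
Qed.

(** V is continuous along the trajectory because x_t is continuous in the sup norm; for U the
    one-sided growth bound started at s suffices. *)
Let W_lusc t e : 0 < t <= b -> 0 < e ->
  exists2 d, 0 < d & forall s, 0 <= s -> t - d < s < t -> W t <= W s + e.
Proof.
move=> /andP[t0 tb] e0; have k0 := lyap_kappa_gt0.
have [L L0 HL] := functional_lipschitz D0 Vlip r.
have L1 : 0 < L + 1 by rewrite ltr_wpDl.
have q0 : 0 < e / 2 / (L + 1) by apply: divr_gt0 => //; exact: divr_gt0.
have kC : 0 <= kappa * Cq by apply: mulr_ge0 => //; exact: ltW.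
have kC1 : 0 < kappa * Cq + 1 by rewrite ltr_wpDl.
have d20 : 0 < e / 2 / (kappa * Cq + 1) by apply: divr_gt0 => //; exact: divr_gt0.
have /nbhs_ballP[d /= d0 Hd] := hist_at_uniform D0 t yc q0.
exists (Num.min d (e / 2 / (kappa * Cq + 1))); first by rewrite lt_min d0.
move=> s s0 /andP[s1 st].
have s1d : t - d < s by apply: le_lt_trans s1; rewrite lerB// ge_min lexx.
have s1d' : t - s <= e / 2 / (kappa * Cq + 1).
  rewrite lerBlDr -lerBlDl; apply: le_trans (ltW s1); rewrite lerB// ge_min lexx orbT//.
have hd : hist_norm Delta (hist_at y s \- hist_at y t) <= e / 2 / (L + 1).
  by apply: Hd; rewrite /ball/= gtr0_norm ?subr_gt0// ltrBlDr -ltrBlDl.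
have VV : V (hist_at y t) <= V (hist_at y s) + e / 2.
  have := HL _ _ (@hs t) (@hs s) (N_le t) (N_le s); rewrite hist_norm_distC.
  move=> /(le_trans (ler_norm _)) X; have := le_trans X (ler_wpM2l L0 hd).
  rewrite lerBlDl => /le_trans; apply; rewrite lerD2l.
  by rewrite mulrCA ger_pMr ?divr_gt0// ler_pdivrMr// mul1r lerDl.
have UU : kappa * U t <= kappa * U s + e / 2.
  have ts : t = s + (t - s) by rewrite addrC subrK.
  have := @U_growth s (t - s) s0; rewrite subr_ge0 (ltW st) -ts => /(_ isT tb) X.
  apply: le_trans (ler_wpM2l (ltW k0) X) _; rewrite mulrDr lerD2l mulrA.
  apply: le_trans (ler_wpM2l kC s1d') _.
  by rewrite mulrCA ger_pMr ?divr_gt0// ler_pdivrMr// mul1r lerDl.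
rewrite /W; apply: le_trans (lerD VV UU) _.
by rewrite addrACA lerD2l -splitr.
Qed.

(** [dini_gronwall] with the level k = B / eta. At b only kappa U is kept from W, with kappa p1
    |y|^2 <= kappa q <= kappa U; at 0, V and U are both bounded by the squared initial norm. *)
Lemma trajectory_bound : kappa * p1 * enorm (y b) ^+ 2 <=
  expR (- (lyap_eta * b)) * ((abar + kappa * p2) * hist_norm Delta (hist_at y 0) ^+ 2) +
  (1 + 2 * sigma * kappa) * gamma K / lyap_eta.
Proof.
have k0 := lyap_kappa_gt0; have e0 := lyap_eta_gt0.
have B0 : 0 <= B.
  apply: mulr_ge0 => //; apply: addr_ge0 => //.
  by apply: mulr_ge0; [apply: mulr_ge0 => //|]; exact: ltW.
have Be : 0 <= B / eta by apply: divr_ge0 => //; exact: ltW.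
have [Cw Cw0 HCw] := W_growth.
have cc : 0 <= 2 * abar / p1 + kappa.
  by apply: addr_ge0; [apply: divr_ge0; [apply: mulr_ge0 => //|]|]; exact: ltW.
have WM t : 0 <= t <= b -> `|W t - B / eta| <= (2 * abar / p1 + kappa) * (p2 * r ^+ 2) + B / eta.
  move=> _; have /andP[W0 WU] := W_le_U t.
  have Wr : W t <= (2 * abar / p1 + kappa) * (p2 * r ^+ 2).
    apply: le_trans WU _; apply: ler_wpM2l => //; apply: le_trans (U_le_N t) _.
    by rewrite ler_pM2l//; exact: sqr_le.
  have X0 := le_trans W0 Wr; rewrite ler_norml; apply/andP; split; lra.
have := dini_gronwall b_ge0 e0 Cw0 WM W_lusc HCw W_dini.
have E0 := expR_gt0 (- (eta * b)).
have W0 : W 0 <= (abar + kappa * p2) * hist_norm Delta (hist_at y 0) ^+ 2.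
  have /andP[_ Vb] := V_bounds (@hs 0); rewrite mulrDl; apply: lerD => //.
  by rewrite -mulrA; apply: ler_wpM2l; [exact: ltW|exact: U_le_N].
move=> Wb; apply: (@le_trans _ _ (W b)).
  have /andP[V0 _] := V_bounds (@hs b); rewrite /W -[leLHS]add0r; apply: lerD => //.
  rewrite -mulrA; apply: ler_wpM2l; first exact: ltW.
  exact: le_trans (P_low _) (q_le_U b).
apply: le_trans Wb _; rewrite -/eta -/G -/B lerD2r; apply: ler_wpM2l; first exact: ltW.
by apply: le_trans W0; rewrite gerBl.
Qed.

End Trajectory.
End Lyapunov.

(** * From the Lyapunov estimate to exponential input-to-state stability *)

Theorem theorem3 (R : realType) (Delta : R) (n m : nat)
    (abar a sigma : R) (P : 'M[R]_n)
    (Delta_ge0 : 0 <= Delta) (n_gt0 : (0 < n)%N) (m_gt0 : (0 < m)%N)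
    (abar_gt0 : 0 < abar) (a_gt0 : 0 < a) (sigma_gt0 : 0 < sigma)
    (P_sym : P^T = P)
    (P_posdef : forall z : 'cV[R]_n, z != 0 -> 0 < (z^T *m P *m z) 0 0) :
  exists2 cbar : R, 0 < cbar &
    forall (f : (R -> 'cV[R]_n) -> 'cV[R]_m -> 'cV[R]_n)
           (V : (R -> 'cV[R]_n) -> R) (c : R) (gamma : R -> R),
      lipschitz_on_bounded_rhs Delta f ->
      f (fun=> 0) 0 = 0 ->
      lipschitz_on_bounded_functional Delta V ->
      0 <= c ->
      class_N gamma ->
      (forall phi : R -> 'cV[R]_n, hist_space Delta phi ->
        0 <= V phi <= abar * hist_norm Delta phi ^+ 2) ->
      (forall (phi : R -> 'cV[R]_n) (v : 'cV[R]_m), hist_space Delta phi ->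
        (driver_derivative V phi (f phi v)
          <= (- a * enorm (phi 0) ^+ 2 + c * hist_norm Delta phi ^+ 2
              + gamma (enorm v))%:E)%E) ->
      (forall (phi : R -> 'cV[R]_n) (v : 'cV[R]_m), hist_space Delta phi ->
        ((phi 0)^T *m P *m f phi v) 0 0
          <= sigma * (hist_norm Delta phi ^+ 2 + gamma (enorm v))) ->
      c < cbar ->
      exp_iss Delta f /\
      ((exists2 gamma0 : R, 0 <= gamma0 &
          forall s : R, 0 <= s -> gamma s = gamma0 * s ^+ 2) ->
        exp_iss_linear_gain Delta f).
Proof.
have [p1 p1_gt0 P_low] := posdef_lower P_sym P_posdef.
have [p2 p2_gt0 P_up] := bform_upper P.
exists (lyap_cbar Delta a sigma p1 p2); first exact: lyap_cbar_gt0.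
move=> f V c gamma flip f0 Vlip c_ge0 [gamma_cont gamma_mono gamma0] V_bounds V_driver P_growth hc.
pose kap := lyap_kappa Delta a sigma p1 p2.
pose eta := lyap_eta Delta a abar sigma p1 p2.
have kap0 : 0 < kap by exact: lyap_kappa_gt0.
have eta0 : 0 < eta by exact: lyap_eta_gt0.
(* [k0] and [M0] are the coefficients of [trajectory_bound] after division by kappa p1. *)
pose k0 := (abar + kap * p2) / (kap * p1).
pose M0 := (1 + 2 * sigma * kap) / (eta * kap * p1).
have kp : 0 < kap * p1 by exact: mulr_gt0.
have k00 : 0 < k0.
  by apply: divr_gt0 => //; apply: addr_gt0 => //; exact: mulr_gt0.
have M00 : 0 <= M0.
  apply: divr_ge0; last by apply: mulr_ge0; [apply: mulr_ge0|]; exact: ltW.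
  by apply: addr_ge0 => //; apply: mulr_ge0; [apply: mulr_ge0 => //|]; exact: ltW.
have gamma_ge0 s : 0 <= s -> 0 <= gamma s by move=> s0; rewrite -gamma0; exact: gamma_mono.
(* The trajectory estimate is used on [0, t] for each t separately, with K the input norm up to that
   same t, so the bound involves the past input only. *)
have key x0 u T x t : hist_space Delta x0 -> input_space u ->
    solution Delta f x0 u T x -> 0 <= t -> (t%:E < T)%E ->
    enorm (x t) <= Num.sqrt k0 * hist_norm Delta x0 * expR (- (eta / 2 * t)) +
      Num.sqrt (M0 * gamma (fine (input_norm u t))).
  move=> hx0 hu sx t0 tT; have K0 := fine_input_norm_ge0 u t.
  have uK := input_norm_bound hu t0; set K := fine _ in K0 uK *.
  have sy := solution_clamp Delta_ge0 flip sx t0 tT.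
  set y := x \o _ in sy; have [yc yac yd] := sy.
  have Dt : - Delta <= t by apply: le_trans t0; rewrite oppr_le0.
  have [r r0 yr] := bounded_on_segment yc Dt.
  have y_bnd s : enorm (y s) <= r.
    have := yr _ (clamp_itv s Dt); rewrite /y /= clamp_id//; exact: clamp_itv.
  have [C C0 y_lip] := solves_lipschitz Delta_ge0 flip f0 sy uK.
  have := trajectory_bound Delta_ge0 flip f0 Vlip P_sym p1_gt0 p2_gt0 a_gt0 abar_gt0
    sigma_gt0 c_ge0 P_low P_up gamma_mono gamma0 V_bounds V_driver P_growth hc
    yc y_bnd t0 y_lip C0 r0 K0 yd uK.
  rewrite -/kap -/eta.
  have -> : hist_norm Delta (hist_at y 0) = hist_norm Delta x0.
    apply: hist_norm_ext => tau /[dup] ht /andP[h1 h2].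
    rewrite /hist_at add0r /y /= clamp_id ?h1 ?(le_trans h2)//.
    exact: (solution_start sx).
  have -> : y t = x t by rewrite /y /= clamp_id// Dt lexx.
  have N0 := hist_norm_ge0 Delta_ge0 hx0; set N := hist_norm _ _ in N0 *.
  set E := expR _ => H.
  set a1 := Num.sqrt k0 * N * _; set b1 := Num.sqrt _.
  have a10 : 0 <= a1 by rewrite !mulr_ge0 ?sqrtr_ge0 ?expR_ge0.
  have b10 : 0 <= b1 by exact: sqrtr_ge0.
  have a1E : a1 ^+ 2 = k0 * N ^+ 2 * E.
    rewrite /a1 !exprMn sqr_sqrtr ?(ltW k00)// (expr2 (expR _)) -expRD.
    by congr (_ * expR _); field.
  have b1E : b1 ^+ 2 = M0 * gamma K.
    by rewrite sqr_sqrtr// mulr_ge0// gamma_ge0.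
  (* a1^2 + b1^2 <= (a1 + b1)^2 separates the two contributions; a1 carries the rate eta / 2, as its
     square has the rate eta. *)
  apply: enorm_le; first exact: addr_ge0.
  apply: (@le_trans _ _ (a1 ^+ 2 + b1 ^+ 2)); last first.
    rewrite sqrrD -addrA lerD2l; rewrite lerDr.
    by apply: mulrn_wge0; exact: mulr_ge0.
  rewrite a1E b1E -(ler_pM2l kp); apply: (le_trans H).
  rewrite le_eqVlt; apply/orP; left; apply/eqP.
  have nz : (kap != 0) /\ (p1 != 0) by rewrite !gt_eqF.
  by rewrite /k0 /M0; field; rewrite !gt_eqF.
(* Leaving [mu] open serves both gains; its monotonicity bounds the a priori estimate on compact
   time intervals, as continuation requires. *)
have est mu : (forall s, 0 <= s -> Num.sqrt (M0 * gamma s) <= mu s) ->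
    (forall s t, 0 <= s -> s <= t -> mu s <= mu t) ->
    exp_iss_estimate Delta f (Num.sqrt k0) (eta / 2) mu.
  move=> mu_ge mu_mono x0 u hx0 hu.
  pose B t := Num.sqrt k0 * hist_norm Delta x0 * expR (- (eta / 2 * t)) +
    mu (fine (input_norm u t)).
  have apriori T x : solution Delta f x0 u T x ->
      forall t, 0 <= t -> (t%:E < T)%E -> enorm (x t) <= B t.
    move=> sx t t0 tT; apply: le_trans (key _ _ _ _ _ hx0 hu sx t0 tT) _.
    by rewrite lerD2l; apply: mu_ge; exact: fine_input_norm_ge0.
  have B_bounded b : exists M, forall t, 0 <= t <= b -> B t <= M.
    exists (Num.sqrt k0 * hist_norm Delta x0 + mu (fine (input_norm u b))).
    move=> t /andP[t0 tb]; apply: lerD.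
      apply: ler_piMr; first by rewrite mulr_ge0 ?sqrtr_ge0//; exact: hist_norm_ge0.
      rewrite -[leRHS]expR0 ler_expR oppr_le0 mulr_ge0// divr_ge0//; exact: ltW.
    apply: mu_mono; first exact: fine_input_norm_ge0.
    exact: fine_input_norm_mono.
  have [ex all] := maximal_solutions_global Delta_ge0 flip f0 hx0 hu apriori B_bounded.
  split=> // T x mx; have TE := all T x mx; split=> // t t0.
  by case: mx => sx _; apply: (apriori T x sx t t0); rewrite TE ltry.
have sk0 : 0 < Num.sqrt k0 by rewrite sqrtr_gt0.
have e20 : 0 < eta / 2 by exact: divr_gt0.
have mono s t : 0 <= s -> s <= t -> Num.sqrt (M0 * gamma s) <= Num.sqrt (M0 * gamma t).
  by move=> s0 st; apply: ler_wsqrtr; apply: ler_wpM2l => //; exact: gamma_mono.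
split.
  exists (Num.sqrt k0), (eta / 2), (fun s => Num.sqrt (M0 * gamma s)).
  split=> //; last exact: est.
  split=> //; last by rewrite gamma0 mulr0 sqrtr0.
  move=> s; apply: (@cvg_comp _ _ _ gamma (fun z => Num.sqrt (M0 * z)) _ _ _ (gamma_cont s)).
  apply: (@continuous_comp _ _ _ (fun z => M0 * z) Num.sqrt); last exact: sqrt_continuous.
  by apply: cvgMr; exact: cvg_id.
move=> [g0 g00 gE]; exists (Num.sqrt k0), (eta / 2), (Num.sqrt (M0 * g0)).
split=> //; apply: est => [s s0|s t s0 st]; last by apply: ler_wpM2l.
(* For gamma(s) = g0 s^2 the square root is exactly sqrt(M0 g0) s. *)
by rewrite gE// mulrA (sqrtrM _ (mulr_ge0 M00 g00)) sqrtr_sqr ger0_norm.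
Qed.
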